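(* Assume $\tau\ge \frac52$ and let $\{x_i\}_{i=0}^N$ be the Bakhvalov-type mesh with parameter $\tau$ described in the context. Let $u$ be the solution of the two-parameter boundary value problem and $u^N\in V^N$ its linear finite element approximation on this mesh. Then there is a constant $C>0$, independent of $\varepsilon_1,\varepsilon_2$ and $N$, such that $$\Vert u-u^N\Vert_E\le C(\varepsilon_2+\varepsilon_1^{\frac12})^{\frac12}N^{-1}+CN^{-2}.$$
   Context: Problem. Let $\Omega=(0,1)$ and consider $$-\varepsilon_1u''+\varepsilon_2b(x)u'+c(x)u=f(x)\ \text{ in }\Omega,\qquad u(0)=u(1)=0,$$ with small parameters $0<\varepsilon_1,\varepsilon_2\ll1$, functions $b,c,f$ sufficiently smooth on $\bar\Omega=[0,1]$ (in $C^q(\bar\Omega)$ with $q\ge 3$), and constants $\lambda,\beta,\gamma>0$ with $b\ge\lambda$, $c\ge\beta$, $c-\frac12\varepsilon_2b'\ge\gamma$ on $\bar\Omega$. The solution $u\in H_0^1(\Omega)$ is unique. Layer parameters. For $x\in[0,1]$ let $g_0(x)<0<g_1(x)$ be the two real roots $g$ of $-\varepsilon_1g^2+\varepsilon_2b(x)g+c(x)=0$, and set $\mu_0=-\max_{0\le x\le1}g_0(x)$, $\mu_1=\min_{0\le x\le1}g_1(x)$; one has $1\ll\mu_0\le\mu_1$. Fix $p,\kappa\in(0,1)$ and assume $q\Vert b'\Vert_{L^\infty(\Omega)}\varepsilon_2\le\kappa(1-p)$. Mesh. Let $N\ge16$ be an integer divisible by $4$, $\tau\geq 1$ a parameter, and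 $\sigma_j=\frac{\tau}{p\mu_j}\ln\mu_j$ for $j=0,1$, where it is assumed that $\sigma_j\le\frac14$. It is also assumed throughout that $\mu_1^{-1}\le\mu_0^{-1}\le N^{-1}$. With $t_i=i/N$, $\varphi_0(t)=-\ln(1-4(1-\mu_0^{-1})t)$ and $\varphi_1(t)=-\ln(1-4(1-\mu_1^{-1})(1-t))$, the Bakhvalov-type mesh is $$x_i=\begin{cases}\frac{\tau}{p\mu_0}\varphi_0(t_i), & i=0,\dots,\frac N4,\\ \sigma_0+2(t_i-\frac14)(1-\sigma_0-\sigma_1), & i=\frac N4,\dots,\frac{3N}4,\\ 1-\frac{\tau}{p\mu_1}\varphi_1(t_i), & i=\frac{3N}4,\dots,N.\end{cases}$$ Finite element method. $V^N$ is the space of continuous functions on $[0,1]$ that vanish at $0$ and $1$ and are linear on each $[x_i,x_{i+1}]$. With $(\cdot,\cdot)$ the $L^2(\Omega)$ inner product, let $a(v,w)=\varepsilon_1(v',w')+\varepsilon_2(bv',w)+(cv,w)$. The finite element solution $u^N\in V^N$ is the unique element with $a(u^N,v^N)=(f,v^N)$ for all $v^N\in V^N$. The energy norm is $\Vert v\Vert_E^2=\varepsilon_1|v|_1^2+\Vert v\Vert^2$, where $\Vert\cdot\Vert$ is the $L^2(\Omega)$ norm and $|v|_1=\Vert v'\Vert$. Constants. $C$ denotes a generic positive constant independent of $\varepsilon_1,\varepsilon_2,N$ (different occurrences may differ). *)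

(* Defs.v *)
(* MathComp world: MathComp-Analysis, over an arbitrary R : realType. *)
From HB Require Import structures.
From mathcomp Require Import all_boot all_order all_algebra.
From mathcomp Require Import all_classical all_reals all_analysis.

Set Implicit Arguments.
Unset Strict Implicit.
Unset Printing Implicit Defensive.
Import Order.TTheory GRing.Theory Num.Theory.
Import numFieldNormedType.Exports.
Local Open Scope classical_set_scope.
Local Open Scope ring_scope.

(* All functions are total R -> R; only their values on [0,1] matter. *)

Definition Omega {R : realType} : set R := `]0, 1[.

Definition Omega_bar {R : realType} : set R := `[0, 1].

(* C^q of the closed interval: the derivatives of order <= q exist in the open
   interval and extend continuously to the closed one. *)
Definition Cq (R : realType) (q : nat) (g : R -> R) : Prop :=
  [/\ {within Omega_bar, continuous g},
      forall k x, (k < q)%N -> Omega x -> derivable (g^`(k))%classic x 1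
    & forall k, (k <= q)%N -> exists2 h : R -> R,
        {within Omega_bar, continuous h} & forall x, Omega x -> h x = (g^`(k))%classic x].

(* 'N[mu]_p is taken over the whole line, hence the extension by 0. *)
Definition Linfty_norm (R : realType) (g : R -> R) : \bar R :=
  ('N[lebesgue_measure]_+oo [ (EFin \o g) \_ Omega ])%E.

Definition ip (R : realType) (v w : R -> R) : R :=
  \int[lebesgue_measure]_(x in Omega) (v x * w x).

Definition L2 (R : realType) (g : R -> R) : Prop :=
  measurable_fun (Omega : set (measurableTypeR R)) g /\
  (\int[lebesgue_measure]_(x in Omega) ((g x) ^+ 2)%:E < +oo)%E.

(* In one dimension H^1(Omega) consists of the (continuous representatives of)
   primitives of L^2 functions, the integrand being the weak derivative. *)
Definition is_weak_derivative (R : realType) (v dv : R -> R) : Prop :=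
  L2 dv /\
  forall x, Omega_bar x ->
    v x = v 0 + \int[lebesgue_measure]_(t in `]0, x[) dv t.

(* H^1_0(Omega). *)
Definition H10 (R : realType) (v : R -> R) : Prop :=
  [/\ exists dv, is_weak_derivative v dv, v 0 = 0 & v 1 = 0].

(* The weak derivative is unique up to a null set, so no integral below depends
   on the representative picked here. *)
Definition weak_deriv (R : realType) (v : R -> R) : R -> R :=
  xget (fun=> 0) [set dv | is_weak_derivative v dv].

Definition bilin (R : realType) (eps1 eps2 : R) (b c v w : R -> R) : R :=
  eps1 * ip (weak_deriv v) (weak_deriv w)
  + eps2 * ip (b \* weak_deriv v) w
  + ip (c \* v) w.

Definition energy_norm (R : realType) (eps1 : R) (v : R -> R) : R :=
  Num.sqrt (eps1 * ip (weak_deriv v) (weak_deriv v) + ip v v).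

(* The solution in H^1_0(Omega) of - eps1 u'' + eps2 b u' + c u = f, understood
   weakly; this includes every classical solution. *)
Definition bvp_solution (R : realType) (eps1 eps2 : R) (b c f u : R -> R) :
    Prop :=
  H10 u /\ forall v, H10 v -> bilin eps1 eps2 b c u v = ip f v.

(* mu0 = - max g0 and mu1 = min g1, where g0 x < 0 < g1 x are the roots g of
   - eps1 g^2 + eps2 b(x) g + c(x) = 0. *)
Definition layer_parameters (R : realType) (eps1 eps2 : R) (b c : R -> R)
    (mu0 mu1 : R) : Prop :=
  exists g0 g1 : R -> R,
  [/\ forall x, Omega_bar x ->
        [/\ g0 x < 0, 0 < g1 x,
            - eps1 * g0 x ^+ 2 + eps2 * b x * g0 x + c x = 0
          & - eps1 * g1 x ^+ 2 + eps2 * b x * g1 x + c x = 0],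
      (exists2 x, Omega_bar x & g0 x = - mu0) /\
      (forall x, Omega_bar x -> g0 x <= - mu0)
    & (exists2 x, Omega_bar x & g1 x = mu1) /\
      (forall x, Omega_bar x -> mu1 <= g1 x)].

Definition sigma (R : realType) (tau p mu : R) : R := tau / (p * mu) * ln mu.

Definition phi0 (R : realType) (mu0 t : R) : R :=
  - ln (1 - 4 * (1 - mu0^-1) * t).

Definition phi1 (R : realType) (mu1 t : R) : R :=
  - ln (1 - 4 * (1 - mu1^-1) * (1 - t)).

Definition mesh (R : realType) (tau p mu0 mu1 : R) (N i : nat) : R :=
  let t := i%:R / N%:R in
  let s0 := sigma tau p mu0 in
  let s1 := sigma tau p mu1 in
  if (i <= N %/ 4)%N then tau / (p * mu0) * phi0 mu0 t
  else if (i <= 3 * (N %/ 4))%N then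
    s0 + 2 * (t - 1 / 4) * (1 - s0 - s1)
  else 1 - tau / (p * mu1) * phi1 mu1 t.

(* V^N, for mesh points x 0, ..., x N. *)
Definition VN (R : realType) (N : nat) (x : nat -> R) (v : R -> R) : Prop :=
  [/\ {within Omega_bar, continuous v}, v 0 = 0, v 1 = 0
    & forall i, (i < N)%N -> exists r s : R,
        forall y, x i <= y <= x i.+1 -> v y = r * y + s].

Definition fem_solution (R : realType) (eps1 eps2 : R) (b c f : R -> R)
    (N : nat) (x : nat -> R) (uN : R -> R) : Prop :=
  VN N x uN /\
  forall vN, VN N x vN -> bilin eps1 eps2 b c uN vN = ip f vN.

(* Main.v *)
(* The weak solution [u] is classical. Let [G] be the positive root of the symbol
   at [1]. Subtracting [E = A (exp (- G (1 - x)) - exp (- G))], with [A] such that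
   [w = u - E] has [w' 1 = 0], leaves a [w] with
   [|w''| <= C (1 + mu0^2 e0 + mu1 e1)], where [e0] and [e1] decay exponentially
   from [0] and [1] at the rates [p mu0] and [p mu1]: apply the maximum principle
   with exponential barriers to [w], [w'] and [w''] in turn, the slopes of the
   barriers bounding the boundary values of [w'] and [w''].
   Compare [u^N] with the interpolant of [w] plus that of [E], the latter cut off
   outside its layer, where [e1^2 <= C N^-5]. By coercivity and Young's inequality,
   after integrating by parts the convection term of the interpolation error of
   [E], the squared energy norm of the error is at most [C (d N^-2 + N^-4)] with
   [d = eps2 + sqrt eps1], since [d mu0 <= C] and [eps1 mu1 <= C d].
   The barriers require [eps2 |b'|] to be small compared with [c]. If it is not,
   [eps2] is bounded below, so [N <= mu0 <= C] and stability suffices. *)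

Require Import Defs.
From HB Require Import structures.
From mathcomp Require Import all_boot all_order all_algebra.
From mathcomp Require Import all_classical all_reals all_analysis.
From mathcomp Require Import measurable_realfun zify ring lra.
Set Implicit Arguments.
Unset Strict Implicit.
Unset Printing Implicit Defensive.
Import Order.TTheory GRing.Theory Num.Theory.
Import numFieldNormedType.Exports.
Local Open Scope classical_set_scope.
Local Open Scope ring_scope.

(** * Square-integrable functions *)

Section SquareIntegrable.
Context {R : realType}.
Notation mu := (@lebesgue_measure R).
Implicit Types f g h k : R -> R.

(** Two opposite demands force the splitting. The convection term of an interpolation error can be
    kept, at the cost of [e2 ^+ 2] times its squared H1 size, or integrated by parts, at the cost of
    [e2 ^+ 2 / e1] times its squared L2 size. For the layer at 1 the former brings in
    [e2 ^+ 2 * mu1], which may be large; for the rest of [u] nothing offsets the factor of the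
    latter. So only the layer at 1 is split off, its squared L2 error gaining [1 / mu1] from the
    layer width, and the H1 error of [w] must be free of [mu1]. The condition [w' 1 = 0] buys this:
    one power of [mu1] less in [w'']. Next to each transition point lies an oversized cell, whose
    length times [mu] is not uniformly bounded. At 0, convexity of the dominating exponential makes
    up for this. At 1, the interpolant of [E] is zero through that cell, and the next one, of length
    about [1 / mu1], carries the jump back to [E]. There [e1] is at most [lden] to the power [tau],
    with [lden] of order [1 / N]; [5 / 2] makes the square [N^-5], and [N] cells sum to [N^-4]. *)

Lemma measurable_Omega : measurable (Omega : set (measurableTypeR R)).
Proof. exact: measurable_itv. Qed.
Local Hint Resolve measurable_Omega : core.

Lemma L2_bounded f M : measurable_fun (Omega : set (measurableTypeR R)) f ->
  (forall x, Omega x -> `|f x| <= M) -> L2 f.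
Proof.
move=> mf fM; split=> //.
apply: (@le_lt_trans _ _ (\int[mu]_(x in Omega) (M ^+ 2)%:E)%E).
  apply: ge0_le_integral => //.
  - by move=> x _; rewrite lee_fin sqr_ge0.
  - by apply/measurable_EFinP; apply: measurable_funX.
  - move=> x Ox; rewrite lee_fin -real_normK ?num_real//.
    by rewrite lerXn2r ?nnegrE// ?fM// (le_trans _ (fM _ Ox)).
rewrite integral_cst//= lebesgue_measure_itv/= lte_fin ltr01.
by rewrite oppr0 adde0 mule1 ltry.
Qed.

Lemma L2_integrableM f g : L2 f -> L2 g ->
  mu.-integrable Omega (EFin \o (f \* g)).
Proof.
move=> [mf f2] [mg g2]; apply/integrableP; split.
  by apply/measurable_EFinP; apply: measurable_funM.
apply: (@le_lt_trans _ _ (\int[mu]_(x in Omega) (((f x) ^+ 2)%:E + ((g x) ^+ 2)%:E))%E).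
  apply: ge0_le_integral => //.
  - by apply: measurableT_comp => //; apply/measurable_EFinP; apply: measurable_funM.
  - by apply: emeasurable_funD; apply/measurable_EFinP; apply: measurable_funX.
  - move=> x Ox /=; rewrite lee_fin ler_norml.
    by apply/andP; split; nra.
rewrite ge0_integralD//; first exact: lte_add_pinfty.
- by move=> x _; rewrite lee_fin sqr_ge0.
- by apply/measurable_EFinP; apply: measurable_funX.
- by move=> x _; rewrite lee_fin sqr_ge0.
- by apply/measurable_EFinP; apply: measurable_funX.
Qed.

Lemma L2_cst (r : R) : L2 (cst r).
Proof. by apply: (@L2_bounded _ `|r|) => //; exact: measurable_cst. Qed.

Lemma L2_integrable f : L2 f -> mu.-integrable Omega (EFin \o f).
Proof.
move=> f2; have := L2_integrableM f2 (L2_cst 1).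
by apply: eq_integrable => // x _ /=; rewrite mulr1.
Qed.

Lemma L2P f : measurable_fun (Omega : set (measurableTypeR R)) f ->
  mu.-integrable Omega (EFin \o (f \* f)) -> L2 f.
Proof.
move=> mf /integrableP[_ f2]; split => //.
apply: le_lt_trans f2; apply: ge0_le_integral => //.
- by move=> x _; rewrite lee_fin sqr_ge0.
- by apply/measurable_EFinP; apply: measurable_funX.
- by apply: measurableT_comp => //; apply/measurable_EFinP; apply: measurable_funM.
- by move=> x _ /=; rewrite lee_fin expr2 ler_norm.
Qed.

Lemma L2M f g M : measurable_fun (Omega : set (measurableTypeR R)) f ->
  (forall x, Omega x -> `|f x| <= M) -> L2 g -> L2 (f \* g).
Proof.
move=> mf fM g2; have [mg _] := g2.
apply: L2P; first exact: measurable_funM.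
have /(@integrableZl _ _ R mu _ measurable_Omega (M ^+ 2)) := L2_integrableM g2 g2.
apply: le_integrable => //.
  by apply/measurable_EFinP; do 2?apply: measurable_funM.
move=> x Ox /=; rewrite lee_fin.
rewrite (_ : f x * g x * (f x * g x) = (f x) ^+ 2 * (g x * g x)); last by ring.
rewrite [leLHS]normrM [leRHS]normrM ler_wpM2r// !normrX lerXn2r ?nnegrE//.
by rewrite (le_trans (fM _ Ox))// ler_norm.
Qed.

Lemma L2D f g : L2 f -> L2 g -> L2 (f \+ g).
Proof.
move=> f2 g2; have [mf _] := f2; have [mg _] := g2.
apply: L2P; first exact: measurable_funD.
have i1 := L2_integrableM f2 f2; have i2 := L2_integrableM f2 g2.
have i3 := L2_integrableM g2 g2.
have := integrableD measurable_Omega (integrableD measurable_Omega i1 i2)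
  (integrableD measurable_Omega i2 i3).
by apply: eq_integrable => // x _ /=; rewrite -!EFinD; congr EFin; ring.
Qed.

Lemma L2Z (r : R) f : L2 f -> L2 (fun x => r * f x).
Proof.
by move=> f2; apply: (@L2M (cst r) f `|r|) => //; exact: measurable_cst.
Qed.

Lemma L2B f g : L2 f -> L2 g -> L2 (f \- g).
Proof.
move=> f2 g2; have := L2D f2 (L2Z (-1) g2).
by congr (L2 _); apply/funext => x /=; rewrite mulN1r.
Qed.

Lemma eq_L2 f g : {in Omega, f =1 g} -> L2 f -> L2 g.
Proof.
move=> fg [mf f2]; split; first exact: eq_measurable_fun mf.
by under eq_integral => x xO do rewrite -fg//.
Qed.

Lemma ipC f g : ip f g = ip g f.
Proof. by rewrite /ip; apply: eq_Rintegral => x _; rewrite mulrC. Qed.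

Lemma eq_ip f g h k : {in Omega, f =1 h} -> {in Omega, g =1 k} ->
  ip f g = ip h k.
Proof. by move=> fh gk; apply: eq_Rintegral => x xO; rewrite fh// gk. Qed.

Lemma ipDl f g h : L2 f -> L2 g -> L2 h -> ip (f \+ g) h = ip f h + ip g h.
Proof.
move=> f2 g2 h2; rewrite /ip -RintegralD//; try exact: L2_integrableM.
by apply: eq_Rintegral => x _; rewrite mulrDl.
Qed.

Lemma ipZl (r : R) f h : L2 f -> L2 h -> ip (fun x => r * f x) h = r * ip f h.
Proof.
move=> f2 h2; rewrite /ip -RintegralZl//; last exact: L2_integrableM.
by apply: eq_Rintegral => x _; rewrite mulrA.
Qed.

Lemma ipBl f g h : L2 f -> L2 g -> L2 h -> ip (f \- g) h = ip f h - ip g h.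
Proof.
move=> f2 g2 h2; rewrite /ip -RintegralB//; try exact: L2_integrableM.
by apply: eq_Rintegral => x _; rewrite mulrBl.
Qed.

Lemma ipDr f g h : L2 f -> L2 g -> L2 h -> ip h (f \+ g) = ip h f + ip h g.
Proof. by move=> *; rewrite ipC ipDl// [ip f h]ipC [ip g h]ipC. Qed.

Lemma ipBr f g h : L2 f -> L2 g -> L2 h -> ip h (f \- g) = ip h f - ip h g.
Proof. by move=> *; rewrite ipC ipBl// [ip f h]ipC [ip g h]ipC. Qed.

Lemma ipZr (r : R) f h : L2 f -> L2 h -> ip h (fun x => r * f x) = r * ip h f.
Proof. by move=> *; rewrite ipC ipZl// ipC. Qed.

Lemma ip_ge0 f : 0 <= ip f f.
Proof. by apply: Rintegral_ge0 => x _; rewrite -expr2 sqr_ge0. Qed.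

Lemma ip_le f g : L2 f -> L2 g -> (forall x, Omega x -> `|f x| <= `|g x|) ->
  ip f f <= ip g g.
Proof.
move=> f2 g2 fg; apply: le_Rintegral => //; try exact: L2_integrableM.
move=> x Ox; rewrite -!expr2 -[f x ^+ 2]real_normK ?num_real//.
by rewrite -[g x ^+ 2]real_normK ?num_real// lerXn2r ?nnegrE// fg.
Qed.

Lemma ip_le_cst f M : L2 f -> (forall x, Omega x -> `|f x| <= M) ->
  ip f f <= M ^+ 2.
Proof.
move=> f2 fM; apply: (le_trans (ip_le f2 (L2_cst M) _)).
  by move=> x Ox; rewrite (le_trans (fM _ Ox))// ler_norm.
rewrite -[leLHS]/(\int[mu]_(x in Omega) (M * M)) Rintegral_cst// /Omega.
by rewrite /= lebesgue_measure_itv/= lte_fin ltr01 oppr0 adde0 mulr1.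
Qed.

(** Expands the nonnegative squares of [t * f + g] and [t * f - g]; the two signs together bound the
    absolute value. *)
Lemma ip_young f g (t : R) : 0 < t -> L2 f -> L2 g ->
  2 * `|ip f g| <= t * ip f f + t^-1 * ip g g.
Proof.
move=> t0 f2 g2.
have tf := L2Z t f2.
have H1 := ip_ge0 (fun x => t * f x + g x).
have H2 := ip_ge0 (fun x => t * f x - g x).
move: H1; rewrite (ipDl tf g2 (L2D tf g2)) !(ipDr tf g2)// !ipZl// !ipZr//.
move: H2; rewrite (ipBl tf g2 (L2B tf g2)) !(ipBr tf g2)// !ipZl// !ipZr//.
rewrite [ip g f]ipC => H1 H2.
have H3 : 2 * t * `|ip f g| <= t * (t * ip f f) + ip g g.
  by case: (ger0P (ip f g)) => _; lra.
rewrite -(ler_pM2l t0) mulrDr mulVKf ?gt_eqF//; lra.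
Qed.

Lemma ae_eq_ip f g h : ae_eq mu Omega f g ->
  L2 f -> L2 g -> L2 h -> ip f h = ip g h.
Proof.
move=> fg [mf _] [mg _] [mh _]; rewrite /ip /Rintegral; congr fine.
apply: ae_eq_integral => //.
- by apply/measurable_EFinP; apply: measurable_funM.
- by apply/measurable_EFinP; apply: measurable_funM.
- move: fg => [N [mN N0 sN]]; exists N; split => // x /= H; apply: sN => /= H'.
  by apply: H => Ox; rewrite H'.
Qed.

Lemma ip_eq0_ae f : L2 f -> ip f f = 0 -> ae_eq mu Omega f (cst 0).
Proof.
move=> f2 f0; have [mf _] := f2.
have i2 := L2_integrableM f2 f2.
have H : (\int[mu]_(x in Omega) `|(f x * f x)%:E| = 0)%E.
  under eq_integral => x _ do rewrite gee0_abs ?lee_fin -?expr2 ?sqr_ge0// expr2.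
  by rewrite -[LHS]fineK ?(integrable_fin_num _ i2)// -/(Rintegral _ _ _) -/(ip f f) f0.
have mff := measurable_int _ i2.
have [+ _] := @ae_eq_integral_abs _ _ _ mu _ measurable_Omega _ mff.
move=> /(_ H) [N [mN N0 sN]].
exists N; split => // x /= H1; apply: sN => /= H2; apply: H1 => Ox.
by have [/eqP] := H2 Ox; rewrite mulf_eq0 orbb => /eqP.
Qed.

End SquareIntegrable.
#[global] Hint Resolve measurable_Omega : core.

(** * Weak derivatives *)

Section WeakDerivative.
Context {R : realType}.
Notation mu := (@lebesgue_measure R).
Implicit Types f g v w : R -> R.

Lemma Omega_bar0 : @Omega_bar R 0.
Proof. by rewrite /Omega_bar /= in_itv/= lexx ler01. Qed.

Lemma Omega_bar1 : @Omega_bar R 1.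
Proof. by rewrite /Omega_bar /= in_itv/= lexx ler01. Qed.

Lemma OmegaP (x : R) : Omega x <-> 0 < x < 1.
Proof. by rewrite /Omega /= in_itv. Qed.

Lemma Omega_barP (x : R) : Omega_bar x <-> 0 <= x <= 1.
Proof. by rewrite /Omega_bar /= in_itv. Qed.

Lemma Omega_sub : (@Omega R) `<=` Omega_bar.
Proof. by move=> x /OmegaP /andP[? ?]; apply/Omega_barP; rewrite !ltW. Qed.

Lemma within_measurable f : {within Omega_bar, continuous f} ->
  measurable_fun (Omega : set (measurableTypeR R)) f.
Proof.
move=> cf; apply: (@measurable_funS _ _ _ _ (Omega_bar : set (measurableTypeR R))) => //.
  exact: measurable_itv.
  exact: Omega_sub.
by apply: subspace_continuous_measurable_fun => //; exact: measurable_itv.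
Qed.

Lemma within_bounded f : {within Omega_bar, continuous f} ->
  exists2 M, 0 < M & forall x, Omega_bar x -> `|f x| <= M.
Proof.
move=> cf; have cnf : {within `[0, 1], continuous (fun x => `|f x|)}.
  by move=> x; apply: continuous_comp; [exact: cf|exact: norm_continuous].
have [c c01 cmax] := EVT_max ler01 cnf.
exists (`|f c| + 1); first by rewrite ltr_wpDl.
by move=> x Ox; rewrite (le_trans (cmax _ Ox))// lerDl.
Qed.

Lemma L2_within f : {within Omega_bar, continuous f} -> L2 f.
Proof.
move=> cf; have [M _ fM] := within_bounded cf.
by apply: (L2_bounded (within_measurable cf)) => x /Omega_sub; exact: fM.
Qed.

Lemma eq_within f g : {in Omega_bar, f =1 g} ->
  {within Omega_bar, continuous f} -> {within Omega_bar, continuous g}.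
Proof. by move=> fg cf; exact: (subspace_eq_continuous fg). Qed.

Lemma sub0x (x : R) : Omega_bar x -> (`]0, x[ : set R) `<=` Omega.
Proof.
move=> /Omega_barP/andP[x0 x1] t /=; rewrite in_itv/= => /andP[t0 tx].
by apply/OmegaP; rewrite t0 (lt_le_trans tx).
Qed.

Lemma L2_integrable0x g x : Omega_bar x -> L2 g ->
  mu.-integrable `]0, x[ (EFin \o g).
Proof.
move=> Ox g2; apply: integrableS (L2_integrable g2) => //.
exact: sub0x.
Qed.

Lemma eq_weak v w dv : {in Omega_bar, v =1 w} ->
  is_weak_derivative v dv -> is_weak_derivative w dv.
Proof.
move=> vw [d2 H]; split=> // x Ox.
rewrite -!vw ?inE//; first exact: H.
exact: Omega_bar0.
Qed.

Lemma eq_weak_deriv v dv dw : {in Omega, dv =1 dw} ->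
  is_weak_derivative v dv -> is_weak_derivative v dw.
Proof.
move=> vw [d2 H]; split=> [|x Ox]; first exact: eq_L2 d2.
rewrite H//; congr (_ + _); apply: eq_Rintegral => t.
by rewrite inE => /(sub0x Ox) Ot; rewrite vw// inE.
Qed.

Lemma ae_weak_deriv v dv dw : ae_eq mu Omega dv dw -> L2 dw ->
  is_weak_derivative v dv -> is_weak_derivative v dw.
Proof.
move=> [N [mN N0 sN]] w2 [d2 H]; split=> // x Ox.
rewrite H//; congr (_ + _); rewrite /Rintegral; congr fine.
apply: ae_eq_integral => //.
- exact: measurable_int (L2_integrable0x Ox d2).
- exact: measurable_int (L2_integrable0x Ox w2).
exists N; split=> // t Ht; apply: sN => Ht'; apply: Ht => /(sub0x Ox) Ot.
by rewrite (Ht' Ot).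
Qed.

Lemma weakD v w dv dw : is_weak_derivative v dv -> is_weak_derivative w dw ->
  is_weak_derivative (v \+ w) (dv \+ dw).
Proof.
move=> [v2 Hv] [w2 Hw]; split=> [|x Ox /=]; first exact: L2D.
rewrite Hv// Hw// RintegralD//; first by ring.
- exact: L2_integrable0x.
- exact: L2_integrable0x.
Qed.

Lemma weakZ (r : R) v dv : is_weak_derivative v dv ->
  is_weak_derivative (fun x => r * v x) (fun x => r * dv x).
Proof.
move=> [v2 Hv]; split=> [|x Ox /=]; first exact: L2Z.
by rewrite Hv// RintegralZl//; [ring|exact: L2_integrable0x].
Qed.

Lemma weakB v w dv dw : is_weak_derivative v dv -> is_weak_derivative w dw ->
  is_weak_derivative (v \- w) (dv \- dw).
Proof.
move=> [v2 Hv] [w2 Hw]; split=> [|x Ox /=]; first exact: L2B.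
rewrite Hv// Hw// RintegralB//; first by ring.
- exact: L2_integrable0x.
- exact: L2_integrable0x.
Qed.

Lemma weak_cst (r : R) : is_weak_derivative (cst r) (cst 0).
Proof.
split=> [|x Ox]; first exact: L2_cst.
by rewrite Rintegral_cst//= mul0r addr0.
Qed.

Lemma weak_primitive dv : L2 dv ->
  is_weak_derivative (fun x => \int[mu]_(t in `]0, x[) dv t) dv.
Proof.
move=> d2; split=> // x Ox.
have -> : [set` `]0, 0[%R] = (set0 : set R) by rewrite set_itv_ge// bnd_simp ltxx.
by rewrite Rintegral_set0 add0r.
Qed.

(* The two one-sided versions agree because a point is a null set. *)
Lemma Rintegral0x g x : Omega_bar x -> L2 g ->
  \int[mu]_(t in `]0, x[) g t = \int[mu]_(t in `[0, x]) (g \_ Omega) t.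
Proof.
move=> Ox g2.
have i0 : mu.-integrable `[0, x] (EFin \o (g \_ Omega)).
  rewrite -restrict_EFin; apply/integrable_restrict => //.
  by apply: integrableS (L2_integrable g2) => //; exact: measurableI.
have i1 : mu.-integrable `]0, x] (EFin \o (g \_ Omega)).
  by apply: integrableS i0 => //; exact: subset_itv_oc_cc.
have i2 : mu.-integrable `]0, x[ (EFin \o (g \_ Omega)).
  by apply: integrableS i0 => //; exact: subset_itv_oo_cc.
rewrite -Rintegral_itv_obnd_cbnd// -Rintegral_itv_bndo_bndc//.
apply: eq_Rintegral => t; rewrite inE => tx.
by rewrite patchE mem_set//; exact: sub0x tx.
Qed.

Lemma weak_within v dv : is_weak_derivative v dv ->
  {within Omega_bar, continuous v}.
Proof.
move=> [d2 H].
have i1 : mu.-integrable `[0, 1] (EFin \o (dv \_ Omega)).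
  rewrite -restrict_EFin; apply/integrable_restrict => //.
  by apply: integrableS (L2_integrable d2) => //; exact: measurableI.
have c1 := parameterized_integral_continuous ler01 i1.
apply: (@eq_within (fun x => v 0 + parameterized_integral mu 0 x (dv \_ Omega))).
  by move=> x; rewrite inE => Ox; rewrite (H x Ox) Rintegral0x.
by move=> x; apply: cvgD; [exact: cvg_cst|exact: c1].
Qed.

Lemma weak_L2 v dv : is_weak_derivative v dv -> L2 v.
Proof. by move=> /weak_within; exact: L2_within. Qed.

(** The difference of the two candidates has a primitive vanishing on [Omega_bar], and by Lebesgue
    differentiation it is almost everywhere the derivative of that primitive. *)
Lemma weak_uniq v dv dw : is_weak_derivative v dv -> is_weak_derivative v dw ->
  ae_eq mu Omega dv dw.
Proof.
move=> hv hw; have [d2 H] := weakB hv hw.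
set g := (dv \- dw) \_ Omega.
have ig : mu.-integrable setT (EFin \o g).
  by rewrite /g -restrict_EFin; apply: (integrable_mkcond _ measurable_Omega).1; exact: L2_integrable.
have igS (A : set R) : measurable (A : set (measurableTypeR R)) ->
    mu.-integrable A (EFin \o g).
  by move=> mA; exact: integrableS ig.
have lg : locally_integrable [set: R] g by apply: open_integrable_locally => //; exact: openT.
have [N [mN N0 sN]] := @FTC1 R g (BLeft 0) (fun y => igS _ (measurable_itv _)) lg.
exists N; split => // x Hx; apply: sN => /= Hx'; apply: Hx => Ox.
have /OmegaP/andP[x0 x1] := Ox.
have [] := Hx'; first by rewrite lte_fin.
move=> _; set F := (X in derive1 X); move=> F'.
suff : (F^`())%classic x = 0 :> R.
  rewrite F' /g patchE mem_set//= => /eqP; rewrite subr_eq0 => /eqP ->//.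
rewrite derive1E; rewrite (_ : 0 = 'D_1 (cst 0 : R -> R) x); last first.
  by rewrite derive_cst.
apply: near_eq_derive => //.
have : \forall y \near x, Omega y by exact: near_in_itvoo.
apply: filterS => y Oy; rewrite /F.
rewrite -Rintegral0x//; last exact: Omega_sub.
by have /= := H _ (Omega_sub Oy); lra.
Qed.

(* Integrating [f s * g t] over the triangle [s < t] in both orders. *)
Lemma triangle_Fubini f g : mu.-integrable setT (EFin \o f) ->
  mu.-integrable setT (EFin \o g) ->
  \int[mu]_s (f s * \int[mu]_(t in `]s, +oo[) g t) =
  \int[mu]_t (g t * \int[mu]_(s in `]-oo, t[) f s).
Proof.
move=> fi gi.
have mf := (measurable_EFinP _ _).1 (measurable_int _ fi).
have mg := (measurable_EFinP _ _).1 (measurable_int _ gi).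
pose h (z : measurableTypeR R * measurableTypeR R) : R :=
  if z.1 < z.2 then f z.1 * g z.2 else 0.
have mh : measurable_fun setT h.
  apply: measurable_fun_ifT.
  - by apply: measurable_fun_ltr; [exact: measurable_fst|exact: measurable_snd].
  - by apply: measurable_funM; [exact: (measurableT_comp mf)|exact: (measurableT_comp mg)].
  - exact: measurable_cst.
have ih : (mu \x mu)%E.-integrable setT (EFin \o h).
  apply/integrable12ltyP; first exact/measurable_EFinP.
  (* [h] is dominated by the product of the absolute values, whose iterated integral factors into
     two finite ones. *)
  have fgoo : (\int[mu]_x (`|(f x)%:E| * \int[mu]_y `|(g y)%:E|) < +oo)%E.
    have /integrableP[_ gi'] := gi.
    have gfin : (\int[mu]_y `|(g y)%:E|)%E \is a fin_num.
      by rewrite ge0_fin_numE// integral_ge0.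
    rewrite -(fineK gfin) ge0_integralZr//; last 2 first.
    - by apply: measurableT_comp => //; exact/measurable_EFinP.
    - by rewrite lee_fin fine_ge0// integral_ge0.
    have /integrableP[_ fi'] := fi.
    have ffin : (\int[mu]_y `|(f y)%:E|)%E \is a fin_num.
      by rewrite ge0_fin_numE// integral_ge0.
    by rewrite -(fineK ffin) -EFinM ltry.
  apply: le_lt_trans fgoo; apply: ge0_le_integral => //.
  - by move=> x _; apply: integral_ge0.
  - apply: (@measurable_fun_fubini_tonelli_F _ _ _ _ _ mu (fun z => `|(h z)%:E|%E)) => //.
    by apply: measurableT_comp => //; exact/measurable_EFinP.
  - by apply: emeasurable_funM => //; apply: measurableT_comp => //; exact/measurable_EFinP.
  - move=> x _; rewrite -ge0_integralZl//; last first.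
      by apply: measurableT_comp => //; exact/measurable_EFinP.
    apply: ge0_le_integral => //.
    + apply/measurable_EFinP; apply: measurableT_comp => //.
      exact: (measurableT_comp mh (measurable_pair1 x)).
    + by apply: emeasurable_funM => //; apply: measurableT_comp => //; exact/measurable_EFinP.
    + move=> y _; rewrite /h /=; case: ifP => _; first by rewrite normrM EFinM.
      by rewrite normr0 mule_ge0.
have := Fubini ih.
have inner1 s : (\int[mu]_t (h (s, t))%:E = (f s * \int[mu]_(t in `]s, +oo[) g t)%:E)%E.
  have igs : mu.-integrable `]s, +oo[ (EFin \o g) by apply: integrableS gi.
  rewrite EFinM /Rintegral fineK; last exact: integrable_fin_num.
  rewrite -integralZl// integral_mkcond; apply: eq_integral => t _.
  rewrite patchE; case: ifPn; rewrite /h/=.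
    by rewrite inE/= in_itv/= andbT => ->; rewrite EFinM.
  by rewrite notin_setE/= in_itv/= andbT => /negP/negbTE ->.
have inner2 t : (\int[mu]_s (h (s, t))%:E = (g t * \int[mu]_(s in `]-oo, t[) f s)%:E)%E.
  have igs : mu.-integrable `]-oo, t[ (EFin \o f) by apply: integrableS fi.
  rewrite EFinM /Rintegral fineK; last exact: integrable_fin_num.
  rewrite -integralZl// integral_mkcond; apply: eq_integral => s _.
  rewrite patchE; case: ifPn; rewrite /h/=.
    by rewrite inE/= in_itv/= => ->; rewrite -EFinM mulrC.
  by rewrite notin_setE/= in_itv/= => /negP/negbTE ->.
move=> H; rewrite /Rintegral; congr fine.
transitivity (\int[mu]_s \int[mu]_t (h (s, t))%:E)%E.
  by apply: eq_integral => s _; rewrite inner1.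
by rewrite [LHS]H; apply: eq_integral => t _; rewrite inner2.
Qed.

Lemma L2_mkcond0x g x : Omega_bar x -> L2 g ->
  mu.-integrable setT (EFin \o (g \_ `]0, x[)).
Proof.
move=> Ox g2; rewrite -restrict_EFin.
have mI : measurable ([set` `]0, x[%R] : set (measurableTypeR R)) by exact: measurable_itv.
by apply: (integrable_mkcond _ mI).1; exact: L2_integrable0x.
Qed.

(** Fubini on the triangle, applied to [dw] and [dv] cut off outside []0, x[]: the inner integrals
    are [v x - v s] and [w t - w 0], and expanding the products gives the formula without
    approximating by smooth functions. *)
Lemma weak_by_parts v w dv dw x :
  is_weak_derivative v dv -> is_weak_derivative w dw -> Omega_bar x ->
  \int[mu]_(t in `]0, x[) (dv t * w t) + \int[mu]_(t in `]0, x[) (v t * dw t) =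
  v x * w x - v 0 * w 0.
Proof.
move=> hv hw Ox; have [v2 Hv] := hv; have [w2 Hw] := hw.
have := triangle_Fubini (L2_mkcond0x Ox w2) (L2_mkcond0x Ox v2).
set f := dw \_ _; set g := dv \_ _.
have E1 : \int[mu]_s (f s * \int[mu]_(t in `]s, +oo[) g t) =
    \int[mu]_(s in `]0, x[) (dw s * (v x - v s)).
  rewrite [RHS]Rintegral_mkcond; apply: eq_Rintegral => s _.
  rewrite /f !patchE; case: ifPn => sx; last by rewrite mul0r.
  congr (_ * _); move: sx; rewrite inE => sx.
  have Os := Omega_sub (sub0x Ox sx).
  rewrite Hv// (Hv s)// opprD addrACA subrr add0r.
  have -> : \int[mu]_(t in `]0, x[) dv t - \int[mu]_(t in `]0, s[) dv t =
    \int[mu]_(t in `]s, x[) dv t.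
    have i1 : mu.-integrable `]0, x[ (EFin \o dv) by exact: L2_integrable0x.
    rewrite (Rintegral_itv_bndo_bndc (a := BRight 0) (r := s)); last exact: L2_integrable0x.
    apply: (Rintegral_itvB (a := BRight 0) (b := BLeft x)) => //.
      by move: sx => /=; rewrite in_itv/= => /andP[s0 _]; rewrite bnd_simp ltW.
    by move: sx => /=; rewrite in_itv/= => /andP[_ s0]; rewrite bnd_simp.
  rewrite Rintegral_mkcond [RHS]Rintegral_mkcond; apply: eq_Rintegral => t _.
  move: sx; rewrite /g !patchE /= in_itv/= => /andP[s0 sx].
  rewrite !mem_setE /= !in_itv/= andbT.
  by case: (ltP s t) => st //=; rewrite (lt_trans s0 st).
have E2 : \int[mu]_t (g t * \int[mu]_(s in `]-oo, t[) f s) =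
    \int[mu]_(t in `]0, x[) (dv t * (w t - w 0)).
  rewrite [RHS]Rintegral_mkcond; apply: eq_Rintegral => s _.
  rewrite /g !patchE; case: ifPn => sx; last by rewrite mul0r.
  congr (_ * _); move: sx; rewrite inE => sx.
  have Os := Omega_sub (sub0x Ox sx).
  rewrite (Hw s)// addrAC subrr add0r.
  rewrite Rintegral_mkcond [RHS]Rintegral_mkcond; apply: eq_Rintegral => t _.
  move: sx; rewrite /f !patchE /= in_itv/= => /andP[s0 sx].
  rewrite !mem_setE /= !in_itv/= .
  case: (ltP t s) => st //=; last by rewrite andbF.
  by rewrite (lt_trans st sx) andbT.
rewrite E1 E2 => E.
have iM (h k : R -> R) : L2 h -> L2 k -> mu.-integrable `]0, x[ (EFin \o (fun t => h t * k t)).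
  by move=> h2 k2; apply: integrableS (L2_integrableM h2 k2) => //; exact: sub0x.
have Lw := weak_L2 hw; have Lv := weak_L2 hv.
move: E; under eq_Rintegral do rewrite mulrBr.
under [in RHS]eq_Rintegral do rewrite mulrBr.
rewrite !RintegralB//; try by [exact: iM | exact: (iM _ _ w2 (L2_cst _)) | exact: (iM _ _ v2 (L2_cst _))].
rewrite !RintegralZr//; try exact: L2_integrable0x.
have -> : \int[mu]_(t in `]0, x[) dw t = w x - w 0 by rewrite (Hw x)//; ring.
have -> : \int[mu]_(t in `]0, x[) dv t = v x - v 0 by rewrite (Hv x)//; ring.
under [in X in _ - X]eq_Rintegral do rewrite mulrC.
by move=> E; lra.
Qed.

Lemma weakM v w dv dw : is_weak_derivative v dv -> is_weak_derivative w dw ->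
  is_weak_derivative (v \* w) ((dv \* w) \+ (v \* dw)).
Proof.
move=> hv hw; have [v2 _] := hv; have [w2 _] := hw.
have cv := weak_within hv; have cw := weak_within hw.
have [Mv _ bv] := within_bounded cv; have [Mw _ bw] := within_bounded cw.
have l1 : L2 (v \* dw).
  by apply: (L2M (M := Mv)) => //; [exact: within_measurable|move=> x /Omega_sub/bv].
have l2 : L2 (dv \* w).
  suff : L2 (w \* dv) by congr L2; apply/funext => x /=; rewrite mulrC.
  by apply: (L2M (M := Mw)) => //; [exact: within_measurable|move=> x /Omega_sub/bw].
split=> [|x Ox /=]; first exact: L2D.
rewrite RintegralD//; try exact: L2_integrable0x.
by rewrite (weak_by_parts hv hw Ox) addrC subrK.
Qed.

Lemma ip_by_parts v w dv dw :
  is_weak_derivative v dv -> is_weak_derivative w dw ->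
  ip dv w + ip v dw = v 1 * w 1 - v 0 * w 0.
Proof. by move=> hv hw; rewrite /ip (weak_by_parts hv hw Omega_bar1). Qed.

Lemma weak_derivP v dv : is_weak_derivative v dv ->
  is_weak_derivative v (weak_deriv v).
Proof. by move=> hv; rewrite /weak_deriv; case: xgetP => // /(_ dv). Qed.

Lemma weak_derivE v dv : is_weak_derivative v dv ->
  ae_eq mu Omega (weak_deriv v) dv.
Proof. by move=> hv; exact: weak_uniq (weak_derivP hv) hv. Qed.

Lemma energy_normE (e : R) v dv : is_weak_derivative v dv ->
  energy_norm e v = Num.sqrt (e * ip dv dv + ip v v).
Proof.
move=> hv; have h := weak_derivP hv; have ae := weak_derivE hv.
have [d2 _] := hv; have [w2 _] := h.
by rewrite /energy_norm (ae_eq_ip ae)// ipC (ae_eq_ip ae).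
Qed.

(** Frees later arguments from the representative chosen by [weak_deriv]: any weak derivative at
    hand may be used in the bilinear form. *)
Lemma bilinE (e1 e2 : R) b c v w dv dw :
  {within Omega_bar, continuous b} -> {within Omega_bar, continuous c} ->
  is_weak_derivative v dv -> is_weak_derivative w dw ->
  bilin e1 e2 b c v w = e1 * ip dv dw + e2 * ip (b \* dv) w + ip (c \* v) w.
Proof.
move=> cb cc hv hw.
have h := weak_derivP hv; have ae := weak_derivE hv.
have h' := weak_derivP hw; have ae' := weak_derivE hw.
have [d2 _] := hv; have [w2 _] := h; have [d2' _] := hw; have [w2' _] := h'.
have [M _ bM] := within_bounded cb.
have LM (k : R -> R) : L2 k -> L2 (b \* k).
  by move=> k2; apply: (L2M (M := M)) => //; [exact: within_measurable|move=> x /Omega_sub/bM].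
rewrite /bilin (ae_eq_ip ae)// [ip dv _]ipC (ae_eq_ip ae')// [ip dw _]ipC.
congr (_ + _ * _ + _); apply: ae_eq_ip; [|exact: LM|exact: LM|exact: weak_L2 hw].
case: ae => N [mN N0 sN]; exists N; split=> // x H; apply: sN => H'.
by apply: H => Ox /=; rewrite (H' Ox).
Qed.

Lemma weak_C1 v v1 : {within Omega_bar, continuous v} ->
  {within Omega_bar, continuous v1} ->
  (forall x, Omega x -> is_derive x 1 v (v1 x)) -> is_weak_derivative v v1.
Proof.
move=> cv cv1 dv; split; first exact: L2_within.
move=> x Ox; have /Omega_barP/andP[x0 x1] := Ox.
move: x0; rewrite le_eqVlt => /predU1P[<-|x0].
  have -> : [set` `]0, 0[%R] = (set0 : set R) by rewrite set_itv_ge// bnd_simp ltxx.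
  by rewrite Rintegral_set0 addr0.
have sub : `[0, x] `<=` (Omega_bar : set R).
  by move=> t /=; rewrite in_itv/= => /andP[t0 tx]; apply/Omega_barP; rewrite t0 (le_trans tx).
have cv1x : {within `[0, x], continuous v1} by exact: continuous_subspaceW sub _.
have cvx : {within `[0, x], continuous v} by exact: continuous_subspaceW sub _.
have Dx t : t \in `]0, x[%R -> Omega t by move=> tx; exact: (sub0x Ox tx).
have := @continuous_FTC2 R v1 v 0 x x0 cv1x.
have /(continuous_within_itvP _ x0)[_ c0 cx] := cvx.
move=> H; rewrite /Rintegral.
have i1 : mu.-integrable `[0, x] (EFin \o v1).
  by apply: continuous_compact_integrable => //; exact: segment_compact.
rewrite -/(Rintegral _ _ _) (Rintegral_itv_bndo_bndc (a := BRight 0) (r := x)); last first.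
  by apply: integrableS i1 => //; exact: subset_itv_oo_cc.
rewrite (Rintegral_itv_obnd_cbnd (r := 0) (b := BRight x)); last first.
  by apply: integrableS i1 => //; exact: subset_itv_oc_cc.
rewrite /Rintegral H//; first by rewrite -EFinB/= addrC subrK.
- by split=> // t tx; have [] := dv _ (Dx _ tx).
- by move=> t tx; rewrite derive1E; have [_ ->] := dv _ (Dx _ tx).
Qed.

(** Freezing a function beyond [a] is the one nonsmooth construction needed: the piecewise linear
    functions and the truncated exponential of the layer estimates are both built from it. *)
Lemma weak_trunc (v dv : R -> R) (a : R) : Omega_bar a -> is_weak_derivative v dv ->
  is_weak_derivative (fun y : R => v (Num.min y a)) (fun y : R => dv y * (y < a)%R%:R).
Proof.
move=> Oa hv; have [d2 Hv] := hv; have /Omega_barP/andP[a0 a1] := Oa.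
have mi : measurable_fun (Omega : set (measurableTypeR R)) (fun y : R => (y < a)%R%:R : R).
  have -> : (fun y : R => (y < a)%R%:R : R) = (fun y => if y < a then 1 else 0).
    by apply/funext => y; case: ifP.
  apply: measurable_fun_if => //.
  by apply: measurable_fun_ltr => //; exact: measurable_cst.
split.
  apply: (@eq_L2 _ ((fun y : R => (y < a)%R%:R : R) \* dv)).
    by move=> y _ /=; rewrite mulrC.
  by apply: (L2M (M := 1)) => // x _; case: (x < a); rewrite ?normr1 ?normr0.
move=> x Ox; have /Omega_barP/andP[x0 x1] := Ox.
rewrite (min_l a0).
have Om : Omega_bar (Num.min x a).
  by apply/Omega_barP; rewrite le_min x0 a0 ge_min x1.
rewrite (Hv _ Om); congr (_ + _).
rewrite Rintegral_mkcond [RHS]Rintegral_mkcond; apply: eq_Rintegral => t _.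
rewrite !patchE !mem_setE/= !in_itv/= lt_min.
case: (0 < t) => //=; case: (t < x) => //=; case: (t < a) => //=; first by rewrite mulr1.
by rewrite mulr0.
Qed.

End WeakDerivative.

(** * Coercivity and regularity *)

Section Regularity.
Context {R : realType}.
Notation mu := (@lebesgue_measure R).
Implicit Types b c f g u v w : R -> R.

Lemma within_continuous_at g x : {within Omega_bar, continuous g} -> Omega x ->
  {for x, continuous g}.
Proof.
move=> cg Ox.
have oO : open (Omega : set R) by exact: interval_open.
have := continuous_subspaceW Omega_sub cg.
by rewrite continuous_open_subspace// => H; apply: H; rewrite inE.
Qed.

Lemma near_Omega (x : R) : Omega x -> \forall y \near x, Omega y.
Proof. by move=> Ox; exact: near_in_itvoo. Qed.

Lemma is_derive_near v w x (d : R) : (\forall y \near x, v y = w y) ->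
  is_derive x 1 v d -> is_derive x 1 w d.
Proof.
move=> vw [dv <-]; have vw' : {near x, v =1 w} by [].
have dw : derivable w x 1 by apply: near_eq_derivable dv; rewrite ?oner_eq0.
by apply: DeriveDef => //; apply/esym/near_eq_derive; rewrite ?oner_eq0.
Qed.

Lemma is_derive_primitive g x : {within Omega_bar, continuous g} -> Omega x ->
  is_derive x 1 (fun y => \int[mu]_(t in `]0, y[) g t) (g x).
Proof.
move=> cg Ox; have g2 := L2_within cg.
have /OmegaP/andP[x0 x1] := Ox.
have i1 : mu.-integrable `[0, 1] (EFin \o (g \_ Omega)).
  rewrite -restrict_EFin; apply/integrable_restrict => //.
  by apply: integrableS (L2_integrable g2) => //; exact: measurableI.
have cx : {for x, continuous (g \_ Omega)}.
  have cgx := within_continuous_at cg Ox.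
  rewrite /prop_for /continuous_at patchE mem_set//.
  apply: cvg_trans cgx; apply: near_eq_cvg; near=> y.
  rewrite patchE mem_set//.
  by near: y; exact: near_Omega.
have [d1 d2] := continuous_FTC1_closed x1 i1 x0 cx.
apply: (@is_derive_near (fun y => \int[mu]_(t in `[0, y]) (g \_ Omega) t)).
  near=> y; rewrite Rintegral0x//; apply: Omega_sub.
  by near: y; exact: near_Omega.
apply: DeriveDef => //; rewrite -derive1E d2 patchE mem_set//.
Unshelve. all: by end_near. Qed.

Lemma withinD v w : {within Omega_bar, continuous v} ->
  {within Omega_bar, continuous w} -> {within Omega_bar, continuous (v \+ w)}.
Proof. by move=> cv cw x; apply: cvgD; [exact: cv|exact: cw]. Qed.

Lemma withinB v w : {within Omega_bar, continuous v} ->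
  {within Omega_bar, continuous w} -> {within Omega_bar, continuous (v \- w)}.
Proof. by move=> cv cw x; apply: cvgB; [exact: cv|exact: cw]. Qed.

Lemma withinM v w : {within Omega_bar, continuous v} ->
  {within Omega_bar, continuous w} -> {within Omega_bar, continuous (v \* w)}.
Proof. by move=> cv cw x; apply: cvgM; [exact: cv|exact: cw]. Qed.

Lemma within_cst (r : R) : {within Omega_bar, continuous (cst r : R -> R)}.
Proof. by move=> x; exact: cvg_cst. Qed.

Lemma withinZ (r : R) v : {within Omega_bar, continuous v} ->
  {within Omega_bar, continuous (fun x => r * v x)}.
Proof. by move=> cv x; apply: cvgM; [exact: cvg_cst|exact: cv]. Qed.

Lemma within_T v : continuous v -> {within Omega_bar, continuous v}.
Proof. by move=> cv; exact: continuous_subspaceT. Qed.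

Lemma L2_withinM b g : {within Omega_bar, continuous b} -> L2 g -> L2 (b \* g).
Proof.
move=> cb g2; have [M _ bM] := within_bounded cb.
by apply: (L2M (M := M)) => //; [exact: within_measurable|move=> x /Omega_sub/bM].
Qed.

(** Integrating by parts, [ip (b \* dv) v] equals minus one half of [ip (b1 \* v) v], so the
    convection term only shifts the zeroth order coefficient to the one bounded below by [gamma]. *)
Lemma bilin_coercive (e1 e2 gamma : R) b b1 c v dv :
  {within Omega_bar, continuous b} -> {within Omega_bar, continuous c} ->
  {within Omega_bar, continuous b1} ->
  (forall x, Omega x -> is_derive x 1 b (b1 x)) ->
  (forall x, Omega x -> gamma <= c x - 1 / 2 * e2 * b1 x) ->
  is_weak_derivative v dv -> v 0 = 0 -> v 1 = 0 ->
  e1 * ip dv dv + gamma * ip v v <= bilin e1 e2 b c v v.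
Proof.
move=> cb cc cb1 db gc hv v0 v1.
rewrite (bilinE e1 e2 cb cc hv hv) -addrA lerD2l.
have v2 := weak_L2 hv; have [dv2 _] := hv.
have cv := weak_within hv.
have hb := weak_C1 cb cb1 db.
have := ip_by_parts (weakM hb hv) hv.
rewrite v0 v1 !mulr0 subr0.
have L1 : L2 (b1 \* v) by exact: L2_withinM.
have L2' : L2 (b \* dv) by exact: L2_withinM.
have L3 : L2 (c \* v) by exact: L2_withinM.
rewrite (ipDl L1 L2' v2) => E.
have E2 : ip (b \* v) dv = ip (b \* dv) v.
  by apply: eq_Rintegral => x _ /=; rewrite mulrAC.
rewrite E2 in E.
have -> : ip (b \* dv) v = - (1 / 2) * ip (b1 \* v) v by lra.
have L4 : L2 (fun x => - (1 / 2 * e2) * (b1 \* v) x) by exact: L2Z.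
have -> : e2 * (- (1 / 2) * ip (b1 \* v) v) + ip (c \* v) v =
  ip ((c \* v) \+ (fun x => - (1 / 2 * e2) * (b1 \* v) x)) v.
  by rewrite ipDl// ipZl//; ring.
rewrite -ipZl//; apply: le_Rintegral => //.
- by apply: L2_integrableM => //; exact: L2Z.
- by apply: L2_integrableM => //; exact: L2D.
- move=> x Ox /=; have := gc x Ox; have := sqr_ge0 (v x).
  by move=> v2x gx; rewrite -subr_ge0; nra.
Qed.

(* du Bois-Reymond: [eps1 u'] minus the primitive of [eps2 b u' + c u - f] is
   orthogonal to the derivative of every test function, hence constant. *)
Lemma bvp_solution_regular (e1 e2 : R) b c f u : 0 < e1 ->
  {within Omega_bar, continuous b} -> {within Omega_bar, continuous c} ->
  {within Omega_bar, continuous f} -> bvp_solution e1 e2 b c f u ->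
  exists u1, [/\ {within Omega_bar, continuous u1},
    forall x, Omega x -> is_derive x 1 u (u1 x) &
    forall x, Omega x ->
      is_derive x 1 u1 ((e2 * b x * u1 x + c x * u x - f x) / e1)].
Proof.
move=> e10 cb cc cf [[[du hu] u0 u1] Hu].
have [du2 _] := hu; have u2 := weak_L2 hu.
have cu := weak_within hu.
have f2 := L2_within cf.
have bd2 := L2_withinM cb du2; have cu2 := L2_withinM cc u2.
pose k := ((fun x => e2 * (b \* du) x) \+ (c \* u)) \- f.
have k2 : L2 k by apply: L2B => //; apply: L2D => //; exact: L2Z.
pose P x := \int[mu]_(t in `]0, x[) k t.
have hP : is_weak_derivative P k by exact: weak_primitive.
have P0 : P 0 = 0.
  rewrite /P; have -> : [set` `]0, 0[%R] = (set0 : set R) by rewrite set_itv_ge// bnd_simp ltxx.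
  by rewrite Rintegral_set0.
have P2 := weak_L2 hP.
pose h := (fun x => e1 * du x) \- P.
have h2 : L2 h by apply: L2B => //; exact: L2Z.
(* Subtracting the mean makes the primitive [v] of [h - m] vanish at 1, so [v] is an admissible test
   function; testing with it yields that [h - m] has norm 0. *)
pose m := \int[mu]_(x in Omega) h x.
have hm2 : L2 (h \- cst m) := L2B h2 (L2_cst m).
pose v x := \int[mu]_(t in `]0, x[) (h \- cst m) t.
have hv : is_weak_derivative v (h \- cst m) by exact: weak_primitive.
have v2 := weak_L2 hv.
have v0 : v 0 = 0.
  rewrite /v; have -> : [set` `]0, 0[%R] = (set0 : set R) by rewrite set_itv_ge// bnd_simp ltxx.
  by rewrite Rintegral_set0.
have v1 : v 1 = 0.
  rewrite /v -/(Omega) RintegralB//; [|exact: L2_integrable|exact: L2_integrable (L2_cst m)].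
  rewrite -/m -[X in _ - X]/(\int[mu]_(x in Omega) m) Rintegral_cst// /Omega.
  by rewrite /= lebesgue_measure_itv/= lte_fin ltr01 oppr0 adde0 mulr1 subrr.
have Hv : H10 v by split=> //; exists (h \- cst m).
have := Hu v Hv; rewrite (bilinE e1 e2 cb cc hu hv) => E.
have := ip_by_parts hP hv; rewrite v0 v1 !mulr0 subr0 => E2.
have E3 : ip k v = e2 * ip (b \* du) v + ip (c \* u) v - ip f v.
  by rewrite /k ipBl//; [rewrite ipDl// ?ipZl//; exact: L2Z|by apply: L2D => //; exact: L2Z].
have E4 : ip h (h \- cst m) = 0.
  by rewrite {1}/h ipBl// ?ipZl//; [lra|exact: L2Z].
have E5 : ip (h \- cst m) (h \- cst m) = 0.
  rewrite (ipBl h2 (L2_cst m) hm2) E4 sub0r; have -> : ip (cst m) (h \- cst m) = m * v 1.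
    rewrite -[LHS]/(\int[mu]_(x in Omega) (m * (h \- cst m) x)).
    by rewrite (RintegralZl _ measurable_Omega (L2_integrable hm2)).
  by rewrite v1 mulr0 oppr0.
have [N [mN N0 sN]] := ip_eq0_ae hm2 E5.
(* [w] is a continuous representative of [du]. Replacing [du] by [w] inside [k] makes the integrand
   of [P] continuous, so [P], and with it [w], is differentiable at every point of [Omega]. *)
pose w x := (P x + m) / e1.
have cP := weak_within hP.
have cw : {within Omega_bar, continuous w}.
  have := withinZ (r := e1^-1) (withinD cP (within_cst (r := m))).
  by apply: eq_within => x _; rewrite /w /= mulrC.
have w2 := L2_within cw.
have aew : ae_eq mu Omega du w.
  exists N; split=> // x /= H; apply: sN => /= H'; apply: H => Ox.
  move: (H' Ox); rewrite /h /w /= => Ex.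
  apply: (mulfI (lt0r_neq0 e10)); rewrite mulrCA divff ?lt0r_neq0// mulr1.
  by apply/eqP; rewrite -subr_eq0 opprD addrA; exact/eqP.
have hw : is_weak_derivative u w by exact: ae_weak_deriv aew w2 hu.
pose k' := ((fun x => e2 * (b \* w) x) \+ (c \* u)) \- f.
have ck' : {within Omega_bar, continuous k'}.
  apply: withinB => //; apply: withinD; last exact: withinM.
  by apply: withinZ; exact: withinM.
have hP' : is_weak_derivative P k'.
  apply: ae_weak_deriv hP; last exact: L2_within.
  case: aew => N' [mN' N'0 sN']; exists N'; split=> // x /= H.
  by apply: sN' => /= H'; apply: H => Ox; rewrite /k /k' /= H'.
exists w; split=> // x Ox.
- apply: (@is_derive_near (fun y => u 0 + \int[mu]_(t in `]0, y[) w t)).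
    near=> y; rewrite [RHS]hw.2//; apply: Omega_sub.
    by near: y; exact: near_Omega.
  rewrite -[w x]add0r; apply: is_deriveD; exact: is_derive_primitive.
- have dP : is_derive x 1 P (k' x).
    apply: (@is_derive_near (fun y => P 0 + \int[mu]_(t in `]0, y[) k' t)).
      near=> y; rewrite [RHS]hP'.2//; apply: Omega_sub.
      by near: y; exact: near_Omega.
    rewrite -[k' x]add0r; apply: is_deriveD; exact: is_derive_primitive.
  have -> : (e2 * b x * w x + c x * u x - f x) / e1 = e1^-1 *: (k' x + 0).
    by rewrite addr0 /k' /= mulrC -mulrA.
  have -> : w = e1^-1 \*: (P \+ cst m) by apply/funext => y; rewrite /w /= mulrC.
  by apply: is_deriveZ; apply: is_deriveD.
Unshelve. all: by end_near. Qed.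

End Regularity.

(** * Maximum principle and exponential barriers *)

Section Calculus.
Context {R : realType}.
Implicit Types f g v w D : R -> R.

Definition der f (x d : R) := is_derive x 1 f d.

Lemma der_eq f (x a b : R) : der f x a -> a = b -> der f x b.
Proof. by move=> H <-. Qed.

Lemma derD f g (x a b : R) : der f x a -> der g x b ->
  der (fun y => f y + g y) x (a + b).
Proof. by move=> fa gb; exact: (is_deriveD fa gb). Qed.

Lemma derB f g (x a b : R) : der f x a -> der g x b ->
  der (fun y => f y - g y) x (a - b).
Proof. by move=> fa gb; exact: (is_deriveB fa gb). Qed.

Lemma derM f g (x a b : R) : der f x a -> der g x b ->
  der (fun y => f y * g y) x (a * g x + f x * b).
Proof.
move=> fa gb; apply: (der_eq (is_deriveM fa gb)).
by rewrite /GRing.scale/= addrC [g x * a]mulrC.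
Qed.

Lemma derC (r x : R) : der (fun=> r : R) x 0.
Proof. exact: is_derive_cst. Qed.

Lemma derZ (r : R) f (x a : R) : der f x a ->
  der (fun y => r * f y) x (r * a).
Proof.
by move=> fa; apply: (der_eq (derM (derC r x) fa)); rewrite mul0r add0r.
Qed.

Lemma derX (x : R) : der (fun y : R => y) x (1 : R).
Proof. exact: is_derive_id. Qed.

Definition eaff (k d x : R) : R := expR (k * x + d).

Lemma eaff_gt0 (k d x : R) : 0 < eaff k d x.
Proof. exact: expR_gt0. Qed.

Lemma der_eaff (k d x : R) : der (eaff k d) x (k * eaff k d x).
Proof.
have h : der (fun y : R => k * y + d) x (k * 1 + 0).
  by apply: derD; [apply: derZ; exact: derX|exact: derC].
have H := @is_derive1_comp R expR (fun y : R => k * y + d) x _ _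
  (is_derive_expR (k * x + d)) h.
by apply: (der_eq H); rewrite addr0 mulr1 mulrC.
Qed.

Lemma within_eaff (k d : R) : {within Omega_bar, continuous (eaff k d)}.
Proof.
apply: within_T => x; apply: differentiable_continuous.
by apply/derivable1_diffP; have [] := der_eaff k d x.
Qed.

Lemma subOmega_bar (x y : R) : Omega_bar x -> Omega_bar y ->
  `[x, y] `<=` (Omega_bar : set R).
Proof.
move=> /Omega_barP/andP[x0 x1] /Omega_barP/andP[y0 y1] t /=.
rewrite in_itv/= => /andP[xt ty]; apply/Omega_barP.
by rewrite (le_trans x0)// (le_trans ty).
Qed.

Lemma subOmega (x y t : R) : Omega_bar x -> Omega_bar y ->
  x < t < y -> Omega t.
Proof.
move=> /Omega_barP/andP[x0 x1] /Omega_barP/andP[y0 y1] /andP[xt ty].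
by apply/OmegaP; rewrite (le_lt_trans x0)// (lt_le_trans ty).
Qed.

Lemma mvt_Omega_bar v v1 x y : {within Omega_bar, continuous v} ->
  (forall x, Omega x -> der v x (v1 x)) ->
  Omega_bar x -> Omega_bar y -> x < y ->
  exists2 t, x < t < y & v y - v x = v1 t * (y - x).
Proof.
move=> cv dv Ox Oy xy.
have dxy t : t \in `]x, y[%R -> der v t (v1 t).
  by rewrite in_itv/= => xty; apply: dv; exact: subOmega xty.
have cxy : {within `[x, y], continuous v}.
  exact: continuous_subspaceW (subOmega_bar Ox Oy) cv.
have [t tI E] := MVT xy dxy cxy.
by exists t => //; rewrite in_itv/= in tI.
Qed.

Lemma derive_near_lt v (x d e : R) : der v x d -> d < e ->
  \forall h \near (0 : R)^'+, v (x + h) < v x + e * h.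
Proof.
move=> [dv dE] de.
have : h^-1 *: (v (h *: 1 + x) - v x) @[h --> (0 : R)^'] --> d.
  by rewrite -dE; exact: dv.
move=> /cvg_dnbhs_at_right cv.
have : \forall h \near (0 : R)^'+, h^-1 *: (v (h *: 1 + x) - v x) < e.
  by apply: (cvgr_lt d) => //; exact: cv.
move=> H; near=> h.
have h0 : 0 < h by near: h; exact: nbhs_right_gt.
have : h^-1 *: (v (h *: 1 + x) - v x) < e by near: h.
by rewrite /GRing.scale/= mulr1 mulrC ltr_pdivrMr// [h + x]addrC; lra.
Unshelve. all: by end_near. Qed.

(** If [d] were negative, [v1] would be negative just to the right of [x], and the mean value
    theorem would produce a value of [v] below the minimum. *)
Lemma second_derivative_min v v1 (x d : R) : {within Omega_bar, continuous v} ->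
  (forall x, Omega x -> der v x (v1 x)) -> Omega x ->
  der v1 x d -> v1 x = 0 -> (forall y, Omega_bar y -> v x <= v y) ->
  0 <= d.
Proof.
move=> cv dv Ox dv1 v1x vmin; rewrite leNgt; apply/negP => d0.
have /OmegaP/andP[x0 x1] := Ox.
have [/= e e0 He] := derive_near_lt dv1 d0.
pose h := Num.min (e / 2) ((1 - x) / 2).
have h0 : 0 < h by rewrite lt_min !divr_gt0// subr_gt0.
have he : h < e by rewrite gt_min ltr_pdivrMr// mulr_natr mulr2n ltrDl e0.
have hx : h < 1 - x.
  by rewrite gt_min; apply/orP; right; rewrite ltr_pdivrMr// mulr_natr mulr2n ltrDl subr_gt0.
have Oxh : Omega_bar (x + h) by apply/Omega_barP/andP; split; lra.
have [|t /andP[xt tx] E] := mvt_Omega_bar cv dv (Omega_sub Ox) Oxh; first by rewrite ltrDl.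
have := vmin _ Oxh.
have : v1 (x + (t - x)) < v1 x + 0 * (t - x).
  apply: He; rewrite /= ?subr_gt0//.
  by rewrite sub0r normrN gtr0_norm ?subr_gt0//; lra.
rewrite [x + _]addrC subrK mul0r addr0 v1x => v1t.
have : v1 t * h < 0 by rewrite nmulr_rlt0.
by move: E; rewrite [x + h - x]addrAC subrr add0r; lra.
Qed.

(** At a negative interior minimum the first derivative vanishes and the second is nonnegative,
    while [d * v] is negative, which contradicts the sign of the operator. *)
Lemma maximum_principle (e1 : R) (B d v v1 v2 : R -> R) : 0 < e1 ->
  {within Omega_bar, continuous v} ->
  (forall x, Omega x -> der v x (v1 x)) ->
  (forall x, Omega x -> der v1 x (v2 x)) ->
  (forall x, Omega x -> 0 < d x) ->
  (forall x, Omega x -> 0 <= - e1 * v2 x + B x * v1 x + d x * v x) ->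
  0 <= v 0 -> 0 <= v 1 -> forall x, Omega_bar x -> 0 <= v x.
Proof.
move=> e10 cv dv dv1 d0 Lv v0 vv1 x Ox.
have [y yI ymin] := EVT_min ler01 cv.
apply: le_trans (ymin x Ox).
have Oy : Omega_bar y by [].
rewrite leNgt; apply/negP => vy.
have /Omega_barP/andP[] := Oy.
rewrite le_eqVlt => /predU1P[y0|y0]; first by move: vy; rewrite -y0 ltNge v0.
rewrite le_eqVlt => /predU1P[y1|y1]; first by move: vy; rewrite y1 ltNge vv1.
have Oy' : Omega y by apply/OmegaP; rewrite y0.
have [_ Ey] : der v y 0.
  apply: (@derive1_at_min R v 0 1) => //.
    by move=> t tI; have [] := dv t tI.
  by move=> t tI; apply: ymin; exact: (Omega_sub tI).
have v1y : v1 y = 0 by have [_ <-] := dv y Oy'.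
have v2y := second_derivative_min cv dv Oy' (dv1 y Oy') v1y ymin.
have := Lv y Oy'; rewrite v1y mulr0 addr0; apply/negP; rewrite -ltNge.
have : d y * v y < 0 by rewrite pmulr_rlt0 ?d0.
have : 0 <= e1 * v2 y by rewrite mulr_ge0// ltW.
lra.
Qed.

Lemma comparison (e1 : R) (B d v v1 v2 P P1 P2 : R -> R) : 0 < e1 ->
  {within Omega_bar, continuous v} ->
  (forall x, Omega x -> der v x (v1 x)) ->
  (forall x, Omega x -> der v1 x (v2 x)) ->
  {within Omega_bar, continuous P} ->
  (forall x, Omega x -> der P x (P1 x)) ->
  (forall x, Omega x -> der P1 x (P2 x)) ->
  (forall x, Omega x -> 0 < d x) ->
  (forall x, Omega x -> `|- e1 * v2 x + B x * v1 x + d x * v x| <=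
    - e1 * P2 x + B x * P1 x + d x * P x) ->
  `|v 0| <= P 0 -> `|v 1| <= P 1 -> forall x, Omega_bar x -> `|v x| <= P x.
Proof.
move=> e10 cv dv dv1 cP dP dP1 d0 L v0 vv1 x Ox.
move: v0 vv1; rewrite !ler_norml => /andP[a1 a2] /andP[a3 a4].
have H1 : 0 <= P x - v x.
  apply: (@maximum_principle e1 B d (fun y => P y - v y) (fun y => P1 y - v1 y)
    (fun y => P2 y - v2 y)) => //; try by rewrite subr_ge0.
  - exact: withinB.
  - by move=> y Oy; apply: derB; [exact: dP|exact: dv].
  - by move=> y Oy; apply: derB; [exact: dP1|exact: dv1].
  - by move=> y Oy; have := L y Oy; rewrite ler_norml => /andP[? ?]; lra.
have H2 : 0 <= P x + v x.
  apply: (@maximum_principle e1 B d (fun y => P y + v y) (fun y => P1 y + v1 y)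
    (fun y => P2 y + v2 y)) => //; try lra.
  - exact: withinD.
  - by move=> y Oy; apply: derD; [exact: dP|exact: dv].
  - by move=> y Oy; apply: derD; [exact: dP1|exact: dv1].
  - by move=> y Oy; have := L y Oy; rewrite ler_norml => /andP[? ?]; lra.
by apply/andP; split; lra.
Qed.

(** Turns a barrier that touches the solution at an endpoint into a bound for the derivative at that
    endpoint; such bounds are the boundary data when the differentiated equation is treated. *)
Lemma slope_at0 D D1 : {within Omega_bar, continuous D} ->
  {within Omega_bar, continuous D1} ->
  (forall x, Omega x -> der D x (D1 x)) ->
  (forall x, Omega_bar x -> 0 <= D x) -> D 0 = 0 -> 0 <= D1 0.
Proof.
move=> cD cD1 dD Dge0 D0; rewrite leNgt; apply/negP => D10.
have /(continuous_within_itvP _ ltr01)[_ c0 _] := cD1.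
have [/= e e0 He] : \forall x \near (0 : R)^'+, D1 x < 0.
  by apply: (cvgr_lt (D1 0)) => //; exact: c0.
pose h := Num.min (e / 2) 1.
have h0 : 0 < h by rewrite lt_min ltr01 divr_gt0.
have he : h < e by rewrite gt_min ltr_pdivrMr// mulr_natr mulr2n ltrDl e0.
have Oh : Omega_bar h by apply/Omega_barP; rewrite ltW//= ge_min lexx orbT.
have [t /andP[t0 th] E] := mvt_Omega_bar cD dD Omega_bar0 Oh h0.
have D1t : D1 t < 0.
  by apply: He => //=; rewrite sub0r normrN gtr0_norm// (lt_trans th).
have := Dge0 _ Oh; move: E; rewrite D0 !subr0 => ->.
by rewrite leNgt nmulr_rlt0 ?h0.
Qed.

Lemma slope_at1 D D1 : {within Omega_bar, continuous D} ->
  {within Omega_bar, continuous D1} ->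
  (forall x, Omega x -> der D x (D1 x)) ->
  (forall x, Omega_bar x -> 0 <= D x) -> D 1 = 0 -> D1 1 <= 0.
Proof.
move=> cD cD1 dD Dge0 D0; rewrite leNgt; apply/negP => D10.
have /(continuous_within_itvP _ ltr01)[_ _ c0] := cD1.
have [/= e e0 He] : \forall x \near (1 : R)^'-, 0 < D1 x.
  by apply: (cvgr_gt (D1 1)) => //; exact: c0.
pose h := Num.min (e / 2) 1.
have h0 : 0 < h by rewrite lt_min ltr01 divr_gt0.
have he : h < e by rewrite gt_min ltr_pdivrMr// mulr_natr mulr2n ltrDl e0.
have h1 : h <= 1 by rewrite ge_min lexx orbT.
have Oh : Omega_bar (1 - h) by apply/Omega_barP/andP; split; lra.
have [|t /andP[t0 th] E] := mvt_Omega_bar cD dD Oh Omega_bar1; first by lra.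
have D1t : 0 < D1 t.
  by apply: He => //=; rewrite gtr0_norm ?subr_gt0//; lra.
have := Dge0 _ Oh; move: E; rewrite D0 sub0r (_ : 1 - (1 - h) = h); last by lra.
move=> E.
by rewrite -oppr_le0 E leNgt mulr_gt0.
Qed.

Variables (a0 a1 k1 d1 a2 k2 d2 a3 k3 d3 : R).

Definition bar x := a0 + a1 * eaff k1 d1 x + a2 * eaff k2 d2 x + a3 * eaff k3 d3 x.
Definition bar1 x :=
  a1 * (k1 * eaff k1 d1 x) + a2 * (k2 * eaff k2 d2 x) + a3 * (k3 * eaff k3 d3 x).
Definition bar2 x := a1 * (k1 * (k1 * eaff k1 d1 x)) +
  a2 * (k2 * (k2 * eaff k2 d2 x)) + a3 * (k3 * (k3 * eaff k3 d3 x)).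

Lemma der_bar (x : R) : der bar x (bar1 x).
Proof.
rewrite /bar /bar1 -[a1 * _]add0r.
by do 3?apply: derD; [exact: derC|exact: derZ (der_eaff _ _ _)..].
Qed.

Lemma der_bar1 (x : R) : der bar1 x (bar2 x).
Proof.
by rewrite /bar1 /bar2; do 2?apply: derD; do 2?apply: derZ; exact: der_eaff.
Qed.

Lemma derivable_within v (dv : R -> R) : (forall x, der v x (dv x)) ->
  {within Omega_bar, continuous v}.
Proof.
move=> dv'; apply: within_T => x; apply: differentiable_continuous.
by apply/derivable1_diffP; have [] := dv' x.
Qed.

Lemma within_bar : {within Omega_bar, continuous bar}.
Proof. exact: derivable_within der_bar. Qed.

Lemma within_bar1 : {within Omega_bar, continuous bar1}.
Proof. exact: derivable_within der_bar1. Qed.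

Variables (e1 : R) (B d v v1 v2 k : R -> R).
Hypotheses (e10 : 0 < e1) (cv : {within Omega_bar, continuous v})
  (dv : forall x, Omega x -> der v x (v1 x))
  (dv1 : forall x, Omega x -> der v1 x (v2 x))
  (d0 : forall x, Omega x -> 0 < d x)
  (Lv : forall x, Omega x -> - e1 * v2 x + B x * v1 x + d x * v x = k x)
  (kb : forall x, Omega x -> `|k x| <= d x * a0
    + a1 * eaff k1 d1 x * (- e1 * k1 ^+ 2 + B x * k1 + d x)
    + a2 * eaff k2 d2 x * (- e1 * k2 ^+ 2 + B x * k2 + d x)
    + a3 * eaff k3 d3 x * (- e1 * k3 ^+ 2 + B x * k3 + d x))
  (v0 : `|v 0| <= bar 0) (vv1 : `|v 1| <= bar 1).

(** On [eaff k d] the operator multiplies by its symbol at [k], so the right-hand side of [kb] is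
    the operator applied to [bar]. *)
Lemma bar_bound x : Omega_bar x -> `|v x| <= bar x.
Proof.
apply: (comparison (B := B) e10 cv dv dv1 within_bar (fun x _ => der_bar x)
  (fun x _ => der_bar1 x) d0) => // y Oy.
rewrite Lv//; apply: le_trans (kb Oy) _.
by rewrite /bar2 /bar1 /bar le_eqVlt; apply/orP; left; apply/eqP; ring.
Qed.

(** Both [bar + v] and [bar - v] are nonnegative and vanish at 0, so their slopes there are
    nonnegative. *)
Lemma bar_slope0 : {within Omega_bar, continuous v1} -> v 0 = 0 -> bar 0 = 0 ->
  `|v1 0| <= bar1 0.
Proof.
move=> cv1 z0 b0; rewrite ler_norml; apply/andP; split.
- rewrite lerNl -subr_ge0 opprK.
  apply: (@slope_at0 (fun y => bar y + v y) (fun y => bar1 y + v1 y)).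
  + exact: withinD within_bar cv.
  + exact: withinD within_bar1 cv1.
  + by move=> x Ox; apply: derD; [exact: der_bar|exact: dv].
  + by move=> x /bar_bound; rewrite ler_norml => /andP[? _]; lra.
  + by rewrite b0 z0 addr0.
- rewrite -subr_ge0.
  apply: (@slope_at0 (fun y => bar y - v y) (fun y => bar1 y - v1 y)).
  + exact: withinB within_bar cv.
  + exact: withinB within_bar1 cv1.
  + by move=> x Ox; apply: derB; [exact: der_bar|exact: dv].
  + by move=> x /bar_bound; rewrite ler_norml => /andP[_ ?]; lra.
  + by rewrite b0 z0 subr0.
Qed.

Lemma bar_slope1 : {within Omega_bar, continuous v1} -> v 1 = 0 -> bar 1 = 0 ->
  `|v1 1| <= - bar1 1.
Proof.
move=> cv1 z0 b0; rewrite ler_norml opprK; apply/andP; split.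
- rewrite -subr_le0.
  apply: (@slope_at1 (fun y => bar y - v y) (fun y => bar1 y - v1 y)).
  + exact: withinB within_bar cv.
  + exact: withinB within_bar1 cv1.
  + by move=> x Ox; apply: derB; [exact: der_bar|exact: dv].
  + by move=> x /bar_bound; rewrite ler_norml => /andP[_ ?]; lra.
  + by rewrite b0 z0 subr0.
- rewrite -subr_le0 opprK [_ + bar1 _]addrC.
  apply: (@slope_at1 (fun y => bar y + v y) (fun y => bar1 y + v1 y)).
  + exact: withinD within_bar cv.
  + exact: withinD within_bar1 cv1.
  + by move=> x Ox; apply: derD; [exact: der_bar|exact: dv].
  + by move=> x /bar_bound; rewrite ler_norml => /andP[? _]; lra.
  + by rewrite b0 z0 addr0.
Qed.

End Calculus.

(** * Second derivative of the smooth part *)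

(* Matching is syntactic because [mulr_ge0] also unfolds local definitions. *)
Ltac nonneg := first
  [ match goal with
    | H : is_true (0 <= ?x) |- is_true (0 <= ?x) => exact: H
    | H : is_true (0 < ?x) |- is_true (0 <= ?x) => exact: (ltW H)
    end
  | exact/ltW/expR_gt0
  | lazymatch goal with
    | |- is_true (0 <= _ * _) => apply: mulr_ge0; nonneg
    | |- is_true (0 <= _ ^+ 2) => exact: sqr_ge0
    | |- is_true (0 <= _ ^+ _) => apply: exprn_ge0; nonneg
    | |- is_true (0 <= _ + _) => apply: addr_ge0; nonneg
    | |- is_true (0 <= _%:R) => exact: ler0n
    end
  | assumption | lra ].

Section LayerBounds.
Context {R : realType}.

(* [kap] bounds the zeroth order coefficients of [L], of its first two
   derivatives and the symbols at the layer exponents from below; the symbols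
   are nonpositive at the exponents enlarged by the factor [K]. *)
Record layered (M kap p K e1 e2 : R) (b b1 b2 c c1 c2 : R -> R)
    (mu0 mu1 : R) : Prop := Layered {
  ly_M : 1 <= M; ly_kap : 0 < kap <= 1; ly_p : 0 < p < 1; ly_K : 1 <= K;
  ly_e1 : 0 < e1; ly_e2 : 0 < e2 <= 1; ly_mu0 : 16 <= mu0; ly_mu : mu0 <= mu1;
  ly_cb : {within Omega_bar, continuous b};
  ly_cc : {within Omega_bar, continuous c};
  ly_db : forall x, Omega x -> der b x (b1 x);
  ly_db1 : forall x, Omega x -> der b1 x (b2 x);
  ly_dc : forall x, Omega x -> der c x (c1 x);
  ly_dc1 : forall x, Omega x -> der c1 x (c2 x);
  ly_bM : forall x, Omega_bar x -> `|b x| <= M;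
  ly_b1M : forall x, Omega x -> `|b1 x| <= M;
  ly_b2M : forall x, Omega x -> `|b2 x| <= M;
  ly_cM : forall x, Omega_bar x -> `|c x| <= M;
  ly_c1M : forall x, Omega x -> `|c1 x| <= M;
  ly_c2M : forall x, Omega x -> `|c2 x| <= M;
  ly_d : forall x k, Omega x -> 0 <= k <= 2 ->
    kap <= c x + k * (e2 * b1 x) <= 2 * M;
  ly_pe0 : forall x k, Omega x -> 0 <= k <= 2 ->
    kap <= - e1 * (- (p * mu0)) ^+ 2 + e2 * b x * (- (p * mu0))
           + (c x + k * (e2 * b1 x));
  ly_pe1 : forall x k, Omega x -> 0 <= k <= 2 ->
    kap * (e2 * mu1 + 1) <= - e1 * (p * mu1) ^+ 2 + e2 * b x * (p * mu1)
           + (c x + k * (e2 * b1 x));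
  ly_pl : forall x k, Omega x -> 0 <= k <= 2 ->
    - e1 * (- (K * mu0)) ^+ 2 + e2 * b x * (- (K * mu0))
           + (c x + k * (e2 * b1 x)) <= 0;
  ly_pm : forall x k, Omega x -> 0 <= k <= 2 ->
    - e1 * (K * mu1) ^+ 2 + e2 * b x * (K * mu1)
           + (c x + k * (e2 * b1 x)) <= 0
}.

Definition decay0 (k x : R) : R := eaff (- k) 0 x.
Definition decay1 (k x : R) : R := eaff k (- k) x.

Lemma eaff_0 (k d : R) : eaff k d 0 = expR d.
Proof. by rewrite /eaff mulr0 add0r. Qed.

Lemma eaff_1 (k d : R) : eaff k d 1 = expR (k + d).
Proof. by rewrite /eaff mulr1. Qed.

Lemma decay1_le1 (k x : R) : 0 <= k -> Omega_bar x -> decay1 k x <= 1.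
Proof.
move=> k0 /Omega_barP/andP[x0 x1].
by rewrite /decay1 /eaff -expR0 ler_expR; nra.
Qed.

Lemma decay0_gt0 (k x : R) : 0 < decay0 k x. Proof. exact: expR_gt0. Qed.
Lemma decay1_gt0 (k x : R) : 0 < decay1 k x. Proof. exact: expR_gt0. Qed.

Lemma expRN_le (t : R) : 0 <= t -> (1 + t) * expR (- t) <= 1.
Proof.
move=> t0; rewrite expRN ler_pdivrMr ?expR_gt0// mul1r.
exact: expR_ge1Dx.
Qed.

Lemma expRN_le2 (t : R) : 0 <= t -> t ^+ 2 * expR (- t) <= 2.
Proof.
move=> t0; rewrite expRN ler_pdivrMr ?expR_gt0//.
have := expR_ge1Dxn 1 t0; rewrite /= (_ : 2`!%:R = 2 :> R)//; lra.
Qed.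

Lemma expRN_half (t : R) : 1 <= t -> expR (- t) <= 1 / 2.
Proof.
move=> t1; have := expRN_le (le_trans ler01 t1).
by have := expR_gt0 (- t); nra.
Qed.

Lemma barrier_term_le (kap A a E P s : R) : 0 < kap -> 0 <= A -> A * kap^-1 <= a ->
  0 <= E -> 0 <= s -> kap * s <= P -> A * E * s <= a * E * P.
Proof.
move=> k0 A0 Aa E0 s0 sP.
have P0 : 0 <= P by apply: le_trans sP; rewrite mulr_ge0 // ltW.
rewrite mulrAC [a * E * P]mulrAC ler_wpM2r//.
apply: (@le_trans _ _ (A * kap^-1 * P)); last exact: ler_wpM2r.
rewrite -mulrA ler_wpM2l// mulrC ler_pdivlMr// mulrC//.
Qed.

Lemma barrier_term_ge0 (a E P : R) : a <= 0 -> 0 <= E -> P <= 0 -> 0 <= a * E * P.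
Proof. by move=> a0 E0 P0; rewrite mulr_le0// mulr_le0_ge0. Qed.

(** The summands are [A7 * ik], [C5] and [C6] below: they account for the source in the equation of
    the second derivative and for its boundary values at 0 and at 1. *)
Definition smooth_const (M kap p K : R) : R :=
  let ik := kap^-1 in let ip := p^-1 in
  let C3 := 2 * M * ik * K in let C4 := 2 * M ^+ 2 * ik * K in
  (M ^+ 2 + M + 6 * M * C4) * ik
  + (2 * M ^+ 2 + 2 * M * C3) * ik * ((2 * M * ik + 1) * K + 1)
  + C4 * ((1 + 2 * M * ip * ik + 1) * K + 2 * ip).

(** * Barriers for a function with [w 0 = 0] and [w1 1 = 0] *)

Section smooth_part.
Variables (M kap p K e1 e2 : R) (b b1 b2 c c1 c2 : R -> R) (mu0 mu1 : R).
Hypothesis ly : layered M kap p K e1 e2 b b1 b2 c c1 c2 mu0 mu1.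
Variables (k0 k01 k02 w w1 : R -> R).

Let om := e2 * mu1 + 1.
Let e0 := decay0 (p * mu0).
Let e_1 := decay1 (p * mu1).

(** The second derivative read off from the differential equation. Unlike a derivative it has
    meaningful values at 0 and 1, which serve as boundary data. *)
Definition rhs2 x := (e2 * b x * w1 x + c x * w x - k0 x) / e1.
Let w2 := rhs2.
Let w3 x := (e2 * (b1 x * w1 x + b x * w2 x) + (c1 x * w x + c x * w1 x)
  - k01 x) / e1.
Let w4 x := (e2 * ((b2 x * w1 x + b1 x * w2 x) + (b1 x * w2 x + b x * w3 x))
  + ((c2 x * w x + c1 x * w1 x) + (c1 x * w1 x + c x * w2 x)) - k02 x) / e1.

Hypotheses (cw : {within Omega_bar, continuous w})
  (cw1 : {within Omega_bar, continuous w1})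
  (ck0 : {within Omega_bar, continuous k0})
  (dw : forall x, Omega x -> der w x (w1 x))
  (dw1 : forall x, Omega x -> der w1 x (rhs2 x))
  (dk0 : forall x, Omega x -> der k0 x (k01 x))
  (dk01 : forall x, Omega x -> der k01 x (k02 x)).
Hypotheses (w0 : w 0 = 0) (w11 : w1 1 = 0)
  (wM : forall x, Omega_bar x -> `|w x| <= M)
  (k0M : forall x, Omega x -> `|k0 x| <= M)
  (k01M : forall x, Omega x -> `|k01 x| <= M * (1 + om * e_1 x))
  (k02M : forall x, Omega x -> `|k02 x| <= M * (1 + mu1 * om * e_1 x)).

Let cw2 : {within Omega_bar, continuous w2}.
Proof.
have h : {within Omega_bar, continuous (fun x => e1^-1 * (e2 * (b x * w1 x) + c x * w x - k0 x))}.
  apply: withinZ; apply: withinB ck0; apply: withinD.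
    by apply: withinZ; apply: withinM cw1; exact: ly_cb ly.
  by apply: withinM cw; exact: ly_cc ly.
by apply: eq_within h => x _; rewrite /w2 /rhs2 mulrC -!mulrA.
Qed.

Let dw2 x : Omega x -> der w2 x (w3 x).
Proof.
move=> Ox; rewrite (_ : w2 = fun x => e1^-1 * (e2 * (b x * w1 x) + c x * w x - k0 x)); last first.
  by apply/funext => y; rewrite /w2 /rhs2 mulrC -!mulrA.
apply: (der_eq (a := e1^-1 *
  (e2 * (b1 x * w1 x + b x * w2 x) + (c1 x * w x + c x * w1 x) - k01 x)));
  last by rewrite /w3 mulrC.
apply: derZ; apply: derB (dk0 Ox); apply: derD.
  by apply: derZ; apply: derM (dw1 Ox); exact: ly_db ly _ Ox.
by apply: derM (dw Ox); exact: ly_dc ly _ Ox.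
Qed.

Let dw3 x : Omega x -> der w3 x (w4 x).
Proof.
move=> Ox; rewrite (_ : w3 = fun x =>
  e1^-1 * (e2 * (b1 x * w1 x + b x * w2 x) + (c1 x * w x + c x * w1 x) - k01 x)); last first.
  by apply/funext => y; rewrite /w3 mulrC.
apply: (der_eq (a := e1^-1 * (e2 * ((b2 x * w1 x + b1 x * w2 x) + (b1 x * w2 x + b x * w3 x))
  + ((c2 x * w x + c1 x * w1 x) + (c1 x * w1 x + c x * w2 x)) - k02 x))); last by rewrite /w4 mulrC.
apply: derZ; apply: derB (dk01 Ox); apply: derD.
  apply: derZ; apply: derD.
    by apply: derM (dw1 Ox); exact: ly_db1 ly _ Ox.
  by apply: derM (dw2 Ox); exact: ly_db ly _ Ox.
apply: derD.
  by apply: derM (dw Ox); exact: ly_dc1 ly _ Ox.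
by apply: derM (dw1 Ox); exact: ly_dc ly _ Ox.
Qed.

Let e1n0 : e1 != 0. Proof. by rewrite lt0r_neq0// (ly_e1 ly). Qed.

(** Each differentiation of the equation adds [e2 * b1] to the zeroth order coefficient and turns
    the other new terms into source. Hence the multiples [k] between 0 and 2 in [layered]. *)
Let L0 x : - e1 * w2 x + e2 * b x * w1 x + (c x + 0 * (e2 * b1 x)) * w x = k0 x.
Proof. by rewrite /w2 /rhs2; field. Qed.

Let L1 x : - e1 * w3 x + e2 * b x * w2 x + (c x + 1 * (e2 * b1 x)) * w1 x =
  k01 x - c1 x * w x.
Proof. by rewrite /w3; field. Qed.

Let L2' x : - e1 * w4 x + e2 * b x * w3 x + (c x + 2 * (e2 * b1 x)) * w2 x =
  k02 x - 2 * c1 x * w1 x - c2 x * w x - e2 * b2 x * w1 x.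
Proof. by rewrite /w4; field. Qed.

Let d_gt0 k x : Omega x -> 0 <= k <= 2 -> 0 < c x + k * (e2 * b1 x).
Proof.
move=> Ox k2; have /andP[h _] := ly_d ly Ox k2.
by have /andP[k0' _] := ly_kap ly; exact: lt_le_trans h.
Qed.

Let ik := kap^-1.
Let C3 := 2 * M * ik * K.

Let ik_ge1 : 1 <= ik.
Proof. by have /andP[? ?] := ly_kap ly; rewrite /ik invf_ge1. Qed.

Let C3_ge0 : 2 * M <= C3.
Proof.
have M1 := ly_M ly; have K1 := ly_K ly; have i1 := ik_ge1.
rewrite /C3 -mulrA ler_peMr//; first by lra.
by rewrite -[1]mulr1 ler_pM.
Qed.

Let M_ge0 : 0 <= M. Proof. exact: le_trans ler01 (ly_M ly). Qed.
Let K_ge0 : 0 <= K. Proof. exact: le_trans ler01 (ly_K ly). Qed.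
Let ik_ge0 : 0 <= ik. Proof. exact: le_trans ler01 ik_ge1. Qed.
Let C3_pos : 0 <= C3.
Proof. by apply: le_trans C3_ge0; rewrite mulr_ge0. Qed.
Let mu0_ge0 : 0 <= mu0. Proof. by have := ly_mu0 ly; lra. Qed.
Let mu1_ge0 : 0 <= mu1. Proof. exact: le_trans (ly_mu ly). Qed.

(** The barrier [a * (1 - exp (- K * mu0 * x))] vanishes at 0 with slope [C3 * mu0]. Its exponential
    has a negative coefficient and, the exponent being steep, a nonpositive symbol, so it only
    helps; at 1 the barrier is still at least [a / 2], which is at least [M]. *)
Let w1_0_le : `|w1 0| <= C3 * mu0.
Proof.
have M1 := ly_M ly; have K1 := ly_K ly; have i1 := ik_ge1.
have m16 := ly_mu0 ly; have /andP[kp0 kp1] := ly_kap ly.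
pose a := 2 * M * ik.
have a2M : 2 * M <= a by rewrite /a ler_peMr//; lra.
have hk : 0 <= (0 : R) <= 2 by rewrite lexx/=.
have := @bar_slope0 R a (- a) (- (K * mu0)) 0 0 0 0 0 0 0 e1
  (fun x => e2 * b x) (fun x => c x + 0 * (e2 * b1 x)) w w1 w2 k0
  (ly_e1 ly) cw dw dw1 _ (fun x _ => L0 x) _ _ _ cw1 w0 _.
rewrite /bar /bar1 !eaff_0 !eaff_1 !mul0r !addr0 expR0.
have l1 : expR (- (K * mu0)) <= 1 / 2 by rewrite expRN_half//; nra.
rewrite w0 normr0.
have -> : - a * (- (K * mu0) * 1) = C3 * mu0 by rewrite /a /C3; ring.
apply.
- by move=> x Ox; exact: d_gt0.
- move=> x Ox.
  have /andP[h1 _] := ly_d ly Ox hk.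
  have h2 := ly_pl ly Ox hk.
  have h3 : 0 <= - a * eaff (- (K * mu0)) 0 x * (- e1 * (- (K * mu0)) ^+ 2 +
    e2 * b x * - (K * mu0) + (c x + 0 * (e2 * b1 x))).
    by apply: barrier_term_ge0 h2; [lra|exact/ltW/eaff_gt0].
  have h4 : 2 * M * 1 * 1 <= a * 1 * (c x + 0 * (e2 * b1 x)).
    by apply: (@barrier_term_le kap) => //; first [rewrite mulr1; assumption|nonneg].
  by have := k0M Ox; lra.
- by rewrite mulr1 subrr.
- by have := wM Omega_bar1; nra.
- by rewrite mulr1 subrr.
Qed.

Let C4 := 2 * M ^+ 2 * ik * K.

Let C34 : C3 <= C4.
Proof.
have M1 := ly_M ly; have K1 := ly_K ly; have i1 := ik_ge1.
rewrite /C3 /C4; have -> : 2 * M ^+ 2 * ik * K = M * (2 * M * ik * K) by ring.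
rewrite ler_peMl//; have := C3_ge0; rewrite /C3; lra.
Qed.

Let om_ge1 : 1 <= om.
Proof.
have /andP[h1 _] := ly_e2 ly; by rewrite /om lerDr mulr_ge0// ltW.
Qed.

Let om_ge0 : 0 <= om. Proof. exact: le_trans ler01 om_ge1. Qed.
Let C4_ge0 : 0 <= C4. Proof. exact: le_trans C34. Qed.

Let k1M x : Omega x ->
  `|k01 x - c1 x * w x| <= 2 * M ^+ 2 * (1 + om * e_1 x).
Proof.
move=> Ox; have M1 := ly_M ly.
have h1 : `|c1 x * w x| <= M ^+ 2.
  by rewrite normrM expr2 ler_pM// ?(ly_c1M ly)// wM//; exact: Omega_sub.
have h3 : 0 < om * e_1 x by rewrite mulr_gt0 ?decay1_gt0// (lt_le_trans ltr01).
have h2 := k01M Ox.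
have MM : M <= M ^+ 2 by rewrite expr2 ler_peMr//; lra.
have h4 : M * (om * e_1 x) <= M ^+ 2 * (om * e_1 x) by rewrite ler_wpM2r// ltW.
apply: (le_trans (ler_normB _ _)); have : 0 <= M ^+ 2 * (om * e_1 x).
  by rewrite mulr_ge0 ?sqr_ge0// ltW.
by lra.
Qed.

Let C4_ge : 2 * M ^+ 2 * ik <= C4.
Proof.
have M1 := ly_M ly; have K1 := ly_K ly; have i1 := ik_ge1.
by rewrite /C4 ler_peMr//; nonneg.
Qed.

(** Since [w1 1 = 0], the boundary at 1 demands nothing, and [e_1] enters only to absorb the source
    [om * e_1], which the lower bound [kap * om] of the symbol does without a factor [mu1]. The term
    [mu0 * e0] covers the boundary value at 0. *)
Let w1_le x : Omega_bar x -> `|w1 x| <= C4 * (1 + e_1 x + mu0 * e0 x).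
Proof.
move=> Ox.
have M1 := ly_M ly; have K1 := ly_K ly; have i1 := ik_ge1.
have m16 := ly_mu0 ly; have /andP[kp0 kp1] := ly_kap ly.
have M2 : 1 <= M ^+ 2 by rewrite exprn_ege1.
have c34 := C34; have c3 := C3_ge0; have c4 := C4_ge; have o1 := om_ge1.
have hk : 0 <= (1 : R) <= 2 by rewrite ler01/=; lra.
have -> : C4 * (1 + e_1 x + mu0 * e0 x) =
  bar C4 C4 (p * mu1) (- (p * mu1)) (C4 * mu0) (- (p * mu0)) 0 0 0 0 x.
  by rewrite /bar /e0 /e_1 /decay0 /decay1; ring.
apply: (@bar_bound R _ _ _ _ _ _ _ _ _ _ e1
  (fun x => e2 * b x) (fun x => c x + 1 * (e2 * b1 x)) w1 w2 w3
  (fun x => k01 x - c1 x * w x) (ly_e1 ly) cw1 dw1 dw2 _ (fun x _ => L1 x)) => //.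
- by move=> y Oy; exact: d_gt0.
- move=> y Oy.
  have /andP[h1 _] := ly_d ly Oy hk.
  have g1 : 2 * M ^+ 2 * 1 * 1 <= C4 * 1 * (c y + 1 * (e2 * b1 y)).
    by apply: (@barrier_term_le kap) => //; first [rewrite mulr1; assumption|nonneg].
  have g2 : 2 * M ^+ 2 * e_1 y * om <= C4 * e_1 y * (- e1 * (p * mu1) ^+ 2
    + e2 * b y * (p * mu1) + (c y + 1 * (e2 * b1 y))).
    by apply: (@barrier_term_le kap) => //; first [exact: (ly_pe1 ly Oy hk)|exact/ltW/decay1_gt0|nonneg].
  have g3 : 0 <= C4 * mu0 * e0 y * (- e1 * (- (p * mu0)) ^+ 2
    + e2 * b y * (- (p * mu0)) + (c y + 1 * (e2 * b1 y))).
    apply: mulr_ge0; first by rewrite /e0; nonneg.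
    by have := ly_pe0 ly Oy hk; lra.
  have := k1M Oy; rewrite !mul0r addr0.
  rewrite /e_1 /e0 /decay0 /decay1 in g2 g3 *.
  by lra.
- rewrite /bar !eaff_0 expR0 !mul0r addr0.
  have := w1_0_le; have := expR_gt0 (- (p * mu1)).
  by nra.
- rewrite w11 normr0 /bar !eaff_1 subrr expR0.
  rewrite mul0r addr0 mulr1.
  by do 2?apply: addr_ge0; nonneg.
Qed.

Let A5 := 2 * M ^+ 2 + 2 * M * C3.
Let a5 := A5 * ik.
Let X5 := 2 * M * ik + 1.
Let C5 := a5 * (X5 * K + 1).

(** The slope lemma is applied to [w1 - w1 0], at the price of a source of size [mu0]. The constant
    part of the barrier contains [- E], the value of [e_1] at 0, so that the barrier vanishes at 0;
    the summand [2 * M * ik] of [X5] pays for this. The unwanted slope [p * mu1 * E] is at most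
    1. *)
Let w2_0_le : `|w2 0| <= C5 * mu0 ^+ 2.
Proof.
have M1 := ly_M ly; have K1 := ly_K ly; have i1 := ik_ge1.
have m16 := ly_mu0 ly; have /andP[kp0 kp1] := ly_kap ly.
have m01 := ly_mu ly; have /andP[p0 p1] := ly_p ly.
have M2 : 1 <= M ^+ 2 by rewrite exprn_ege1.
have c34 := C34; have c3 := C3_ge0; have c4 := C4_ge; have o1 := om_ge1.
have hk : 0 <= (1 : R) <= 2 by rewrite ler01/=; lra.
have A5_ge : 2 * C3 <= A5 by rewrite /A5; nra.
have a5_ge : A5 <= a5 by rewrite /a5 ler_peMr//; lra.
have X5_ge : 1 <= X5 by rewrite /X5 lerDr; nonneg.
have z1 := w1_0_le.
pose E := expR (- (p * mu1)).
have E0 : 0 < E by exact: expR_gt0.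
have E1 : E <= 1 by rewrite /E -expR0 ler_expR oppr_le0 mulr_ge0//; lra.
have E2 : p * mu1 * E <= 1.
  have /expRN_le : 0 <= p * mu1 by nonneg.
  by rewrite -/E; lra.
have lhalf : expR (- (K * mu0)) <= 1 / 2 by rewrite expRN_half//; nra.
have := @bar_slope0 R (a5 * (X5 * mu0 - E)) (- (a5 * X5 * mu0)) (- (K * mu0)) 0
  a5 (p * mu1) (- (p * mu1)) 0 0 0 e1
  (fun x => e2 * b x) (fun x => c x + 1 * (e2 * b1 x)) (fun x => w1 x - w1 0) w2 w3
  (fun x => k01 x - c1 x * w x - (c x + 1 * (e2 * b1 x)) * w1 0)
  (ly_e1 ly) _ _ dw2 _ _ _ _ _ cw2 _ _.
rewrite /bar /bar1 !eaff_0 !eaff_1 !mul0r !addr0 -/E !subrr !expR0 normr0.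
move=> H; apply: le_trans (H _ _ _ _ _ _ _ _ _) _ => {H} //.
- by apply: withinB cw1 _; exact: within_cst.
- by move=> x Ox; have := derB (dw1 Ox) (derC (w1 0) x); rewrite subr0.
- by move=> x Ox; exact: d_gt0.
- by move=> x Ox; rewrite -L1; ring.
- move=> x Ox.
  have /andP[h1 h1'] := ly_d ly Ox hk.
  have h2 := ly_pl ly Ox hk.
  have g1 : 0 <= - (a5 * X5 * mu0) * eaff (- (K * mu0)) 0 x * (- e1 * (- (K * mu0)) ^+ 2 +
    e2 * b x * - (K * mu0) + (c x + 1 * (e2 * b1 x))).
    apply: barrier_term_ge0 h2; last exact/ltW/eaff_gt0.
    by rewrite oppr_le0; nonneg.
  have g2 : A5 * e_1 x * om <= a5 * e_1 x * (- e1 * (p * mu1) ^+ 2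
    + e2 * b x * (p * mu1) + (c x + 1 * (e2 * b1 x))).
    by apply: (@barrier_term_le kap) => //; first [exact: (ly_pe1 ly Ox hk)|exact/ltW/decay1_gt0|nonneg].
  have g3 : A5 * mu0 <= (c x + 1 * (e2 * b1 x)) * (a5 * (X5 * mu0 - E)).
    set d := c x + _ in h1 h1' *.
    have q1 : mu0 <= d * (ik * (X5 * mu0 - E)).
      have q2 : 1 <= d * ik by rewrite -(divff (lt0r_neq0 kp0)) ler_wpM2r// invr_ge0 ltW.
      rewrite mulrA; rewrite /X5.
      have q3 : d * ik * E <= 2 * M * ik.
        by rewrite -[leRHS]mulr1 ler_pM//; first [nonneg|rewrite ler_wpM2r//; lra].
      have q4 : 2 * M * ik <= (d * ik) * (2 * M * ik * mu0).
        have q5 : 0 <= 2 * M * ik by nonneg.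
        have q6 : 2 * M * ik <= 2 * M * ik * mu0 by rewrite ler_peMr//; lra.
        by nra.
      by nra.
    rewrite /a5; have -> : d * (A5 * ik * (X5 * mu0 - E)) = A5 * (d * (ik * (X5 * mu0 - E))) by ring.
    by rewrite ler_wpM2l//; lra.
  have g4 : `|(c x + 1 * (e2 * b1 x)) * w1 0| <= 2 * M * (C3 * mu0).
    rewrite normrM ler_pM// ger0_norm//.
    by rewrite (le_trans _ h1)// ltW.
  have g5 := k1M Ox.
  have eom : 0 <= e_1 x * om by nonneg.
  apply: (le_trans (ler_normB _ _)).
  rewrite /e_1 /decay1 in g2 g5 eom *.
  have r1 : 2 * M ^+ 2 <= 2 * M ^+ 2 * mu0 by rewrite ler_peMr//; nonneg.
  have r2 : 0 <= 2 * M * C3 * (eaff (p * mu1) (- (p * mu1)) x * om) by nonneg.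
  have r3 : 2 * M ^+ 2 * (1 + om * eaff (p * mu1) (- (p * mu1)) x) + 2 * M * (C3 * mu0) <=
    A5 * mu0 + A5 * eaff (p * mu1) (- (p * mu1)) x * om by rewrite /A5; lra.
  rewrite !mul0r addr0.
  set T1 := - (a5 * X5 * mu0) * _ * _ in g1 *.
  set T2 := a5 * _ * _ in g2 *.
  by lra.
- by rewrite le_eqVlt; apply/orP; left; apply/eqP; ring.
- have : `|w1 1 - w1 0| <= C3 * mu0 by rewrite w11 sub0r normrN.
  have h1 : C3 * mu0 <= a5 * X5 * mu0 / 2.
    have h : 2 * C3 <= a5 * X5 by rewrite (le_trans A5_ge)// (le_trans a5_ge)// ler_peMr//; lra.
    have : 0 <= (a5 * X5 - 2 * C3) * mu0 by nonneg.
    by lra.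
  have h2 : a5 * X5 * mu0 * expR (- (K * mu0)) <= a5 * X5 * mu0 * (1 / 2).
    by rewrite ler_wpM2l//; nonneg.
  have h3 : 0 <= a5 * (1 - E) by nonneg.
  by lra.
- by ring.
- rewrite /C5.
  have h1 : a5 * (p * mu1 * E) <= a5 * 1 by rewrite ler_wpM2l//; lra.
  have h2 : a5 <= a5 * mu0 ^+ 2 by rewrite ler_peMr//; first [nonneg|rewrite exprn_ege1//; lra].
  by lra.
Qed.

Let ip := p^-1.
Let X6 := 1 + 2 * M * ip * ik.
Let C6 := C4 * ((X6 + 1) * K + 2 * ip).

(** The barrier for [w1] is made to vanish at 1: [mu0 * F], the value of its left exponential at 1,
    is subtracted from the constant, and the steep exponential with coefficient [- C4 * (X6 + 1)]
    cancels what remains. Powers of [mu0] times [F] stay bounded, so the slope is of order [mu1]. *)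
Let w2_1_le : `|w2 1| <= C6 * mu1.
Proof.
have M1 := ly_M ly; have K1 := ly_K ly; have i1 := ik_ge1.
have m16 := ly_mu0 ly; have /andP[kp0 kp1] := ly_kap ly.
have m01 := ly_mu ly; have /andP[p0 p1] := ly_p ly.
have M2 : 1 <= M ^+ 2 by rewrite exprn_ege1.
have c34 := C34; have c3 := C3_ge0; have c4 := C4_ge; have o1 := om_ge1.
have hk : 0 <= (1 : R) <= 2 by rewrite ler01/=; lra.
have ip1 : 1 <= ip by rewrite /ip invf_ge1// ltW.
have X6_ge : 2 * ip <= X6.
  rewrite /X6; have : ip <= M * ip * ik.
    by rewrite -mulrA mulrCA ler_peMr//; first [nonneg|rewrite -[1]mulr1 ler_pM].
  by lra.
pose F := expR (- (p * mu0)).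
have F0 : 0 < F by exact: expR_gt0.
have F1 : mu0 * F <= ip.
  have /expRN_le : 0 <= p * mu0 by nonneg.
  rewrite -/F => h; have h' : p * (mu0 * F) <= 1 by nra.
  by rewrite /ip -[leRHS]mul1r ler_pdivlMr// mulrC.
have F2 : p * mu0 ^+ 2 * F <= 2 * ip.
  have /expRN_le2 : 0 <= p * mu0 by nonneg.
  rewrite -/F /ip ler_pdivlMr// => h.
  by have -> : p * mu0 ^+ 2 * F * p = (p * mu0) ^+ 2 * F by ring.
have mhalf : expR (- (K * mu1)) <= 1 / 2 by rewrite expRN_half//; nra.
have mE : expR (- (K * mu1)) <= expR (- (p * mu1)).
  by rewrite ler_expR lerN2 ler_wpM2r//; lra.
have z1 := w1_0_le.
have := @bar_slope1 R (C4 * (X6 - mu0 * F)) C4 (p * mu1) (- (p * mu1))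
  (C4 * mu0) (- (p * mu0)) 0 (- (C4 * (X6 + 1))) (K * mu1) (- (K * mu1)) e1
  (fun x => e2 * b x) (fun x => c x + 1 * (e2 * b1 x)) w1 w2 w3
  (fun x => k01 x - c1 x * w x)
  (ly_e1 ly) cw1 dw1 dw2 _ (fun x _ => L1 x) _ _ _ cw2 w11 _.
rewrite /bar /bar1 !eaff_0 !eaff_1 !addr0 !subrr !expR0 -/F w11 normr0.
move=> H; apply: le_trans (H _ _ _ _ _) _ => {H} //.
- by move=> x Ox; exact: d_gt0.
- move=> x Ox.
  have /andP[h1 h1'] := ly_d ly Ox hk.
  have h2 := ly_pm ly Ox hk.
  have g1 : 0 <= - (C4 * (X6 + 1)) * eaff (K * mu1) (- (K * mu1)) x * (- e1 * (K * mu1) ^+ 2 +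
    e2 * b x * (K * mu1) + (c x + 1 * (e2 * b1 x))).
    apply: barrier_term_ge0 h2; last exact/ltW/eaff_gt0.
    by rewrite oppr_le0; nonneg.
  have g2 : 2 * M ^+ 2 * e_1 x * om <= C4 * e_1 x * (- e1 * (p * mu1) ^+ 2
    + e2 * b x * (p * mu1) + (c x + 1 * (e2 * b1 x))).
    by apply: (@barrier_term_le kap) => //; first [exact: (ly_pe1 ly Ox hk)|exact/ltW/decay1_gt0|nonneg].
  have g3 : 0 <= C4 * mu0 * e0 x * (- e1 * (- (p * mu0)) ^+ 2
    + e2 * b x * (- (p * mu0)) + (c x + 1 * (e2 * b1 x))).
    apply: mulr_ge0; first by rewrite /e0; nonneg.
    by have := ly_pe0 ly Ox hk; lra.
  have g4 : 2 * M ^+ 2 <= (c x + 1 * (e2 * b1 x)) * (C4 * (X6 - mu0 * F)).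
    set d := c x + _ in h1 h1' *.
    have q2 : 1 <= d * ik by rewrite -(divff (lt0r_neq0 kp0)) ler_wpM2r// invr_ge0 ltW.
    have q3 : d * (mu0 * F) <= 2 * M * ip.
      by rewrite ler_pM//; nonneg.
    have q4 : 2 * M * ip <= d * (2 * M * ip * ik).
      have -> : d * (2 * M * ip * ik) = (2 * M * ip) * (d * ik) by ring.
      by rewrite ler_peMr//; nonneg.
    have q5 : kap <= d * (X6 - mu0 * F) by rewrite /X6; nra.
    apply: (@le_trans _ _ (C4 * kap)).
      have -> : 2 * M ^+ 2 = 2 * M ^+ 2 * ik * kap.
        by rewrite -mulrA mulVf ?mulr1// lt0r_neq0.
      by rewrite ler_wpM2r// ltW.
    by rewrite mulrCA ler_wpM2l//; lra.
  have g5 := k1M Ox.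
  rewrite /e_1 /e0 /decay0 /decay1 in g2 g3 g5 *.
  by lra.
- have h1 : C4 * (mu0 * F) <= C4 * ip by rewrite ler_wpM2l//; lra.
  have h2 : C4 * (X6 * expR (- (K * mu1))) <= C4 * (X6 * (1 / 2)).
    by rewrite ler_wpM2l// ler_wpM2l//; lra.
  have h3 : C4 * expR (- (K * mu1)) <= C4 * expR (- (p * mu1)).
    by rewrite ler_wpM2l//; lra.
  have h4 : C4 * ip <= C4 * (X6 * (1 / 2)) by rewrite ler_wpM2l//; lra.
  have h5 : C3 * mu0 <= C4 * mu0 by rewrite ler_wpM2r//; lra.
  by lra.
- by rewrite le_eqVlt; apply/orP; left; apply/eqP; ring.
- by ring.
- rewrite /C6.
  have h1 : C4 * (p * mu0 ^+ 2 * F) <= C4 * (2 * ip) by rewrite ler_wpM2l//; lra.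
  have h2 : C4 * (2 * ip) <= C4 * (2 * ip) * mu1.
    by rewrite ler_peMr//; nonneg.
  have h3 : 0 <= C4 * (p * mu1) by nonneg.
  by lra.
Qed.

Let A7 := M ^+ 2 + M + 6 * M * C4.

(** The source of the twice differentiated equation is bounded by a constant, by [mu1 * om * e_1]
    and, through [w1_le], by [mu0 * e0]. The symbols on the matching barrier terms are at least
    [kap], [kap * om] and [kap]. The barrier also dominates both boundary values found above. *)
Lemma smooth_part_bound x : Omega_bar x ->
  `|rhs2 x| <= smooth_const M kap p K *
    (1 + mu0 ^+ 2 * decay0 (p * mu0) x + mu1 * decay1 (p * mu1) x).
Proof.
move=> Ox; pose C7 := A7 * ik + C5 + C6.
rewrite -[smooth_const _ _ _ _]/C7.
have M1 := ly_M ly; have K1 := ly_K ly; have i1 := ik_ge1.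
have m16 := ly_mu0 ly; have /andP[kp0 kp1] := ly_kap ly.
have m01 := ly_mu ly; have /andP[p0 p1] := ly_p ly.
have M2 : 1 <= M ^+ 2 by rewrite exprn_ege1.
have c34 := C34; have c3 := C3_ge0; have c4 := C4_ge; have o1 := om_ge1.
have /andP[e20 e21] := ly_e2 ly.
have hk : 0 <= (2 : R) <= 2 by rewrite lexx andbT.
have C50 : 0 <= C5.
  have := le_trans (normr_ge0 _) w2_0_le; rewrite pmulr_lge0// exprn_gt0//; lra.
have C60 : 0 <= C6.
  by have := le_trans (normr_ge0 _) w2_1_le; rewrite pmulr_lge0//; lra.
have A70 : 0 <= A7 by rewrite /A7; nra.
have A7C7 : A7 * kap^-1 <= C7 by rewrite /C7 -/ik -addrA lerDl addr_ge0.
have Aik : 0 <= A7 * ik by nonneg.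
have C70 : 0 <= C7 by rewrite /C7; lra.
have mu02 : mu0 <= mu0 ^+ 2 by rewrite expr2 ler_peMr//; lra.
have -> : C7 * (1 + mu0 ^+ 2 * decay0 (p * mu0) x + mu1 * decay1 (p * mu1) x) =
  bar C7 (C7 * mu1) (p * mu1) (- (p * mu1)) (C7 * mu0 ^+ 2) (- (p * mu0)) 0 0 0 0 x.
  by rewrite /bar /decay0 /decay1; ring.
apply: (@bar_bound R _ _ _ _ _ _ _ _ _ _ e1
  (fun x => e2 * b x) (fun x => c x + 2 * (e2 * b1 x)) w2 w3 w4
  (fun x => k02 x - 2 * c1 x * w1 x - c2 x * w x - e2 * b2 x * w1 x)
  (ly_e1 ly) cw2 dw2 dw3 _ (fun x _ => L2' x)) => //.
- by move=> y Oy; exact: d_gt0.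
- move=> y Oy; have Oy' := Omega_sub Oy.
  have pe0 : 0 < e0 y by exact: decay0_gt0.
  have pe1 : 0 < e_1 y by exact: decay1_gt0.
  have /andP[h1 _] := ly_d ly Oy hk.
  have g1 : A7 * 1 * 1 <= C7 * 1 * (c y + 2 * (e2 * b1 y)).
    by apply: (@barrier_term_le kap) => //; rewrite mulr1.
  have g2 : A7 * (mu1 * e_1 y) * om <= C7 * (mu1 * e_1 y) * (- e1 * (p * mu1) ^+ 2
    + e2 * b y * (p * mu1) + (c y + 2 * (e2 * b1 y))).
    apply: (@barrier_term_le kap) => //; first [exact: (ly_pe1 ly Oy hk)|nonneg].
  have g3 : A7 * (mu0 ^+ 2 * e0 y) * 1 <= C7 * (mu0 ^+ 2 * e0 y) *
    (- e1 * (- (p * mu0)) ^+ 2 + e2 * b y * (- (p * mu0)) + (c y + 2 * (e2 * b1 y))).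
    apply: (@barrier_term_le kap) => //; first [rewrite mulr1; exact: (ly_pe0 ly Oy hk)|nonneg].
  have g3' : A7 * (mu0 * e0 y) <= A7 * (mu0 ^+ 2 * e0 y) * 1.
    by rewrite mulr1 ler_wpM2l// ler_wpM2r//; exact/ltW/decay0_gt0.
  have le1 : e_1 y <= 1 by apply: decay1_le1 => //; nonneg.
  have t1 := k02M Oy.
  have z := w1_le Oy'.
  have z' : `|w1 y| <= 2 * C4 * (1 + mu0 * e0 y).
    apply: (le_trans z); have : 0 <= mu0 * e0 y by nonneg.
    by nra.
  have t2 : `|2 * c1 y * w1 y| <= 2 * M * (2 * C4 * (1 + mu0 * e0 y)).
    rewrite normrM ler_pM// normrM gtr0_norm// ler_wpM2l//; exact: ly_c1M ly _ Oy.
  have t3 : `|c2 y * w y| <= M ^+ 2.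
    by rewrite normrM expr2 ler_pM// ?(ly_c2M ly)// wM.
  have t4 : `|e2 * b2 y * w1 y| <= M * (2 * C4 * (1 + mu0 * e0 y)).
    rewrite normrM ler_pM// normrM gtr0_norm//.
    by rewrite -[leRHS]mul1r; apply: ler_pM => //; [exact: ltW|exact: (ly_b2M ly Oy)].
  have s1 : `|k02 y - 2 * c1 y * w1 y - c2 y * w y - e2 * b2 y * w1 y| <=
    M * (1 + mu1 * om * e_1 y) + 2 * M * (2 * C4 * (1 + mu0 * e0 y)) + M ^+ 2 +
    M * (2 * C4 * (1 + mu0 * e0 y)).
    apply: (le_trans (ler_normB _ _)); apply: lerD t4.
    apply: (le_trans (ler_normB _ _)); apply: lerD t3.
    by apply: (le_trans (ler_normB _ _)); exact: lerD t1 t2.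
  apply: (le_trans s1); rewrite !mul0r addr0.
  have G : M * (1 + mu1 * om * e_1 y) + 2 * M * (2 * C4 * (1 + mu0 * e0 y)) + M ^+ 2 +
    M * (2 * C4 * (1 + mu0 * e0 y)) <= A7 * 1 * 1 + A7 * (mu1 * e_1 y) * om + A7 * (mu0 * e0 y).
    have P1 : 0 <= mu1 * e_1 y * om by nonneg.
    have P2 : 0 <= mu0 * e0 y by nonneg.
    have P3 : 0 <= M * C4 by nonneg.
    have P4 : 0 <= M * C4 * (mu1 * e_1 y * om) by exact: mulr_ge0.
    have P5 : 0 <= (M ^+ 2 + M) * (mu0 * e0 y) by nonneg.
    have P6 : 0 <= M ^+ 2 * (mu1 * e_1 y * om) by nonneg.
    by rewrite /A7; lra.
  rewrite /e_1 /e0 /decay0 /decay1 in g2 g3 g3' G *.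
  set P1 := - e1 * (p * mu1) ^+ 2 + _ + _ in g2 *.
  set P2 := - e1 * (- (p * mu0)) ^+ 2 + _ + _ in g3 *.
  by lra.
- rewrite /bar !eaff_0 expR0 mul0r addr0 mulr1.
  apply: (le_trans w2_0_le).
  have h1 : C5 * mu0 ^+ 2 <= C7 * mu0 ^+ 2 by rewrite ler_wpM2r ?sqr_ge0// /C7; lra.
  have h2 : 0 <= C7 * mu1 * expR (- (p * mu1)) by nonneg.
  by lra.
- rewrite /bar !eaff_1 subrr expR0 mul0r addr0 mulr1.
  apply: (le_trans w2_1_le).
  have h1 : C6 * mu1 <= C7 * mu1 by rewrite ler_wpM2r// /C7; lra.
  have h2 : 0 <= C7 * mu0 ^+ 2 * expR (- (p * mu0) + 0).
    by nonneg.
  by lra.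
Qed.

End smooth_part.
End LayerBounds.

(** * Decomposition of the solution *)

Section Decomposition.
Context {R : realType}.

(** The smooth part has larger data bounds than [u]. Enlarging [M] alone keeps [kap] and [K], hence
    all the symbol inequalities. *)
Lemma layered_mono (M M' kap p K e1 e2 : R) b b1 b2 c c1 c2 mu0 mu1 : M <= M' ->
  layered M kap p K e1 e2 b b1 b2 c c1 c2 mu0 mu1 ->
  layered M' kap p K e1 e2 b b1 b2 c c1 c2 mu0 mu1.
Proof.
move=> MM [M1 kp pp KK e10 e20 m0 m1 cb cc db db1 dc dc1 bM b1M b2M cM c1M c2M d pe0 pe1 pl pm].
have le (g : R -> R) x : `|g x| <= M -> `|g x| <= M' by move=> /le_trans; exact.
split=> //; try (by move=> x Ox; apply: le; auto); first exact: le_trans MM.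
by move=> x k Ox hk; have /andP[h1 h2] := d x k Ox hk; rewrite h1; lra.
Qed.

Variables (M kap p K e1 e2 : R) (b b1 b2 c c1 c2 : R -> R) (mu0 mu1 : R).
Hypothesis ly : layered M kap p K e1 e2 b b1 b2 c c1 c2 mu0 mu1.
Variables (f f1 f2 u u1 : R -> R) (G : R).
Hypotheses (cf : {within Omega_bar, continuous f})
  (df : forall x, Omega x -> der f x (f1 x))
  (df1 : forall x, Omega x -> der f1 x (f2 x))
  (fM : forall x, Omega_bar x -> `|f x| <= M)
  (f1M : forall x, Omega x -> `|f1 x| <= M)
  (f2M : forall x, Omega x -> `|f2 x| <= M).
Hypotheses (cu : {within Omega_bar, continuous u})
  (cu1 : {within Omega_bar, continuous u1})
  (du : forall x, Omega x -> der u x (u1 x))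
  (du1 : forall x, Omega x -> der u1 x ((e2 * b x * u1 x + c x * u x - f x) / e1))
  (u00 : u 0 = 0) (u10 : u 1 = 0).
Hypotheses (Gmu : mu1 <= G <= K * mu1)
  (rootG : - e1 * G ^+ 2 + e2 * b 1 * G + c 1 = 0).

Let ik := kap^-1.
Let a := M * ik.
Let om := e2 * mu1 + 1.

Let e1n0 : e1 != 0. Proof. by rewrite lt0r_neq0// (ly_e1 ly). Qed.
Let mu1_ge : 16 <= mu1. Proof. exact: le_trans (ly_mu0 ly) (ly_mu ly). Qed.
Let M1 : 1 <= M. Proof. exact: ly_M ly. Qed.
Let K1 : 1 <= K. Proof. exact: ly_K ly. Qed.
Let ik_ge1 : 1 <= ik.
Proof. by have /andP[? ?] := ly_kap ly; rewrite /ik invf_ge1. Qed.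
Let a_ge : M <= a.
Proof. by rewrite /a ler_peMr// (le_trans ler01). Qed.
Let p01 : 0 < p < 1. Proof. exact: ly_p ly. Qed.

(** The barrier [a * (1 - exp (- K * mu1 * (1 - x)))] gives both: it is at most [a], and it vanishes
    at 1 with a slope of modulus [a * K * mu1]. As [G] is at least [mu1], this keeps the amplitude
    [A] bounded. *)
Let u_bound : (forall x, Omega_bar x -> `|u x| <= a) /\ `|u1 1| <= a * K * mu1.
Proof.
have hk : 0 <= (0 : R) <= 2 by rewrite lexx/=.
have /andP[kp0 kp1] := ly_kap ly.
have a0 : 0 <= a by rewrite (le_trans _ a_ge)// (le_trans ler01).
pose d x := c x + 0 * (e2 * b1 x).
pose u2 x := (e2 * b x * u1 x + c x * u x - f x) / e1.
have d0 x : Omega x -> 0 < d x.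
  by move=> Ox; have /andP[h _] := ly_d ly Ox hk; exact: lt_le_trans h.
have Lu x : Omega x -> - e1 * u2 x + e2 * b x * u1 x + d x * u x = f x.
  by move=> _; rewrite /u2 /d; field.
have em0 : expR (- (K * mu1)) <= 1.
  rewrite -expR0 ler_expR oppr_le0; apply: mulr_ge0; first exact: le_trans K1.
  exact: le_trans mu1_ge.
have kb x : Omega x -> `|f x| <= d x * a
    + (- a) * eaff (K * mu1) (- (K * mu1)) x * (- e1 * (K * mu1) ^+ 2 + e2 * b x * (K * mu1) + d x)
    + 0 * eaff 0 0 x * (- e1 * 0 ^+ 2 + e2 * b x * 0 + d x)
    + 0 * eaff 0 0 x * (- e1 * 0 ^+ 2 + e2 * b x * 0 + d x).
  move=> Ox.
  have /andP[h1 _] := ly_d ly Ox hk.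
  have h3 : 0 <= - a * eaff (K * mu1) (- (K * mu1)) x *
    (- e1 * (K * mu1) ^+ 2 + e2 * b x * (K * mu1) + d x).
    by apply: barrier_term_ge0 (ly_pm ly Ox hk); [rewrite oppr_le0|exact/ltW/eaff_gt0].
  have h4 : M * 1 * 1 <= a * 1 * d x.
    by apply: (@barrier_term_le _ kap) => //; [exact: le_trans M1|rewrite mulr1].
  by have := fM (Omega_sub Ox); rewrite !mul0r !addr0; lra.
have v0 : `|u 0| <= bar a (- a) (K * mu1) (- (K * mu1)) 0 0 0 0 0 0 0.
  rewrite u00 normr0 /bar !mul0r !addr0 eaff_0.
  have : a * expR (- (K * mu1)) <= a * 1 by rewrite ler_wpM2l.
  by lra.
have v1 : `|u 1| <= bar a (- a) (K * mu1) (- (K * mu1)) 0 0 0 0 0 0 1.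
  by rewrite u10 normr0 /bar !mul0r !addr0 eaff_1 subrr expR0 mulr1 subrr.
split.
  move=> x Ox; apply: (le_trans (bar_bound (ly_e1 ly) cu du du1 d0 Lu kb v0 v1 Ox)).
  rewrite /bar !mul0r !addr0 mulNr gerBl mulr_ge0//; exact/ltW/eaff_gt0.
have := bar_slope1 (ly_e1 ly) cu du du1 d0 Lu kb v0 v1 cu1 u10.
rewrite /bar /bar1 !mul0r !addr0 !eaff_1 !subrr !expR0 !mulr1 subrr.
by move=> /(_ erefl); rewrite mulNr opprK mulrA.
Qed.

Let A := u1 1 / G.
Let Am := a * K.
Let psi := eaff G (- G).
Let psi0 := expR (- G).
Let Cp := (1 - p)^-1.

Let G_gt0 : 0 < G.
Proof. by have /andP[h _] := Gmu; have := mu1_ge; lra. Qed.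

Let A_le : `|A| <= Am.
Proof.
have [_ h] := u_bound; have /andP[g _] := Gmu.
rewrite /A normrM normfV (gtr0_norm G_gt0) ler_pdivrMr//.
apply: (le_trans h); rewrite ler_wpM2l//.
have := a_ge; have := M1; have := K1 => k1 m1 am.
by rewrite /Am mulr_ge0//; lra.
Qed.

Let Am_ge0 : 0 <= Am. Proof. exact: le_trans (normr_ge0 _) A_le. Qed.

Let e_1 := decay1 (p * mu1).

Let psi_le x : Omega_bar x -> psi x <= e_1 x.
Proof.
move=> /Omega_barP/andP[x0 x1]; rewrite /psi /e_1 /decay1 /eaff ler_expR.
have /andP[h _] := Gmu; have /andP[p0 p1] := p01.
have : p * mu1 <= G by have := mu1_ge; nra.
by nra.
Qed.

Let psi_gt0 x : 0 < psi x. Proof. exact: eaff_gt0. Qed.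

(** The share [1 - p] of the exponent pays for the factor [G * (1 - x)], because [t * exp (- t)] is
    at most 1; the share [p] remains as [e_1]. *)
Let psi_decay x : Omega_bar x -> G * (1 - x) * psi x <= Cp * e_1 x.
Proof.
move=> /Omega_barP/andP[x0 x1].
have /andP[h _] := Gmu; have /andP[p0 p1] := p01.
have t0 : 0 <= (1 - p) * (G * (1 - x)).
  by rewrite mulr_ge0 ?subr_ge0 ?(ltW p1)// mulr_ge0 ?subr_ge0// ltW.
have E : psi x = expR (- ((1 - p) * (G * (1 - x)))) * expR (- (p * G * (1 - x))).
  by rewrite -expRD /psi /eaff; congr expR; ring.
have le1 : expR (- (p * G * (1 - x))) <= e_1 x.
  rewrite /e_1 /decay1 /eaff ler_expR.
  have : 0 <= p * (G - mu1) * (1 - x) by rewrite !mulr_ge0// ?subr_ge0// ltW.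
  by lra.
have h1 := expRN_le t0.
have h2 := expR_gt0 (- ((1 - p) * (G * (1 - x)))).
have h3 : (1 - p) * (G * (1 - x)) * expR (- ((1 - p) * (G * (1 - x)))) <= 1.
  by move: h1; rewrite mulrDl mul1r; lra.
rewrite [leRHS]mulrC /Cp ler_pdivlMr ?subr_gt0// E.
have -> : G * (1 - x) * (expR (- ((1 - p) * (G * (1 - x)))) * expR (- (p * G * (1 - x)))) * (1 - p)
  = ((1 - p) * (G * (1 - x)) * expR (- ((1 - p) * (G * (1 - x))))) * expR (- (p * G * (1 - x))).
  by ring.
rewrite -[leRHS]mul1r; apply: ler_pM => //;
  first [exact/ltW/expR_gt0 | apply: mulr_ge0 => //; exact/ltW/expR_gt0].
Qed.

(* [psi] is annihilated by the operator with its coefficients frozen at [1], and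
   [A] makes the derivative of the remainder vanish there. *)
Definition layer1 x := A * (psi x - psi0).
Definition layer1' x := A * (G * psi x).
Definition layer1'' x := A * (G * (G * psi x)).

Let e1_le1 x : Omega_bar x -> e_1 x <= 1.
Proof.
by move=> Ox; apply: decay1_le1 => //; have /andP[p0 _] := p01; have := mu1_ge; nra.
Qed.

Let psi_ge x : Omega_bar x -> psi0 <= psi x.
Proof.
move=> /Omega_barP/andP[x0 x1]; rewrite /psi /psi0 /eaff ler_expR lerDr.
by rewrite mulr_ge0// ltW.
Qed.

Let GK : 0 <= G <= K * mu1.
Proof. by have /andP[_ ->] := Gmu; rewrite ltW. Qed.

Lemma layer1_le x : Omega_bar x -> `|layer1 x| <= Am * e_1 x.
Proof.
move=> Ox; rewrite /layer1 normrM ler_pM// ger0_norm ?subr_ge0 ?psi_ge//.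
by apply: le_trans (psi_le Ox); rewrite gerBl ltW// expR_gt0.
Qed.

Lemma layer1'_le x : Omega_bar x -> `|layer1' x| <= Am * K * mu1 * e_1 x.
Proof.
move=> Ox; have /andP[g0 gK] := GK.
rewrite /layer1' normrM -2!mulrA ler_pM//.
have p0 : 0 <= psi x by exact: ltW.
by rewrite mulrA ger0_norm ?mulr_ge0// ler_pM// psi_le.
Qed.

Lemma layer1''_le x : Omega_bar x ->
  `|layer1'' x| <= Am * K ^+ 2 * mu1 ^+ 2 * e_1 x.
Proof.
move=> Ox; have /andP[g0 gK] := GK.
rewrite /layer1'' normrM -2!mulrA ler_pM//.
have p0 : 0 <= psi x by exact: ltW.
rewrite !ger0_norm ?mulr_ge0// (_ : K ^+ 2 * _ = (K * mu1) * ((K * mu1) * e_1 x)); last by ring.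
by rewrite !ler_pM ?mulr_ge0// psi_le.
Qed.

Lemma der_layer1 x : der layer1 x (layer1' x).
Proof.
apply: derZ; apply: (der_eq (derB (der_eaff _ _ _) (derC _ _))).
by rewrite subr0.
Qed.

Lemma der_layer1' x : der layer1' x (layer1'' x).
Proof. by apply: derZ; apply: derZ; exact: der_eaff. Qed.

(** The symbol at [G] with coefficients taken at [x]: the operator maps [psi] to [psi * q], and [q]
    vanishes at 1 because [G] is the root there. The functions [k0], [k01], [k02] are the source of
    the smooth part and its derivatives. *)
Let q x := - e1 * G ^+ 2 + e2 * b x * G + c x.
Let q1 x := e2 * b1 x * G + c1 x.
Let q2 x := e2 * b2 x * G + c2 x.
Let k0 x := f x - A * (psi x * q x - psi0 * c x).
Let k01 x := f1 x - A * ((G * psi x * q x + psi x * q1 x) - psi0 * c1 x).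
Let k02 x := f2 x - A * (((G * (G * psi x)) * q x + G * psi x * q1 x
  + (G * psi x * q1 x + psi x * q2 x)) - psi0 * c2 x).

Definition smooth x := u x - layer1 x.
Definition smooth' x := u1 x - layer1' x.
Definition smooth'' := rhs2 e1 e2 b c k0 smooth smooth'.

Let dq x : Omega x -> der q x (q1 x).
Proof.
move=> Ox; apply: (der_eq (a := (0 + e2 * b1 x * G) + c1 x)); last by rewrite add0r.
apply: derD (ly_dc ly Ox); apply: derD; first exact: derC.
have := derZ G (derZ e2 (ly_db ly Ox)).
rewrite (_ : (fun y => G * (e2 * b y)) = fun y => e2 * b y * G).
  by move=> h; apply: (der_eq h); ring.
by apply/funext => y; ring.
Qed.

Let dq1 x : Omega x -> der q1 x (q2 x).
Proof.
move=> Ox; apply: derD (ly_dc1 ly Ox).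
have := derZ G (derZ e2 (ly_db1 ly Ox)).
rewrite (_ : (fun y => G * (e2 * b1 y)) = fun y => e2 * b1 y * G).
  by move=> h; apply: (der_eq h); ring.
by apply/funext => y; ring.
Qed.

Let om_ge1 : 1 <= om.
Proof.
have /andP[h1 _] := ly_e2 ly; rewrite /om lerDr mulr_ge0//; first exact: ltW.
by have := mu1_ge; lra.
Qed.

Let e2G : e2 * G + 1 <= K * om.
Proof.
have /andP[h1 _] := ly_e2 ly; have /andP[g0 gK] := GK.
rewrite /om mulrDr mulr1 lerD// mulrCA ler_wpM2l//; exact: ltW.
Qed.

Let qlip (v g : R) : `|v| <= M -> `|g| <= M -> `|e2 * v * G + g| <= M * (K * om).
Proof.
move=> vM gM; have /andP[h1 _] := ly_e2 ly; have /andP[g0 gK] := GK.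
apply: (le_trans (ler_normD _ _)).
have h2 : `|e2 * v * G| <= e2 * M * G.
  by rewrite !normrM (gtr0_norm h1) (ger0_norm g0) ler_wpM2r// ler_wpM2l// ltW.
have := ler_wpM2l (le_trans ler01 M1) e2G.
by lra.
Qed.

Let q1M x : Omega x -> `|q1 x| <= M * (K * om).
Proof. by move=> Ox; apply: qlip; [exact: ly_b1M ly _ Ox|exact: ly_c1M ly _ Ox]. Qed.

Let q2M x : Omega x -> `|q2 x| <= M * (K * om).
Proof. by move=> Ox; apply: qlip; [exact: ly_b2M ly _ Ox|exact: ly_c2M ly _ Ox]. Qed.

Let cq : {within Omega_bar, continuous q}.
Proof.
have h : {within Omega_bar, continuous (fun x => (cst (- e1 * G ^+ 2) x + G * (e2 * b x)) + c x)}.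
  apply: withinD (ly_cc ly); apply: withinD; first exact: within_cst.
  by do 2!apply: withinZ; exact: ly_cb ly.
by apply: eq_within h => x _; rewrite /q /=; ring.
Qed.

Let qM x : Omega_bar x -> `|q x| <= M * (K * om) * (1 - x).
Proof.
move=> Ox; have /Omega_barP/andP[x0] := Ox.
rewrite le_eqVlt => /predU1P[->|x1].
  by rewrite /q rootG normr0 subrr mulr0.
have [t xt E] := mvt_Omega_bar cq dq Ox Omega_bar1 x1.
have -> : q x = - (q1 t * (1 - x)) by rewrite -E /q rootG; ring.
rewrite normrN normrM [`|1 - x|]gtr0_norm ?subr_gt0//.
by rewrite ler_wpM2r ?subr_ge0 ?(ltW x1)// q1M//; exact: subOmega Ox Omega_bar1 xt.
Qed.

Let Cp_ge1 : 1 <= Cp.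
Proof. by have /andP[p0 p1] := p01; rewrite /Cp invf_ge1 ?subr_gt0//; lra. Qed.

Let psi0_le1 : 0 <= psi0 <= 1.
Proof. by rewrite /psi0 ltW ?expR_gt0//= -expR0 ler_expR oppr_le0 ltW. Qed.

Let psi0M (g : R) : `|g| <= M -> `|psi0 * g| <= M.
Proof.
move=> gM; have /andP[h1 h2] := psi0_le1.
by rewrite normrM -[leRHS]mul1r ler_pM// ger0_norm.
Qed.

(** The factor [G] produced by differentiating [psi] is compensated by the zero of [q] at 1: [qM]
    supplies [1 - x], and [psi_decay] bounds [G * (1 - x) * psi]. *)
Let Gpq x : Omega_bar x -> `|G * psi x * q x| <= M * (K * om) * (Cp * e_1 x).
Proof.
move=> Ox; have h1 := qM Ox; have h2 := psi_decay Ox.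
have p0 := psi_gt0 x.
rewrite normrM (gtr0_norm (mulr_gt0 G_gt0 p0)).
apply: (@le_trans _ _ (G * psi x * (M * (K * om) * (1 - x)))).
  by rewrite ler_wpM2l//; apply: mulr_ge0; exact: ltW.
have -> : G * psi x * (M * (K * om) * (1 - x)) = M * (K * om) * (G * (1 - x) * psi x) by ring.
rewrite ler_wpM2l// !mulr_ge0//; [have := M1|have := K1|have := om_ge1]; lra.
Qed.

Let pq x : Omega_bar x -> `|psi x * q x| <= 2 * M * K * Cp.
Proof.
move=> Ox; have h := Gpq Ox.
have MK : 0 <= M * K by rewrite mulr_ge0//; [have := M1|have := K1]; lra.
have h1 : G * `|psi x * q x| <= M * (K * om) * (Cp * 1).
  have -> : G * `|psi x * q x| = `|G * psi x * q x|.
    by rewrite -mulrA [RHS]normrM (gtr0_norm G_gt0).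
  apply: (le_trans h).
  rewrite ler_wpM2l//; last by rewrite ler_wpM2l ?e1_le1//; have := Cp_ge1; lra.
  by rewrite mulrA mulr_ge0//; have := om_ge1; lra.
have h2 : om <= 2 * G.
  have /andP[e20 e21] := ly_e2 ly; have /andP[g _] := Gmu; have := mu1_ge.
  by rewrite /om; nra.
rewrite -(ler_pM2l G_gt0); apply: (le_trans h1).
have : 0 <= M * K * Cp * (2 * G - om).
  by rewrite mulr_ge0 ?subr_ge0// mulr_ge0//; have := Cp_ge1; lra.
by lra.
Qed.

Let pqi x (v : R) : Omega_bar x -> `|v| <= M * (K * om) ->
  `|psi x * v| <= M * (K * om) * e_1 x.
Proof.
move=> Ox vM; rewrite normrM (gtr0_norm (psi_gt0 x)) mulrC ler_pM//; last exact: psi_le.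
exact: ltW.
Qed.

(** Replaces [M] for the smooth part: it bounds [smooth], its source, and the two derivatives of the
    source in the units [1 + om * e_1] and [1 + mu1 * om * e_1]. *)
Definition decomp_const (M kap p K : R) : R :=
  let a := M * kap^-1 in let Am := a * K in let Cp := (1 - p)^-1 in
  M + a + Am * (1 + M + M * K * (3 * K * Cp + 2 * K + 2)).

Let M' := decomp_const M kap p K.

Let Z : 0 <= Am * (M * K) /\ 0 <= Am * (M * K) * Cp /\ 0 <= Am * (M * K) * K /\
  Am * (M * K) * Cp <= Am * (M * K) * (K * Cp).
Proof.
have K0 : 0 <= K by exact: le_trans K1.
have z : 0 <= Am * (M * K).
  by rewrite mulr_ge0// mulr_ge0//; exact: le_trans M1.
have c0 : 0 <= Cp by exact: le_trans Cp_ge1.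
split=> //; split; [by rewrite mulr_ge0|split; [by rewrite mulr_ge0|]].
by rewrite ler_wpM2l// ler_peMl.
Qed.

Let M'E : M' = M + a + Am + Am * M + 3 * (Am * (M * K) * (K * Cp)) +
  2 * (Am * (M * K) * K) + 2 * (Am * (M * K)).
Proof. by rewrite /M' /decomp_const -/ik -/a -/Am -/Cp; ring. Qed.

Let a_ge0 : 0 <= a. Proof. by apply: le_trans a_ge; exact: le_trans M1. Qed.
Let AmM : 0 <= Am * M.
Proof. by rewrite mulr_ge0//; exact: le_trans M1. Qed.

Let M_M' : M <= M'.
Proof.
have [z1 [z2 [z3 z4]]] := Z; rewrite M'E.
by have := a_ge0; have := Am_ge0; have := AmM; lra.
Qed.

Let wM x : Omega_bar x -> `|smooth x| <= M'.
Proof.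
move=> Ox; have [h _] := u_bound; have h1 := layer1_le Ox.
have h2 : Am * e_1 x <= Am * 1 by rewrite ler_wpM2l// e1_le1.
have [z1 [z2 [z3 z4]]] := Z; rewrite M'E.
apply: (le_trans (ler_normB _ _)); have := h x Ox.
by have := M1; have := AmM; lra.
Qed.

Let k0M x : Omega x -> `|k0 x| <= M'.
Proof.
move=> Ox; have Ox' := Omega_sub Ox; rewrite /k0.
apply: (le_trans (ler_normB _ _)); rewrite normrM.
have h : `|psi x * q x - psi0 * c x| <= 2 * M * K * Cp + M.
  by apply: (le_trans (ler_normB _ _)); apply: lerD; [exact: pq|apply: psi0M; exact: (ly_cM ly)].
have := ler_pM (normr_ge0 _) (normr_ge0 _) A_le h.
have [z1 [z2 [z3 z4]]] := Z; rewrite M'E.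
by have := fM Ox'; have := a_ge0; have := Am_ge0; have := AmM; lra.
Qed.

Let k01M x : Omega x -> `|k01 x| <= M' * (1 + om * e_1 x).
Proof.
move=> Ox; have Ox' := Omega_sub Ox; rewrite /k01.
apply: (le_trans (ler_normB _ _)); rewrite normrM.
set T := om * e_1 x.
have T0 : 0 <= T by rewrite mulr_ge0//; [have := om_ge1; lra|exact/ltW/decay1_gt0].
have h : `|G * psi x * q x + psi x * q1 x - psi0 * c1 x| <= M * K * (Cp + 1) * T + M.
  apply: (le_trans (ler_normB _ _)); apply: lerD; last by rewrite psi0M// (ly_c1M ly).
  apply: (le_trans (ler_normD _ _)).
  by have := Gpq Ox'; have := pqi Ox' (q1M Ox); rewrite /T; lra.
have := ler_pM (normr_ge0 _) (normr_ge0 _) A_le h.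
have [z1 [z2 [z3 z4]]] := Z.
have r1 : M + Am * M <= M'.
  by rewrite M'E; have := a_ge0; have := Am_ge0; lra.
have r2 : Am * (M * K) * Cp + Am * (M * K) <= M'.
  by rewrite M'E; have := a_ge0; have := Am_ge0; have := AmM; have := M1; lra.
have := ler_wpM2r T0 r2.
by have := f1M Ox; lra.
Qed.

Let k02M x : Omega x -> `|k02 x| <= M' * (1 + mu1 * om * e_1 x).
Proof.
move=> Ox; have Ox' := Omega_sub Ox; rewrite /k02.
apply: (le_trans (ler_normB _ _)); rewrite normrM.
have /andP[g0 gK] := GK.
set T := om * e_1 x.
have T0 : 0 <= T by rewrite mulr_ge0//; [have := om_ge1; lra|exact/ltW/decay1_gt0].
have mu10 : 1 <= mu1 by have := mu1_ge; lra.
have MK : 0 <= M * K by rewrite mulr_ge0//; [have := M1|have := K1]; lra.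
have h : `|G * (G * psi x) * q x + G * psi x * q1 x + (G * psi x * q1 x + psi x * q2 x)
    - psi0 * c2 x| <= M * K * (K * Cp + 2 * K + 1) * (mu1 * T) + M.
  apply: (le_trans (ler_normB _ _)); apply: lerD; last by rewrite psi0M// (ly_c2M ly).
  have s1 : `|G * (G * psi x) * q x| <= K * mu1 * (M * K * Cp * T).
    rewrite -mulrA normrM (ger0_norm g0) ler_pM//.
    by have := Gpq Ox'; rewrite /T; lra.
  have s2 : `|G * psi x * q1 x| <= K * mu1 * (M * K * T).
    rewrite -mulrA normrM (ger0_norm g0) ler_pM//.
    by have := pqi Ox' (q1M Ox); rewrite /T; lra.
  have s3 : `|psi x * q2 x| <= mu1 * (M * K * T).
    apply: (@le_trans _ _ (M * K * T)); first by have := pqi Ox' (q2M Ox); rewrite /T; lra.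
    by rewrite ler_peMl// mulr_ge0.
  apply: (le_trans (ler_normD _ _)).
  apply: (@le_trans _ _ ((K * mu1 * (M * K * Cp * T) + K * mu1 * (M * K * T)) +
     (K * mu1 * (M * K * T) + mu1 * (M * K * T)))); last by lra.
  by apply: lerD; apply: (le_trans (ler_normD _ _)); apply: lerD.
have := ler_pM (normr_ge0 _) (normr_ge0 _) A_le h.
have [z1 [z2 [z3 z4]]] := Z.
have r1 : M + Am * M <= M'.
  by rewrite M'E; have := a_ge0; have := Am_ge0; lra.
have r2 : Am * (M * K) * (K * Cp) + 2 * (Am * (M * K) * K) + Am * (M * K) <= M'.
  by rewrite M'E; have := a_ge0; have := Am_ge0; have := AmM; have := M1; lra.
have mT : 0 <= mu1 * T by rewrite mulr_ge0//; lra.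
have := ler_wpM2r mT r2.
have -> : mu1 * om * e_1 x = mu1 * T by rewrite /T mulrA.
by have := f2M Ox; lra.
Qed.

Let cpsi : {within Omega_bar, continuous psi}. Proof. exact: within_eaff. Qed.

Let ck0 : {within Omega_bar, continuous k0}.
Proof.
apply: withinB => //; apply: withinZ; apply: withinB.
  exact: withinM cpsi cq.
by apply: withinZ; exact: ly_cc ly.
Qed.

Let dk0 x : Omega x -> der k0 x (k01 x).
Proof.
move=> Ox; apply: derB (df Ox) _; apply: derZ; apply: derB.
  exact: derM (der_eaff _ _ _) (dq Ox).
by apply: derZ; exact: ly_dc ly _ Ox.
Qed.

Let dk01 x : Omega x -> der k01 x (k02 x).
Proof.
move=> Ox; apply: derB (df1 Ox) _; apply: derZ; apply: derB.
  apply: derD.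
    by apply: derM (dq Ox); apply: derZ; exact: der_eaff.
  exact: derM (der_eaff _ _ _) (dq1 Ox).
by apply: derZ; exact: ly_dc1 ly _ Ox.
Qed.

Lemma within_layer1 : {within Omega_bar, continuous layer1}.
Proof. exact: derivable_within der_layer1. Qed.

Lemma within_layer1' : {within Omega_bar, continuous layer1'}.
Proof. exact: derivable_within der_layer1'. Qed.

Lemma within_smooth : {within Omega_bar, continuous smooth}.
Proof. exact: withinB cu within_layer1. Qed.

Lemma within_smooth' : {within Omega_bar, continuous smooth'}.
Proof. exact: withinB cu1 within_layer1'. Qed.

Lemma der_smooth x : Omega x -> der smooth x (smooth' x).
Proof. by move=> Ox; exact: derB (du Ox) (der_layer1 x). Qed.

Lemma der_smooth' x : Omega x -> der smooth' x (smooth'' x).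
Proof.
move=> Ox; apply: (der_eq (derB (du1 Ox) (der_layer1' x))).
rewrite /smooth'' /rhs2 /k0 /smooth /smooth' /layer1 /layer1' /layer1'' /q.
by field.
Qed.

Lemma layer1_0 : layer1 0 = 0.
Proof. by rewrite /layer1 /psi eaff_0 subrr mulr0. Qed.

Lemma smooth''_le x : Omega_bar x -> `|smooth'' x| <=
  smooth_const (decomp_const M kap p K) kap p K *
    (1 + mu0 ^+ 2 * decay0 (p * mu0) x + mu1 * decay1 (p * mu1) x).
Proof.
move=> Ox; apply: (smooth_part_bound (layered_mono M_M' ly) (k01 := k01) (k02 := k02)) => //.
- exact: within_smooth.
- exact: within_smooth'.
- exact: der_smooth.
- exact: der_smooth'.
- by rewrite /smooth u00 layer1_0 subrr.
(* As [psi 1 = 1], the derivative of the layer term at 1 is [A * G], which is [u1 1] by the choice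
   of [A]. *)
- rewrite /smooth' /layer1' /psi eaff_1 subrr expR0 mulr1 /A.
  by rewrite divfK ?subrr// lt0r_neq0.
Qed.

End Decomposition.

(** * Layer parameters *)

Section Coefficients.
Context {R : realType}.

(** The continuous extensions given by [Cq] are used in place of the derivatives, whose values at 0
    and 1 are not controlled. *)
Lemma Cq_derivatives (q : nat) (g : R -> R) : (3 <= q)%N -> Cq q g ->
  exists g1 g2, exists2 M, 1 <= M &
  [/\ {within Omega_bar, continuous g},
      {within Omega_bar, continuous g1},
      (forall x, Omega x -> der g x (g1 x)),
      (forall x, Omega x -> der g1 x (g2 x)) &
      [/\ (forall x, Omega_bar x -> `|g x| <= M),
          (forall x, Omega_bar x -> `|g1 x| <= M) &
          (forall x, Omega x -> `|g2 x| <= M)] /\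
      (forall x, Omega x -> (g^`())%classic x = g1 x)].
Proof.
move=> q3 [cg dg hg].
have [h1 ch1 Eh1] := hg 1%N (ltnW (ltnW q3)).
have [h2 ch2 Eh2] := hg 2%N (ltnW q3).
have [M0 M00 gM] := within_bounded cg.
have [M1 M10 gM1] := within_bounded ch1.
have [M2 M20 gM2] := within_bounded ch2.
have dg1 x : Omega x -> der g x (h1 x).
  move=> Ox; rewrite Eh1// derive1n1; apply: DeriveDef; last by rewrite derive1E.
  by have := dg 0%N x (ltnW (ltnW q3)) Ox; rewrite derive1n0.
exists h1, h2; exists (1 + M0 + M1 + M2); first by lra.
split=> //.
- move=> x Ox; apply: (@is_derive_near _ (g^`())%classic).
    near=> y; have Oy : Omega y by near: y; exact: near_Omega.
    by rewrite Eh1// derive1n1.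
  rewrite (Eh2 _ Ox) derive1Sn derive1n1 derive1E; apply: derivableP.
  by have := dg 1%N x (ltnW q3) Ox; rewrite derive1n1.
- split; last by move=> x Ox; rewrite Eh1// derive1n1.
  split=> x Ox; first by apply: le_trans (gM x Ox) _; lra.
    by apply: le_trans (gM1 x Ox) _; lra.
  by apply: le_trans (gM2 x (Omega_sub Ox)) _; lra.
Unshelve. all: by end_near. Qed.

(** The symbol factors as [- e1 * (t - g0 x) * (t - g1 x)]. Its sign at [- mu0] and at [mu1] gives
    the inequalities valid for all [x]; at the points where the extrema are attained it vanishes,
    which gives the reverse bounds. [G] is [g1 1]. *)
Lemma layer_parameters_symbol (e1 e2 l M : R) (b c : R -> R) (mu0 mu1 : R) :
  0 < e1 -> 0 < e2 -> 0 < l ->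
  (forall x, Omega_bar x -> l <= b x) -> (forall x, Omega_bar x -> l <= c x) ->
  (forall x, Omega_bar x -> `|b x| <= M) -> (forall x, Omega_bar x -> `|c x| <= M) ->
  layer_parameters e1 e2 b c mu0 mu1 ->
  [/\ 0 < mu0, 0 < mu1,
    (forall x, Omega_bar x -> e1 * mu0 ^+ 2 + e2 * b x * mu0 <= c x),
    (forall x, Omega_bar x -> e1 * mu1 ^+ 2 <= e2 * b x * mu1 + c x) &
    [/\ l <= e1 * mu0 ^+ 2 + e2 * M * mu0,
        e2 * l * mu1 + l <= e1 * mu1 ^+ 2 &
        exists2 G, mu1 <= G & - e1 * G ^+ 2 + e2 * b 1 * G + c 1 = 0]].
Proof.
move=> e10 e20 l0 lb lc bM cM [g0 [g1 [Hg [[x0 Ox0 Ex0] Hm0] [[x1 Ox1 Ex1] Hm1]]]].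
have mu00 : 0 < mu0 by have [h _ _ _] := Hg _ Ox0; rewrite -oppr_lt0 -Ex0.
have mu10 : 0 < mu1 by have [_ h _ _] := Hg _ Ox1; rewrite -Ex1.
have fact x t : Omega_bar x ->
    - e1 * t ^+ 2 + e2 * b x * t + c x = - e1 * (t - g0 x) * (t - g1 x).
  move=> Ox; have [n0 n1 r0 r1] := Hg _ Ox.
  have d : g1 x - g0 x != 0 by rewrite subr_eq0 gt_eqF// (lt_trans n0).
  have s : e2 * b x = e1 * (g0 x + g1 x).
    by apply: (mulIf d); lra.
  have m : c x = - e1 * (g0 x * g1 x) by move: r0; rewrite s => r0; lra.
  by rewrite s m; ring.
split=> //.
- move=> x Ox; have [n0 n1 r0 r1] := Hg _ Ox; have h := Hm0 _ Ox.
  have := fact x (- mu0) Ox.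
  have : 0 <= e1 * (- mu0 - g0 x) * (g1 x + mu0).
    by rewrite !mulr_ge0//; lra.
  by lra.
- move=> x Ox; have [n0 n1 r0 r1] := Hg _ Ox; have h := Hm1 _ Ox.
  have := fact x mu1 Ox.
  have : 0 <= e1 * (mu1 - g0 x) * (g1 x - mu1).
    by rewrite !mulr_ge0//; lra.
  by lra.
split.
- have [n0 n1 r0 r1] := Hg _ Ox0; have := lc _ Ox0; move: r0; rewrite Ex0 => r0.
  have : e2 * mu0 * b x0 <= e2 * mu0 * M.
    apply: ler_wpM2l; first by rewrite mulr_ge0 ?ltW.
    by apply: le_trans (bM _ Ox0); exact: ler_norm.
  by lra.
- have [n0 n1 r0 r1] := Hg _ Ox1; have := lc _ Ox1; move: r1; rewrite Ex1 => r1.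
  have : e2 * mu1 * l <= e2 * mu1 * b x1 by apply: ler_wpM2l; [rewrite mulr_ge0 ?ltW|exact: lb].
  by lra.
- exists (g1 1); first exact: Hm1 Omega_bar1.
  by have [_ _ _ ->] := Hg _ Omega_bar1.
Qed.

(** At [m = p * mu0] the sum [e1 * m ^+ 2 + e2 * b * m] is at most [p * c]. Of the remaining
    [(1 - p) * c], the perturbation [d] takes no more than half. The further factor [p] makes the
    bound common to both layers. *)
Lemma symbol_decay0 (l p e1 e2 mu0 b c d : R) : 0 < p < 1 -> 0 < l -> 0 < e1 ->
  `|d| <= (1 - p) * l / 2 -> l <= c -> e1 * mu0 ^+ 2 + e2 * b * mu0 <= c ->
  p * (1 - p) * l / 2 <= - e1 * (- (p * mu0)) ^+ 2 + e2 * b * (- (p * mu0)) + (c + d).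
Proof.
move=> /andP[p0 p1] l0 e10; rewrite ler_norml => /andP[hd _] lc hc.
have q0 : 0 < 1 - p by rewrite subr_gt0.
have h1 : p * (e1 * mu0 ^+ 2 + e2 * b * mu0) <= p * c by rewrite ler_pM2l.
have h2 : 0 <= p * ((1 - p) * (e1 * mu0 ^+ 2)) by nonneg.
have h3 : (1 - p) * l <= (1 - p) * c by rewrite ler_pM2l.
have h4 : p * ((1 - p) * l) <= 1 * ((1 - p) * l) by rewrite ler_pM2r ?mulr_gt0// ltW.
by lra.
Qed.

(** The quadratic term shrinks by [p ^+ 2], the linear one only by [p]. What is left over grows like
    [e2 * mu1], and this absorbs the factor [om] of the sources. *)
Lemma symbol_decay1 (l p e1 e2 mu1 b c d : R) : 0 < p < 1 -> 0 < l -> 0 < e2 -> 0 < mu1 ->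
  `|d| <= (1 - p) * l / 2 -> l <= b -> l <= c -> e1 * mu1 ^+ 2 <= e2 * b * mu1 + c ->
  p * (1 - p) * l / 2 * (e2 * mu1 + 1) <=
    - e1 * (p * mu1) ^+ 2 + e2 * b * (p * mu1) + (c + d).
Proof.
move=> /andP[p0 p1] l0 e20 mu10; rewrite ler_norml => /andP[hd _] lb lc hc.
have q0 : 0 < 1 - p by rewrite subr_gt0.
have h1 : p ^+ 2 * (e1 * mu1 ^+ 2) <= p ^+ 2 * (e2 * b * mu1 + c).
  by rewrite ler_wpM2l ?sqr_ge0.
have h2 : p * ((1 - p) * (e2 * (mu1 * l))) <= p * ((1 - p) * (e2 * (mu1 * b))).
  by rewrite !ler_pM2l.
have h3 : (1 - p) * l <= (1 - p) * c by rewrite ler_pM2l.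
have h4 : p * ((1 - p) * l) <= 1 * ((1 - p) * l) by rewrite ler_pM2r ?mulr_gt0// ltW.
have h5 : 0 <= p * ((1 - p) * (e2 * (mu1 * l))) by nonneg.
have h6 : 0 <= p * ((1 - p) * c).
  by rewrite !mulr_ge0 ?(ltW p0) ?(ltW q0)// (le_trans (ltW l0)).
by lra.
Qed.

(* [M (e1 m^2 + e2 b m) >= K l (e1 mu0^2 + e2 M mu0) >= K l^2] at [m = K mu0] *)
Lemma symbol_steep0 (l M K e1 e2 mu0 b c d : R) : 0 < l <= 1 -> 1 <= M -> 1 <= K ->
  K * l ^+ 2 = 4 * M ^+ 2 -> 0 < e1 -> 0 < e2 -> 0 < mu0 ->
  `|d| <= M -> l <= b -> `|c| <= M -> l <= e1 * mu0 ^+ 2 + e2 * M * mu0 ->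
  - e1 * (- (K * mu0)) ^+ 2 + e2 * b * (- (K * mu0)) + (c + d) <= 0.
Proof.
move=> /andP[l0 l1] M1 K1 KE e10 e20 mu00.
rewrite !ler_norml => /andP[_ hd] lb /andP[_ hc] hmu.
have M0 : 0 < M by exact: lt_le_trans M1.
have K0 : 0 < K by exact: lt_le_trans K1.
have t1 : 0 <= e1 * mu0 ^+ 2 by nonneg.
have t2 : 0 <= K * (M * (e2 * mu0)) by nonneg.
have lMK : l <= M * K by apply: (le_trans l1); rewrite -[leLHS]mulr1 ler_pM.
have s1 : K * l * (e1 * mu0 ^+ 2) <= K * (M * K) * (e1 * mu0 ^+ 2).
  by rewrite ler_wpM2r// ler_pM2l.
have s2 : K * (M * (e2 * mu0)) * l <= K * (M * (e2 * mu0)) * b by rewrite ler_wpM2l.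
have s3 : K * l * l <= K * l * (e1 * mu0 ^+ 2 + e2 * M * mu0).
  by rewrite ler_pM2l ?mulr_gt0.
have M2 : 0 <= M ^+ 2 by exact: sqr_ge0.
have s4 : M * (2 * M) <= M * (e1 * (K * mu0) ^+ 2 + e2 * b * (K * mu0)) by lra.
by rewrite ler_pM2l// in s4; lra.
Qed.

(** The quadratic term is at least [K ^+ 2 * l * (e2 * mu1 + 1)], hence at least
    [2 * K * M * (e2 * mu1 + 1)], which exceeds the linear term plus [c + d]. *)
Lemma symbol_steep1 (l M K e1 e2 mu1 b c d : R) : 0 < l -> 1 <= M -> 1 <= K ->
  2 * M <= K * l -> 0 < e2 -> 0 < mu1 ->
  `|d| <= M -> `|b| <= M -> `|c| <= M -> e2 * l * mu1 + l <= e1 * mu1 ^+ 2 ->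
  - e1 * (K * mu1) ^+ 2 + e2 * b * (K * mu1) + (c + d) <= 0.
Proof.
move=> l0 M1 K1 KlM e20 mu10.
rewrite !ler_norml => /andP[_ hd] /andP[_ hb] /andP[_ hc] hmu.
have M0 : 0 < M by exact: lt_le_trans M1.
have K0 : 0 < K by exact: lt_le_trans K1.
have t2 : 0 < e2 * mu1 by rewrite mulr_gt0.
have t3 : 0 <= e2 * mu1 + 1 by rewrite addr_ge0// ltW.
have s1 : K ^+ 2 * (e2 * l * mu1 + l) <= K ^+ 2 * (e1 * mu1 ^+ 2).
  by rewrite ler_wpM2l ?sqr_ge0.
have s2 : K * (2 * M) * (e2 * mu1 + 1) <= K * (K * l) * (e2 * mu1 + 1).
  by rewrite ler_wpM2r// ler_pM2l.
have s3 : K * (e2 * mu1) * b <= K * (e2 * mu1) * M by rewrite ler_pM2l// mulr_gt0.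
have s4 : 1 * (2 * M) <= K * (2 * M) by rewrite ler_pM2r// mulr_gt0.
have s5 : 0 <= K * (e2 * mu1) * M by nonneg.
by lra.
Qed.

Lemma layered_of_parameters (l M p e1 e2 : R) (b b1 b2 c c1 c2 : R -> R) (mu0 mu1 : R) :
  0 < l <= 1 -> 1 <= M -> 0 < p < 1 -> 0 < e1 -> 0 < e2 <= 1 -> 16 <= mu0 -> mu0 <= mu1 ->
  {within Omega_bar, continuous b} -> {within Omega_bar, continuous c} ->
  (forall x, Omega x -> der b x (b1 x)) -> (forall x, Omega x -> der b1 x (b2 x)) ->
  (forall x, Omega x -> der c x (c1 x)) -> (forall x, Omega x -> der c1 x (c2 x)) ->
  (forall x, Omega_bar x -> `|b x| <= M) -> (forall x, Omega x -> `|b1 x| <= M) ->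
  (forall x, Omega x -> `|b2 x| <= M) ->
  (forall x, Omega_bar x -> `|c x| <= M) -> (forall x, Omega x -> `|c1 x| <= M) ->
  (forall x, Omega x -> `|c2 x| <= M) ->
  (forall x, Omega_bar x -> l <= b x) -> (forall x, Omega_bar x -> l <= c x) ->
  (forall x, Omega_bar x -> e1 * mu0 ^+ 2 + e2 * b x * mu0 <= c x) ->
  (forall x, Omega_bar x -> e1 * mu1 ^+ 2 <= e2 * b x * mu1 + c x) ->
  l <= e1 * mu0 ^+ 2 + e2 * M * mu0 -> e2 * l * mu1 + l <= e1 * mu1 ^+ 2 ->
  4 * M * e2 <= (1 - p) * l ->
  layered M (p * (1 - p) * l / 2) p (4 * M ^+ 2 / l ^+ 2) e1 e2 b b1 b2 c c1 c2 mu0 mu1.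
Proof.
move=> l01 M1 p01 e10 e201 m16 m01.
have /andP[l0 l1] := l01; have /andP[p0 p1] := p01; have /andP[e20 e21] := e201.
have mu00 : 0 < mu0 by exact: lt_le_trans m16.
have mu10 : 0 < mu1 by exact: lt_le_trans m01.
have q0 : 0 < 1 - p by rewrite subr_gt0.
have q1 : 1 - p <= 1 by lra.
have ql1 : (1 - p) * l <= 1 by rewrite -[leRHS]mulr1 ler_pM// ltW.
have ql0 : 0 < (1 - p) * l by rewrite mulr_gt0.
have qll : (1 - p) * l <= 1 * l by rewrite ler_pM2r.
have pql : p * ((1 - p) * l) <= 1 * ((1 - p) * l) by rewrite ler_pM2r// ltW.
have kap0 : 0 < p * (1 - p) * l / 2 by rewrite !mulr_gt0.
have lM : l <= M by exact: le_trans M1.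
have KE : 4 * M ^+ 2 / l ^+ 2 * l ^+ 2 = 4 * M ^+ 2 by rewrite divfK// lt0r_neq0// exprn_gt0.
move: (4 * M ^+ 2 / l ^+ 2) KE => K KE.
have K4 : 4 <= K.
  rewrite -(ler_pM2r (exprn_gt0 2 l0)) KE ler_pM2l// lerXn2r ?nnegrE ?(ltW l0)//.
  exact: le_trans (ltW l0) lM.
have KlM : 2 * M <= K * l.
  have M0 : 0 <= M by exact: le_trans (ltW l0) lM.
  have h : 2 * M * l <= 2 * M * M by rewrite ler_wpM2l// mulr_ge0.
  have h' : 0 <= M ^+ 2 by exact: sqr_ge0.
  by rewrite -(ler_pM2r l0) -mulrA -[K * l * l]mulrA -expr2 KE; lra.
have K1 : 1 <= K by lra.
move=> cb cc db db1 dc dc1 bM b1M b2M cM c1M c2M lb lc P0 P1 Q0 Q1 small.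
(* The smallness of [eps2] enters here: with [k] at most 2, the perturbation stays within the margin
   [(1 - p) * l / 2] left by the symbols at the exponents [p * mu0] and [p * mu1]. *)
have b1k x k : Omega x -> 0 <= k <= 2 -> `|k * (e2 * b1 x)| <= (1 - p) * l / 2.
  move=> Ox /andP[k0 k2]; rewrite !normrM (ger0_norm k0) (gtr0_norm e20).
  have e0 := ltW e20; have n0 := normr_ge0 (b1 x).
  have h : e2 * `|b1 x| <= e2 * M by rewrite ler_pM2l// b1M.
  have h' : k * (e2 * `|b1 x|) <= 2 * (e2 * M) by rewrite ler_pM// mulr_ge0.
  by rewrite ler_pdivlMr//; lra.
have b1kM x k : Omega x -> 0 <= k <= 2 -> `|k * (e2 * b1 x)| <= M.
  by move=> Ox hk; apply: (le_trans (b1k x k Ox hk)); lra.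
split=> //.
- by rewrite kap0 /=; lra.
- move=> x k Ox hk; have := b1k x k Ox hk; rewrite ler_norml => /andP[h1 h2].
  have := cM x (Omega_sub Ox); rewrite ler_norml => /andP[_ h3].
  have h4 := lc x (Omega_sub Ox).
  by apply/andP; split; lra.
- move=> x k Ox hk; have Ox' := Omega_sub Ox.
  exact: symbol_decay0 p01 l0 e10 (b1k x k Ox hk) (lc x Ox') (P0 x Ox').
- move=> x k Ox hk; have Ox' := Omega_sub Ox.
  exact: symbol_decay1 p01 l0 e20 mu10 (b1k x k Ox hk) (lb x Ox') (lc x Ox') (P1 x Ox').
- move=> x k Ox hk; have Ox' := Omega_sub Ox.
  exact: symbol_steep0 l01 M1 K1 KE e10 e20 mu00 (b1kM x k Ox hk) (lb x Ox') (cM x Ox') Q0.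
- move=> x k Ox hk; have Ox' := Omega_sub Ox.
  exact: symbol_steep1 l0 M1 K1 KlM e20 mu10 (b1kM x k Ox hk) (bM x Ox') (cM x Ox') Q1.
Qed.

End Coefficients.

(** * The Bakhvalov-type mesh *)

Section LayerMesh.
Context {R : realType}.
Variables (tau p mu : R) (n N : nat).
Hypotheses (tau52 : 5 / 2 <= tau) (p01 : 0 < p < 1) (n4 : (4 <= n)%N)
  (Nn : N = (4 * n)%N) (muN : N%:R <= mu).

(* At the node [lpt i] of the mesh graded towards [0], [lden i] is the argument of
   the logarithm in the mesh generating function and [lexpo i = lden i `^ tau]
   the value of the layer function. *)
Let step := (1 - mu^-1) / n%:R.
Definition lden (i : nat) : R := 1 - (1 - mu^-1) / n%:R * i%:R.
Definition lpt (i : nat) : R := tau / (p * mu) * - ln (lden i).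

Let n0 : 0 < n%:R :> R. Proof. by rewrite ltr0n (leq_trans _ n4). Qed.
Let n4R : 4 <= n%:R :> R. Proof. by rewrite ler_nat. Qed.
Let NR : N%:R = 4 * n%:R :> R. Proof. by rewrite Nn natrM. Qed.
Let mu16 : 16 <= mu. Proof. by have := muN; rewrite NR; have := n4R; lra. Qed.
Let mu0 : 0 < mu. Proof. by have := mu16; lra. Qed.
Let imu : 0 < mu^-1 <= 1 / (4 * n%:R).
Proof.
rewrite invr_gt0 mu0/= div1r lef_pV2 ?posrE ?mulr_gt0//.
by rewrite -NR.
Qed.
Let inv4n : 1 / (4 * n%:R) = n%:R^-1 / 4 :> R.
Proof. by rewrite div1r invfM mulrC. Qed.
Let in4 : n%:R^-1 <= 4^-1 :> R.
Proof. by rewrite lef_pV2 ?posrE. Qed.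
Let imu16 : mu^-1 <= 1 / 16.
Proof.
have /andP[_ h] := imu; apply: (le_trans h); rewrite inv4n.
by have := in4; lra.
Qed.
Let step_ge : 15 / 16 / n%:R <= step.
Proof. by rewrite /step ler_wpM2r ?invr_ge0 ?(ltW n0)//; have := imu16; lra. Qed.
Let step_le : step <= n%:R^-1.
Proof.
rewrite /step -[leRHS]mul1r ler_wpM2r ?invr_ge0 ?(ltW n0)//.
by have /andP[h _] := imu; lra.
Qed.
Let step_gt0 : 0 < step.
Proof. by apply: lt_le_trans step_ge; rewrite divr_gt0. Qed.

Let ldenE i : lden i = 1 - step * i%:R. Proof. by []. Qed.
Let ldenS i : lden i.+1 = lden i - step.
Proof. by rewrite !ldenE -natr1; ring. Qed.
Lemma lden0 : lden 0 = 1. Proof. by rewrite /lden mulr0 subr0. Qed.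
Lemma ldenn : lden n = mu^-1.
Proof. by rewrite /lden divfK ?subKr// lt0r_neq0. Qed.
Let lden_mono i k : (i <= k)%N -> lden k <= lden i.
Proof.
by move=> ik; rewrite !ldenE lerD2l lerN2 ler_wpM2l ?ler_nat// ltW.
Qed.
Let lden_ge i : (i <= n)%N -> mu^-1 <= lden i.
Proof. by move=> i_n; rewrite -ldenn lden_mono. Qed.
Let lden_gt0 i : (i <= n)%N -> 0 < lden i.
Proof. by move=> /lden_ge; apply: lt_le_trans; rewrite invr_gt0. Qed.
Let lden_le1 i : lden i <= 1.
Proof. by rewrite -lden0 lden_mono. Qed.

Let c0 := tau / p.
Let c0_ge : 5 / 2 <= c0.
Proof.
have /andP[h1 h2] := p01; rewrite /c0 ler_pdivlMr//.
by have := tau52; nra.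
Qed.
Let mulpt i : mu * lpt i = c0 * - ln (lden i).
Proof.
have /andP[h1 h2] := p01.
rewrite /lpt /c0 invfM mulrA; field.
by rewrite !lt0r_neq0.
Qed.

Let gap i : (i < n)%N ->
  mu * (lpt i.+1 - lpt i) = c0 * ln (lden i / lden i.+1).
Proof.
move=> ilt; rewrite mulrBr !mulpt -mulrBr; congr (_ * _).
by rewrite ln_div ?posrE ?lden_gt0// 1?ltnW// addrC opprK.
Qed.

Let ratio i : (i < n)%N -> lden i / lden i.+1 = 1 + step / lden i.+1.
Proof.
move=> ilt; have h := lden_gt0 ilt.
have -> : lden i = lden i.+1 + step by rewrite ldenS subrK.
by rewrite mulrDl divff// lt0r_neq0.
Qed.

Let gap_le i : (i < n)%N -> mu * (lpt i.+1 - lpt i) <= c0 * (step / lden i.+1).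
Proof.
move=> ilt; have h := lden_gt0 ilt; rewrite gap// ratio//.
rewrite ler_wpM2l//; first by have := c0_ge; lra.
by apply: le_ln1Dx; apply: (lt_trans (ltrN10 R)); rewrite divr_gt0.
Qed.

Lemma lpt0 : lpt 0 = 0. Proof using All. by rewrite /lpt lden0 ln1 oppr0 mulr0. Qed.
Lemma lptn : lpt n = sigma tau p mu.
Proof using All. by rewrite /lpt ldenn lnV ?posrE// opprK. Qed.

Lemma lpt_lt i : (i < n)%N -> lpt i < lpt i.+1.
Proof using All.
move=> ilt; rewrite -subr_gt0 -(pmulr_rgt0 _ mu0) gap// ratio//.
rewrite mulr_gt0//; first by have := c0_ge; lra.
by rewrite ln_gt0// ltrDl divr_gt0// lden_gt0.
Qed.

(** In the worst case [lden] has dropped to [1 / mu]; the resulting factor [mu] in the scaled length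
    [mu * h] is removed by returning to [h]. *)
Lemma lpt_gap i : (i < n)%N -> lpt i.+1 - lpt i <= 4 * c0 / N%:R.
Proof using All.
move=> ilt; rewrite -(ler_pM2l mu0); apply: (le_trans (gap_le ilt)).
have h1 : step / lden i.+1 <= n%:R^-1 * mu.
  rewrite ler_pM ?invr_ge0 ?(ltW step_gt0) ?(ltW (lden_gt0 _))//.
  by rewrite -[leRHS]invrK lef_pV2 ?posrE ?lden_gt0 ?invr_gt0// lden_ge.
apply: (le_trans (ler_wpM2l _ h1)); first by have := c0_ge; lra.
rewrite NR invfM -subr_ge0.
by rewrite (_ : _ - _ = 0) ?lexx//; field; rewrite lt0r_neq0.
Qed.

Definition lexpo i := expR (- (p * mu * lpt i)).

Let lexpoE i : lexpo i = expR (tau * ln (lden i)).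
Proof.
have /andP[h1 h2] := p01.
rewrite /lexpo; congr expR; rewrite -mulrA mulpt /c0; field.
by rewrite lt0r_neq0.
Qed.

Let ln_le0 i : (i <= n)%N -> ln (lden i) <= 0.
Proof.
move=> ile; have h := lden_gt0 ile; rewrite -ler_expR lnK ?posrE// expR0.
exact: lden_le1.
Qed.

Lemma lexpo_le2 i : (i <= n)%N -> lexpo i <= lden i ^+ 2.
Proof.
move=> ile; have h := lden_gt0 ile.
rewrite lexpoE -[in leRHS](@lnK _ (lden i)) ?posrE// -expRM_natl ler_expR.
by have := ln_le0 ile; have := tau52; nra.
Qed.

(** [lexpo] is [lden] to the power [tau], and [lden] is at most 1, so [2 * tau] may be lowered to 5.
    This is the source of every fifth power below. *)
Lemma lexpo_le5 i : (i <= n)%N -> lexpo i ^+ 2 <= lden i ^+ 5.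
Proof.
move=> ile; have h := lden_gt0 ile.
rewrite lexpoE -[in leRHS](@lnK _ (lden i)) ?posrE// -!expRM_natl ler_expR.
by have := ln_le0 ile; have := tau52; nra.
Qed.

Let t i := mu * (lpt i.+1 - lpt i).
Let cm := 8 * c0.

Let lden_half i : (i.+1 < n)%N -> lden i <= 2 * lden i.+1.
Proof.
move=> ilt; have := lden_mono (ltnW ilt); have h : (i.+2 <= n)%N by [].
by have := lden_gt0 h; rewrite !ldenS; lra.
Qed.

(* Away from the last cell consecutive [lden] are comparable. *)
Let t_le i : (i.+1 < n)%N -> 0 < t i /\ t i * lden i <= cm / N%:R.
Proof.
move=> ilt; have ilt' := ltnW ilt; split.
  by rewrite mulr_gt0// subr_gt0 lpt_lt.
have h0 := lden_gt0 (ltnW ilt').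
have h1 := lden_gt0 ilt'.
have h := ler_wpM2r (ltW h0) (gap_le ilt').
apply: (le_trans h); rewrite -mulrA /cm NR.
have -> : 8 * c0 / (4 * n%:R) = c0 * (2 * n%:R^-1) by rewrite invfM; field; rewrite lt0r_neq0.
rewrite ler_wpM2l//; first by have := c0_ge; lra.
rewrite mulrAC ler_pdivrMr//.
have h2 := lden_half ilt.
apply: (@le_trans _ _ (n%:R^-1 * (2 * lden i.+1))); last by rewrite mulrA [_ * 2]mulrC.
by rewrite ler_pM ?step_le// ltW.
Qed.

(** By [t_le] the product of [t] and [lden] is of order [1 / N]; each power of [t] is paired with as
    many factors [lden] supplied by [lexpo], the surplus ones being at most 1. *)
Lemma fine_cell i : (i.+1 < n)%N ->
  [/\ t i * lexpo i <= cm / N%:R, t i ^+ 2 * lexpo i <= (cm / N%:R) ^+ 2,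
      t i ^+ 3 * lexpo i ^+ 2 <= (cm / N%:R) ^+ 3 &
      t i ^+ 5 * lexpo i ^+ 2 <= (cm / N%:R) ^+ 5].
Proof using All.
move=> ilt; have [t0 tl] := t_le ilt; have ile := ltnW (ltnW ilt).
have d0 := lden_gt0 ile; have d1 := lden_le1 i.
have t0' := ltW t0; have d0' := ltW d0.
have td0 : 0 <= t i * lden i by rewrite mulr_ge0.
have cN0 : 0 <= cm / N%:R by exact: le_trans tl.
have e2 := lexpo_le2 ile; have e5 := lexpo_le5 ile.
split.
- apply: (@le_trans _ _ (t i * lden i ^+ 2)); first by rewrite ler_wpM2l.
  apply: (@le_trans _ _ (t i * lden i)) => //.
  by rewrite ler_wpM2l// expr2 ler_piMr.
- apply: (@le_trans _ _ (t i ^+ 2 * lden i ^+ 2)); first by rewrite ler_wpM2l ?exprn_ge0.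
  by rewrite -exprMn lerXn2r ?nnegrE.
- apply: (@le_trans _ _ (t i ^+ 3 * lden i ^+ 5)); first by rewrite ler_wpM2l ?exprn_ge0.
  apply: (@le_trans _ _ (t i ^+ 3 * lden i ^+ 3)).
    by rewrite ler_wpM2l ?exprn_ge0// ler_wiXn2l.
  by rewrite -exprMn lerXn2r ?nnegrE.
- apply: (@le_trans _ _ (t i ^+ 5 * lden i ^+ 5)); first by rewrite ler_wpM2l ?exprn_ge0.
  by rewrite -exprMn lerXn2r ?nnegrE.
Qed.

(** These values are [1 / mu] plus one or two steps, where [1 / mu] is at most [1 / N] and, since
    [N = 4 * n], a step lies between [15 / (4 * N)] and [4 / N]. *)
Lemma coarse_lden : [/\ lden n.-1 <= 5 / N%:R, lden n.-2 <= 9 / N%:R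
  & 7 / N%:R <= lden n.-2].
Proof.
have e1 : n = n.-1.+1 by rewrite prednK// (leq_trans _ n4).
have e2 : n.-1 = n.-2.+1 by case: (n) n4 => [|[|?]].
have l1 : lden n.-1 = mu^-1 + step by rewrite -ldenn [in lden n]e1 ldenS subrK.
have l2 : lden n.-2 = mu^-1 + 2 * step.
  have : lden n.-1 = lden n.-2 - step by rewrite [in LHS]e2 ldenS.
  by rewrite l1; lra.
have /andP[i0 i1] := imu; rewrite inv4n in i1.
have s1 := step_ge; have s2 := step_le.
have nn : 0 < n%:R^-1 :> R by rewrite invr_gt0.
rewrite l1 l2 NR !invfM; split; lra.
Qed.

Lemma lexpo_coarse : lexpo n.-1 <= (9 / N%:R) ^+ 2 /\
  lexpo n.-1 ^+ 2 <= (9 / N%:R) ^+ 5 /\ lexpo n.-2 ^+ 2 <= (9 / N%:R) ^+ 5.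
Proof using All.
have [h1 h2 h3] := coarse_lden.
have N0 : 0 < N%:R^-1 :> R by rewrite invr_gt0 NR mulr_gt0.
have ln1 : (n.-1 <= n)%N by exact: leq_pred.
have ln2 : (n.-2 <= n)%N by apply: leq_trans ln1; exact: leq_pred.
have d1 := ltW (lden_gt0 ln1); have d2 := ltW (lden_gt0 ln2).
have h1' : lden n.-1 <= 9 / N%:R by lra.
have n9 : 0 <= 9 / N%:R :> R by rewrite mulr_ge0// ltW.
split; first by apply: (le_trans (lexpo_le2 ln1)); rewrite lerXn2r ?nnegrE.
split; first by apply: (le_trans (lexpo_le5 ln1)); rewrite lerXn2r ?nnegrE.
by apply: (le_trans (lexpo_le5 ln2)); rewrite lerXn2r ?nnegrE.
Qed.

(** The lengths are [c0] times the logarithm of the ratio of consecutive [lden]. Here that ratio is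
    at least [10 / 6], so its logarithm is at least [4 / 10], and [c0] is at least [5 / 2]. The
    upper bound uses that [lden] is at least [7 / N]. *)
Lemma transition_cell : 1 <= t n.-2 <= cm.
Proof using All.
have e1 : n = n.-1.+1 by rewrite prednK// (leq_trans _ n4).
have e2 : n.-1 = n.-2.+1 by case: (n) n4 => [|[|?]].
have lt2 : (n.-2.+1 < n)%N by rewrite -e2 [leqRHS]e1.
have [d1 d2 d3] := coarse_lden.
have N0 : 0 < N%:R^-1 :> R by rewrite invr_gt0 NR mulr_gt0.
have [t0 tl] := t_le lt2.
have p1 := lden_gt0 (ltnW lt2); have p2 := lden_gt0 (ltnW (ltnW lt2)).
apply/andP; split; last first.
  have h : 0 <= t n.-2 * (lden n.-2 - 7 / N%:R) by rewrite mulr_ge0 ?subr_ge0// ltW.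
  have : t n.-2 * N%:R^-1 <= cm * N%:R^-1 by have := mulr_gt0 t0 N0; lra.
  by rewrite ler_pM2r.
rewrite /t gap; last exact: ltnW.
set r := lden n.-2.+1 / lden n.-2.
have r0 : 0 < r by rewrite divr_gt0.
have rr : r <= 6 / 10.
  rewrite /r ler_pdivrMr// ldenS.
  have s1 := step_ge.
  have : 4 / 10 * lden n.-2 <= 4 / 10 * (9 / N%:R) by rewrite ler_wpM2l//; lra.
  by move: N0; rewrite NR !invfM => N0; lra.
have lnr : ln r <= r - 1.
  have := @le_ln1Dx R (r - 1); rewrite addrCA subrr addr0; apply.
  by lra.
have -> : lden n.-2 / lden n.-2.+1 = r^-1 by rewrite /r invf_div.
rewrite lnV ?posrE//.
have := c0_ge; nra.
Qed.

End LayerMesh.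

(** Near 1 the graded mesh is numbered backwards: cell [i] of the mesh is cell [4 * n - i.+1] of
    [lpt]. The index [(3 * n).+1] thus corresponds to cell [n.-2], the one of [transition_cell], and
    skips the oversized cell [n.-1]. *)
Lemma mesh_index (n : nat) : (4 <= n)%N ->
  [/\ ((3 * n).+3 < 4 * n)%N, (4 * n - (3 * n).+2 = n.-2)%N,
    (4 * n - (3 * n).+1 = n.-1)%N &
    forall i, (3 * n < i < 4 * n)%N -> ((4 * n - i.+1).+1 < n)%N].
Proof. by move=> n4; split=> [||| i hi]; lia. Qed.

(** * The properties of the whole mesh that the error analysis uses *)

Section BakhvalovMesh.
Context {R : realType}.

(* [j] is the index of the first node of the layer cells at [1], past the cell
   adjacent to the transition point. The second alternative of [fm_left] holds in
   the cells past the layer at [0]. *)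
Record fine_mesh (Cm p mu0 mu1 : R) (N : nat) (x : nat -> R) (j : nat) : Prop :=
  FineMesh {
  fm_0 : x 0%N = 0;
  fm_N : x N = 1;
  fm_j : (j < N)%N;
  fm_gt : forall i, (i < N)%N -> x i < x i.+1;
  fm_gap : forall i, (i < N)%N -> x i.+1 - x i <= Cm * N%:R^-1;
  fm_left : forall i, (i < N)%N ->
    let e := decay0 (p * mu0) (x i) in let t := mu0 * (x i.+1 - x i) in
    (t ^+ 2 * e <= Cm * N%:R^-1 ^+ 2 /\ t ^+ 3 * e ^+ 2 <= Cm * N%:R^-1 ^+ 3)
    \/ e <= Cm * N%:R^-1 ^+ 2;
  fm_right : forall i, (j <= i < N)%N ->
    let e := decay1 (p * mu1) (x i.+1) in let t := mu1 * (x i.+1 - x i) in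
    [/\ t * e <= Cm * N%:R^-1, t ^+ 2 * e <= Cm * N%:R^-1 ^+ 2,
       t ^+ 3 * e ^+ 2 <= Cm * N%:R^-1 ^+ 3
      & t ^+ 5 * e ^+ 2 <= Cm * N%:R^-1 ^+ 5];
  fm_coarse : forall i, (i <= j)%N ->
    decay1 (p * mu1) (x i.+1) ^+ 2 <= Cm * N%:R^-1 ^+ 5;
  fm_cell : 1 <= mu1 * (x j.+1 - x j) <= Cm }.

(** Dominates all powers up to the fifth of the two constants of the graded meshes, [8 * (tau / p)]
    for fine cells and 9 near the transition points. *)
Definition mesh_const (tau p : R) : R := (8 * (tau / p)) ^+ 5 + 9 ^+ 5.

Lemma fine_mesh_mono (C p mu0 mu1 : R) N x j : fine_mesh C p mu0 mu1 N x j ->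
  forall i k, (i <= k)%N -> (k <= N)%N -> x i <= x k.
Proof.
move=> fm i; elim=> [|k IH]; first by rewrite leqn0 => /eqP ->.
rewrite leq_eqVlt => /predU1P[->//|]; rewrite ltnS => ik kN.
exact: le_trans (IH ik (ltnW kN)) (ltW (fm_gt fm kN)).
Qed.

Lemma bakhvalov_fine (tau p mu0 mu1 : R) (N : nat) :
  5 / 2 <= tau -> 0 < p < 1 -> (16 <= N)%N -> (4 %| N)%N ->
  N%:R <= mu0 -> N%:R <= mu1 ->
  sigma tau p mu0 <= 1 / 4 -> sigma tau p mu1 <= 1 / 4 ->
  fine_mesh (mesh_const tau p) p mu0 mu1 N (mesh tau p mu0 mu1 N)
    (3 * (N %/ 4)).+1.
Proof.
move=> tau52 p01 N16 dN Nmu0 Nmu1 s0 s1.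
set n := (N %/ 4)%N; have Nn : N = (4 * n)%N by rewrite mulnC divnK.
have n4 : (4 <= n)%N by rewrite -(leq_pmul2l (isT : (0 < 4)%N)) -Nn.
have NR : N%:R = 4 * n%:R :> R by rewrite Nn natrM.
have n4R : 4 <= n%:R :> R by rewrite ler_nat.
have n0 : 0 < n%:R :> R by lra.
have N0 : 0 < N%:R :> R by rewrite NR mulr_gt0.
have iN0 : 0 < N%:R^-1 :> R by rewrite invr_gt0.
have /andP[p0 p1] := p01.
set cm := 8 * (tau / p).
have cm9 : 9 <= cm.
  have : 5 / 2 <= tau / p by rewrite ler_pdivlMr//; nra.
  by rewrite /cm; lra.
have cm1 : 1 <= cm by lra.
set Cm := mesh_const tau p.
have cmX k : (k <= 5)%N -> cm ^+ k <= Cm.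
  move=> k5; rewrite /Cm /mesh_const -/cm (@le_trans _ _ (cm ^+ 5))//.
    by rewrite ler_weXn2l.
  by rewrite lerDl exprn_ge0.
have nX k : (k <= 5)%N -> 9 ^+ k <= Cm.
  move=> k5; rewrite /Cm /mesh_const -/cm (@le_trans _ _ (9 ^+ 5))//.
    by rewrite ler_weXn2l//; lra.
  by rewrite lerDr exprn_ge0//; lra.
have cmN k (a : R) : (k <= 5)%N -> a <= (cm / N%:R) ^+ k -> a <= Cm * N%:R^-1 ^+ k.
  by move=> k5 h; apply: (le_trans h); rewrite exprMn ler_wpM2r ?exprn_ge0 ?(ltW iN0)// cmX.
have cN k (a : R) : (k <= 5)%N -> a <= (9 / N%:R) ^+ k -> a <= Cm * N%:R^-1 ^+ k.
  by move=> k5 h; apply: (le_trans h); rewrite exprMn ler_wpM2r ?exprn_ge0 ?(ltW iN0)// nX.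
pose X0 := lpt tau p mu0 n; pose X1 := lpt tau p mu1 n.
have muN0 (mu : R) : N%:R <= mu -> 0 < mu by exact: lt_le_trans.
set x := mesh tau p mu0 mu1 N.
have xl i : (i <= n)%N -> x i = X0 i.
  move=> ile; rewrite /x /mesh ile /phi0 /X0 /lpt /lden; congr (_ * - ln _).
  by rewrite NR; field; rewrite !lt0r_neq0// muN0.
(* At [i = n] the definition of the mesh takes the logarithmic branch; both branches give [sigma]
   there. The claim [xr] settles [i = 3 * n] in the same way. *)
have xm i : (n <= i <= 3 * n)%N -> x i = sigma tau p mu0 +
    2 * (i%:R / N%:R - 1 / 4) * (1 - sigma tau p mu0 - sigma tau p mu1).
  move=> /andP[ni i3]; rewrite /x /mesh; case: ifPn => [ile|_]; last by rewrite i3.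
  have -> : i = n by apply/eqP; rewrite eqn_leq ile.
  have := xl n (leqnn n); rewrite /x /mesh leqnn => ->.
  rewrite /X0 (@lptn R tau p mu0 n N tau52 p01 n4 Nn Nmu0).
  have -> : n%:R / N%:R = 1 / 4 :> R by rewrite NR; field; rewrite lt0r_neq0.
  by rewrite subrr mulr0 mul0r addr0.
have xr i : (3 * n <= i <= N)%N -> x i = 1 - X1 (N - i)%N.
  move=> /andP[i3 iN]; rewrite /x /mesh.
  have ni : (i <= n)%N = false.
    by apply/negbTE; rewrite -ltnNge (leq_trans _ i3)// -[ltnLHS]mul1n ltn_pmul2r// (leq_trans _ n4).
  rewrite ni; case: ifPn => [ile|_].
    have -> : i = (3 * n)%N by apply/eqP; rewrite eqn_leq ile.
    have -> : (N - 3 * n = n)%N by rewrite Nn -mulnBl mul1n.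
    rewrite /X1 (@lptn R tau p mu1 n N tau52 p01 n4 Nn Nmu1).
    have -> : (3 * n)%:R / N%:R = 3 / 4 :> R by rewrite NR natrM; field; rewrite lt0r_neq0.
    by field.
  congr (_ - _); rewrite /phi1 /X1 /lpt /lden; congr (_ * - ln (_ - _)).
  by rewrite natrB// NR; field; rewrite !lt0r_neq0// muN0.
have n_pos : (0 < n)%N by rewrite (leq_trans _ n4).
have step_m i : (n <= i < 3 * n)%N ->
  x i.+1 - x i = 2 * N%:R^-1 * (1 - sigma tau p mu0 - sigma tau p mu1).
  move=> /andP[ni i3]; rewrite !xm; last 2 first.
  - by rewrite ni ltnW.
  - by rewrite (leq_trans ni)//= i3.
  by rewrite -natr1; field; rewrite lt0r_neq0.
have sg (mu : R) : N%:R <= mu -> 0 <= sigma tau p mu.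
  move=> h; have mu1' : 1 <= mu by rewrite (le_trans _ h)// NR; lra.
  rewrite /sigma mulr_ge0 ?ln_ge0// divr_ge0//; first lra.
  by rewrite mulr_ge0//; lra.
have sg0 := sg _ Nmu0; have sg1 := sg _ Nmu1.
have Ni i : (3 * n <= i < N)%N -> (N - i = (N - i.+1).+1)%N /\ ((N - i.+1).+1 <= n)%N.
  move=> /andP[i3 iN]; rewrite -subSn// subSS; split => //.
  by rewrite leq_subLR (leq_trans _ (leq_add i3 (leqnn n)))// -mulSnr Nn.
have step_r i : (3 * n <= i < N)%N ->
    x i.+1 - x i = X1 (N - i.+1).+1 - X1 (N - i.+1)%N.
  move=> h; have [e1 e2] := Ni i h; have /andP[i3 iN] := h.
  rewrite !xr ?e1; [ring| |]; first by rewrite i3 ltnW.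
  by rewrite iN andbT (leq_trans i3).
have d0E i : (i <= n)%N -> decay0 (p * mu0) (x i) = lexpo tau p mu0 n i.
  by move=> ile; rewrite xl// /decay0 /eaff /lexpo addr0 mulNr.
have d1E i : (3 * n <= i < N)%N -> decay1 (p * mu1) (x i.+1) = lexpo tau p mu1 n (N - i.+1).
  move=> h; have /andP[i3 iN] := h.
  rewrite xr; last by rewrite iN andbT (leq_trans i3).
  by rewrite /decay1 /eaff /lexpo /X1; congr expR; ring.
have gt i : (i < N)%N -> x i < x i.+1.
  move=> iN; have [h|h] := ltnP i n.
    by rewrite !xl// ?(ltnW h)//; exact: (@lpt_lt R tau p mu0 n N tau52 p01 n4 Nn Nmu0).
  have [h'|h'] := ltnP i (3 * n)%N.
    by rewrite -subr_gt0 step_m ?h//; nra.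
  rewrite -subr_gt0 step_r ?h'// subr_gt0; have [_ h2] := Ni i (introT andP (conj h' iN)).
  exact: (@lpt_lt R tau p mu1 n N tau52 p01 n4 Nn Nmu1).
have mono i k : (i <= k)%N -> (k <= N)%N -> x i <= x k.
  elim: k => [|k IH]; first by rewrite leqn0 => /eqP ->.
  rewrite leq_eqVlt => /predU1P[->//|]; rewrite ltnS => ik kN.
  exact: le_trans (IH ik (ltnW kN)) (ltW (gt _ kN)).
have x0 : x 0%N = 0.
  by rewrite xl// /X0 (@lpt0 R tau p mu0 n N tau52 p01 n4 Nn Nmu0).
have x1 : x N = 1.
  rewrite xr ?subnn /X1 ?(@lpt0 R tau p mu1 n N tau52 p01 n4 Nn Nmu1) ?subr0//.
  by rewrite leqnn andbT Nn leq_mul2r orbT.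
have [jN jn2 jn1 idx] := mesh_index n4; rewrite -Nn in jN jn2 jn1 idx.
have lnden : 4 * (tau / p) / N%:R <= Cm * N%:R^-1.
  rewrite ler_wpM2r ?(ltW iN0)// (le_trans _ (cmX 1%N isT))// expr1 /cm.
  by have := cm9; rewrite /cm; lra.
split=> //.
- by rewrite (leq_trans _ jN)// leqW.
- move=> i iN; have [h|h] := ltnP i n.
    rewrite !xl// ?(ltnW h)//; apply: le_trans lnden.
    exact: (@lpt_gap R tau p mu0 n N tau52 p01 n4 Nn Nmu0).
  have [h'|h'] := ltnP i (3 * n)%N.
    rewrite step_m ?h//.
    apply: (@le_trans _ _ (2 * N%:R^-1)); first by rewrite ler_piMr//; nra.
    by rewrite ler_wpM2r ?(ltW iN0)//; have := nX 1%N isT; rewrite expr1; lra.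
  rewrite step_r ?h'//; have [_ h2] := Ni i (introT andP (conj h' iN)).
  apply: le_trans lnden.
  exact: (@lpt_gap R tau p mu1 n N tau52 p01 n4 Nn Nmu1).
- move=> i iN; have [h|h] /= := ltnP i.+1 n.
    left; rewrite d0E ?(ltnW (ltnW h))// !xl// ?(ltnW h) ?(ltnW (ltnW h))//.
    have [_ h1 h2 _] := @fine_cell R tau p mu0 n N tau52 p01 n4 Nn Nmu0 i h.
    by split; apply: cmN.
  (* From the last cell of the left layer onwards, the layer function is at most its value at node
     [n.-1], which is already of order [N^-2]. *)
  right; have [g1 _] := @lexpo_coarse R tau p mu0 n N tau52 p01 n4 Nn Nmu0.
  apply: cN => //; apply: le_trans g1.
  have ni : (n.-1 <= i)%N by rewrite -ltnS prednK.
  rewrite -d0E; last exact: leq_pred.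
  rewrite /decay0 /eaff ler_expR !addr0 !mulNr lerN2 ler_wpM2l//.
    by rewrite mulr_ge0//; [exact: ltW|exact/ltW/muN0].
  by apply: mono => //; exact: ltnW.
- move=> i /andP[ji iN] /=.
  have i3 : (3 * n <= i < N)%N by rewrite iN andbT ltnW.
  have [e1 e2] := Ni i i3.
  rewrite d1E// step_r//.
  have lt : ((N - i.+1).+1 < n)%N.
    by apply: idx; rewrite ji.
  have [h1 h2 h3 h4] := @fine_cell R tau p mu1 n N tau52 p01 n4 Nn Nmu1 _ lt.
  split; [|exact: cmN|exact: cmN|exact: cmN].
  by have := @cmN 1%N _ isT; rewrite !expr1; exact.
- move=> i ij.
  have [_ [_ g1]] := @lexpo_coarse R tau p mu1 n N tau52 p01 n4 Nn Nmu1.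
  apply: cN => //; apply: le_trans g1.
  rewrite -jn2 -d1E; last by rewrite leqnSn/= (leq_trans _ jN)// leqW.
  have h : decay1 (p * mu1) (x i.+1) <= decay1 (p * mu1) (x (3 * n).+2).
    rewrite /decay1 /eaff ler_expR lerD2r ler_wpM2l//.
      by rewrite mulr_ge0//; [exact: ltW|exact/ltW/muN0].
    by apply: mono => //; rewrite (leq_trans _ jN)// leqW.
  by rewrite lerXn2r ?nnegrE//; exact/ltW/decay1_gt0.
- rewrite step_r; last by rewrite leqnSn/= (leq_trans _ jN)// leqW.
  rewrite jn2.
  have /andP[t1 t2] := @transition_cell R tau p mu1 n N tau52 p01 n4 Nn Nmu1.
  by rewrite t1 (le_trans t2)//; have := cmX 1%N isT; rewrite expr1.
Qed.

End BakhvalovMesh.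

(** * Piecewise linear interpolation *)

Section PiecewiseLinear.
Context {R : realType}.
Notation mu := (@lebesgue_measure R).

Variables (N : nat) (x : nat -> R).
Hypotheses (x0 : x 0%N = 0) (xN : x N = 1)
  (xlt : forall i, (i < N)%N -> x i < x i.+1).

Let xmono i k : (i <= k)%N -> (k <= N)%N -> x i <= x k.
Proof.
elim: k => [|k IH]; first by rewrite leqn0 => /eqP ->.
rewrite leq_eqVlt => /predU1P[->//|]; rewrite ltnS => ik kN.
exact: le_trans (IH ik (ltnW kN)) (ltW (xlt kN)).
Qed.

Lemma node_bar i : (i <= N)%N -> Omega_bar (x i).
Proof.
by move=> iN; apply/Omega_barP; rewrite -x0 -xN !xmono.
Qed.

Lemma node_cell y : 0 <= y < 1 -> exists2 i, (i < N)%N & x i <= y < x i.+1.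
Proof.
move=> /andP[y0 y1].
suff H k : (k <= N)%N -> y < x k -> exists2 i, (i < N)%N & x i <= y < x i.+1.
  by apply: (H N (leqnn N)); rewrite xN.
elim: k => [|k IH] kN; first by rewrite x0 ltNge y0.
have [yk _|ky yk] := ltP y (x k); first exact: IH (ltnW kN) yk.
by exists k => //; rewrite ky.
Qed.

(** Written with clipped arguments instead of cases so that its weak derivative follows from
    [weak_trunc] and linearity; the brackets in [dpl] are the indicators of the half-open cells. *)
Definition pl (a : nat -> R) (y : R) : R := a 0%N + \sum_(i < N)
  (a i.+1 - a i) / (x i.+1 - x i) * (Num.min y (x i.+1) - Num.min y (x i)).

Definition dpl (a : nat -> R) (y : R) : R := \sum_(i < N)
  (a i.+1 - a i) / (x i.+1 - x i) * ((y < x i.+1)%R%:R - (y < x i)%R%:R).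

Lemma weak_pl a : is_weak_derivative (pl a) (dpl a).
Proof.
have wid : is_weak_derivative (fun y : R => y) (fun=> 1).
  have h1 : {within Omega_bar, continuous (fun y : R => y)}.
    by apply: within_T => y; exact: cvg_id.
  have h2 : {within Omega_bar, continuous (cst 1 : R -> R)} by exact: within_cst.
  by apply: (weak_C1 h1 h2) => y _; exact: derX.
have wm i : (i <= N)%N -> is_weak_derivative (fun y : R => Num.min y (x i))
    (fun y : R => (y < x i)%R%:R).
  move=> iN; apply: eq_weak_deriv (weak_trunc (node_bar iN) wid).
  by move=> y _ /=; rewrite mul1r.
suff H m : (m <= N)%N -> is_weak_derivative
    (fun y => a 0%N + \sum_(i < m) (a i.+1 - a i) / (x i.+1 - x i) *
       (Num.min y (x i.+1) - Num.min y (x i)))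
    (fun y : R => \sum_(i < m) (a i.+1 - a i) / (x i.+1 - x i) *
       ((y < x i.+1)%R%:R - (y < x i)%R%:R)) by exact: (H N (leqnn N)).
elim: m => [|k IH] kN.
  have -> : (fun y => a 0%N + \sum_(i < 0) (a i.+1 - a i) / (x i.+1 - x i) *
    (Num.min y (x i.+1) - Num.min y (x i))) = cst (a 0%N).
    by apply/funext => y; rewrite big_ord0 addr0.
  have -> : (fun y : R => \sum_(i < 0) (a i.+1 - a i) / (x i.+1 - x i) *
    ((y < x i.+1)%R%:R - (y < x i)%R%:R)) = cst 0 by apply/funext => y; rewrite big_ord0.
  exact: weak_cst.
have := weakD (IH (ltnW kN)) (weakZ ((a k.+1 - a k) / (x k.+1 - x k))
  (weakB (wm _ kN) (wm _ (ltnW kN)))).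
by congr is_weak_derivative; apply/funext => y /=; rewrite big_ord_recr/= ?addrA.
Qed.

(** Terms of cells to the right of [y] vanish, and those of cells to the left telescope to [a i]. *)
Lemma pl_cell a i y : (i < N)%N -> x i <= y <= x i.+1 ->
  pl a y = a i + (a i.+1 - a i) / (x i.+1 - x i) * (y - x i).
Proof.
move=> iN /andP[xy yx]; rewrite /pl.
have sl k : (k < N)%N -> (a k.+1 - a k) / (x k.+1 - x k) * (x k.+1 - x k) = a k.+1 - a k.
  by move=> kN; rewrite divfK// subr_eq0 gt_eqF// xlt.
suff H m : (i < m)%N -> (m <= N)%N -> a 0%N + \sum_(k < m)
    (a k.+1 - a k) / (x k.+1 - x k) * (Num.min y (x k.+1) - Num.min y (x k)) =
  a i + (a i.+1 - a i) / (x i.+1 - x i) * (y - x i) by exact: (H N iN (leqnn N)).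
elim: m => // m IH; rewrite ltnS leq_eqVlt => /predU1P[<-{IH m} _|im mN]; last first.
  rewrite big_ord_recr/= addrA IH//; last exact: ltnW.
  have h1 : y <= x m by apply: (le_trans yx); apply: xmono => //; exact: ltnW.
  by rewrite !min_l ?subrr ?mulr0 ?addr0// (le_trans h1)// ltW// xlt.
rewrite big_ord_recr/= addrA (min_l yx) (min_r xy); congr (_ + _).
suff H m : (m <= i)%N -> a 0%N + \sum_(k < m)
    (a k.+1 - a k) / (x k.+1 - x k) * (Num.min y (x k.+1) - Num.min y (x k)) = a m.
  exact: H.
elim: m => [|m IH] mi; first by rewrite big_ord0 addr0.
rewrite big_ord_recr/= addrA IH; last exact: ltnW.
have h1 : x m.+1 <= y by apply: le_trans xy; apply: xmono => //; exact: ltnW.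
have mN : (m < N)%N by exact: ltn_trans mi iN.
have h2 : x m <= y by apply: le_trans h1; apply/ltW/xlt.
by rewrite (min_r h1) (min_r h2) sl// addrC subrK.
Qed.

Lemma dpl_cell a i y : (i < N)%N -> x i <= y < x i.+1 ->
  dpl a y = (a i.+1 - a i) / (x i.+1 - x i).
Proof.
move=> iN /andP[xy yx]; rewrite /dpl (bigD1 (Ordinal iN))//= yx ltNge xy subr0 mulr1.
rewrite big1 ?addr0// => -[k kN] /= /eqP ki.
have {}ki : k != i by apply/eqP => E; apply: ki; exact: val_inj.
have [h|h] := ltnP k i.
  have h1 : x k.+1 <= y by apply: le_trans xy; apply: xmono => //; exact: ltnW.
  have h2 : x k <= y by apply: le_trans h1; apply/ltW/xlt.
  by rewrite !ltNge h1 h2 subrr mulr0.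
have {}h : (i < k)%N by rewrite ltn_neqAle eq_sym ki.
have h1 : y < x k by apply: (lt_le_trans yx); apply: xmono => //; exact: ltnW.
have h2 : y < x k.+1 by apply: (lt_trans h1); apply: xlt.
by rewrite h1 h2 subrr mulr0.
Qed.

Lemma N_gt0 : (0 < N)%N.
Proof.
rewrite lt0n; apply/eqP => N0; move: xN; rewrite N0 x0 => /esym/eqP.
by rewrite oner_eq0.
Qed.

Lemma pl_node a i : (i <= N)%N -> pl a (x i) = a i.
Proof.
rewrite leq_eqVlt => /predU1P[->|iN]; last first.
  by rewrite (pl_cell a iN) ?lexx ?(ltW (xlt iN))// subrr mulr0 addr0.
have e : N = N.-1.+1 by rewrite prednK// N_gt0.
have iN : (N.-1 < N)%N by rewrite [ltnRHS]e.
have lt := xlt iN.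
have hy : x N.-1 <= x N.-1.+1 <= x N.-1.+1 by rewrite lexx ltW.
have := pl_cell a iN hy.
rewrite -e in lt *; move=> ->.
by rewrite divfK ?subr_eq0 ?gt_eqF// addrC subrK.
Qed.

Lemma VN_pl a : a 0%N = 0 -> a N = 0 -> VN N x (pl a).
Proof.
move=> a0 aN; split.
- exact: weak_within (weak_pl a).
- by rewrite -[X in pl a X]x0 pl_node.
- by rewrite -[X in pl a X]xN pl_node.
- move=> i iN; exists ((a i.+1 - a i) / (x i.+1 - x i)).
  exists (a i - (a i.+1 - a i) / (x i.+1 - x i) * x i) => y hy.
  by rewrite (pl_cell a iN hy); ring.
Qed.

Lemma VN_is_pl v : VN N x v -> {in Omega_bar, pl (v \o x) =1 v}.
Proof.
move=> [_ v0 v1 vl] y; rewrite inE => /Omega_barP/andP[y0].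
rewrite le_eqVlt => /predU1P[->|y1].
  by rewrite -[X in pl _ X]xN pl_node//= xN v1.
have hy1 : 0 <= y < 1 by rewrite y0.
have [i iN xy] := node_cell hy1.
have /andP[h1 h2] := xy.
have hy : x i <= y <= x i.+1 by rewrite h1 ltW.
have [r [s E]] := vl i iN; have lt := xlt iN.
rewrite (pl_cell _ iN hy) /= (E y hy) (E (x i)) ?lexx ?(ltW lt)//.
rewrite (E (x i.+1)) ?lexx ?(ltW lt)//; field.
by rewrite subr_eq0 gt_eqF.
Qed.

Lemma VN_weak v : VN N x v -> is_weak_derivative v (dpl (v \o x)).
Proof. by move=> /VN_is_pl h; exact: eq_weak h (weak_pl _). Qed.

Lemma VN_H10 v : VN N x v -> H10 v.
Proof.
by move=> hv; have [_ v0 v1 _] := hv; split => //; exists (dpl (v \o x)); exact: VN_weak.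
Qed.

(* The comparison function [K i + phi] on cell [i] integrates explicitly. *)
Lemma ip_cells (g Phi phi : R -> R) (K : nat -> R) :
  L2 g -> is_weak_derivative Phi phi ->
  (forall i y, (i < N)%N -> x i <= y < x i.+1 -> g y ^+ 2 <= K i + phi y) ->
  ip g g <= \sum_(i < N) (x i.+1 - x i) * K i + (Phi 1 - Phi 0).
Proof.
move=> g2 hP H; have [p2 HP] := hP.
(* The interpolant of [a] has slope [K i] on cell [i], so the step function [K] is integrated as a
   weak derivative. *)
pose a k := \sum_(i < k) (x i.+1 - x i) * K i.
have ha := weak_pl a; have [a2 Ha] := ha.
have Sa : \int[mu]_(t in Omega) dpl a t = a N.
  have := Ha 1 Omega_bar1; rewrite -{1}xN pl_node// -[X in pl a X]x0 pl_node//.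
  by rewrite /a big_ord0 add0r => <-.
have SP : \int[mu]_(t in Omega) phi t = Phi 1 - Phi 0.
  by rewrite (HP 1 Omega_bar1) addrC addKr.
rewrite -/(a N) -Sa -SP -RintegralD//; try exact: L2_integrable.
apply: le_Rintegral => //.
- exact: L2_integrableM.
- by have := L2_integrable (L2D a2 p2).
move=> y /OmegaP/andP[y0 y1].
have hy : 0 <= y < 1 by rewrite ltW.
have [i iN xy] := node_cell hy.
rewrite -expr2; apply: (le_trans (H i y iN xy)).
rewrite (dpl_cell a iN xy) /a big_ord_recr/= [X in X - _]addrC addrK mulrAC divff ?mul1r//.
by rewrite subr_eq0 gt_eqF// xlt.
Qed.

End PiecewiseLinear.

(** * Interpolation on one cell under a dominating second derivative *)

Section CellInterpolation.
Context {R : realType}.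
Variables (v v1 v2 W W1 W2 : R -> R).
Hypotheses (cv : {within Omega_bar, continuous v})
  (cv1 : {within Omega_bar, continuous v1})
  (dv : forall x, Omega x -> der v x (v1 x))
  (dv1 : forall x, Omega x -> der v1 x (v2 x))
  (cW : {within Omega_bar, continuous W})
  (cW1 : {within Omega_bar, continuous W1})
  (dW : forall x, Omega x -> der W x (W1 x))
  (dW1 : forall x, Omega x -> der W1 x (W2 x))
  (vW : forall x, Omega x -> `|v2 x| <= W2 x).
Variables (a b : R).
Hypotheses (Oa : Omega_bar a) (Ob : Omega_bar b) (ab : a < b).

Let s := (v b - v a) / (b - a).
Let lin y := v a + s * (y - a).

Let ba0 : 0 < b - a. Proof. by rewrite subr_gt0. Qed.

Let Oy y : a <= y <= b -> Omega_bar y.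
Proof.
move=> /andP[ay yb]; have /Omega_barP/andP[a0 a1] := Oa.
have /Omega_barP/andP[b0 b1] := Ob.
by apply/Omega_barP; rewrite (le_trans a0)//= (le_trans yb).
Qed.

(** [W1 - v1] and [W1 + v1] have nonnegative derivatives, so increments of [v1] are dominated by
    those of [W1], which are explicit for exponentials. *)
Let incr y z : a <= y -> y <= z -> z <= b -> `|v1 z - v1 y| <= W1 z - W1 y.
Proof.
move=> ay; rewrite le_eqVlt => /predU1P[->|yz] zb; first by rewrite !subrr normr0.
have Oy' : Omega_bar y by apply: Oy; rewrite ay (le_trans (ltW yz)).
have Oz' : Omega_bar z by apply: Oy; rewrite zb (le_trans ay (ltW yz)).
have H1 : 0 <= (W1 z - v1 z) - (W1 y - v1 y).
  have [t|t ht ->] := @mvt_Omega_bar R (fun y => W1 y - v1 y) (fun y => W2 y - v2 y) y z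
    (withinB cW1 cv1) _ Oy' Oz' yz.
    by move=> Ot; apply: derB; [exact: dW1|exact: dv1].
  rewrite mulr_ge0//; last by rewrite subr_ge0 ltW.
  have := vW (subOmega Oy' Oz' ht); rewrite ler_norml => /andP[_ ?].
  by rewrite subr_ge0.
have H2 : 0 <= (W1 z + v1 z) - (W1 y + v1 y).
  have [t|t ht ->] := @mvt_Omega_bar R (fun y => W1 y + v1 y) (fun y => W2 y + v2 y) y z
    (withinD cW1 cv1) _ Oy' Oz' yz.
    by move=> Ot; apply: derD; [exact: dW1|exact: dv1].
  rewrite mulr_ge0//; last by rewrite subr_ge0 ltW.
  by have := vW (subOmega Oy' Oz' ht); rewrite ler_norml => /andP[? _]; lra.
by rewrite ler_norml; apply/andP; split; lra.
Qed.

Let W1mono y z : a <= y -> y <= z -> z <= b -> W1 y <= W1 z.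
Proof.
by move=> ay yz zb; have := le_trans (normr_ge0 _) (incr ay yz zb); rewrite subr_ge0.
Qed.

Lemma interp_slope y : a <= y <= b -> `|v1 y - s| <= W1 b - W1 a.
Proof.
move=> /andP[ay yb]; have [t /andP[at_ tb] E] := mvt_Omega_bar cv dv Oa Ob ab.
have -> : s = v1 t by rewrite /s E mulfK// lt0r_neq0.
have at' := ltW at_; have tb' := ltW tb.
have [yt|ty] := leP y t.
  rewrite distrC; apply: (le_trans (incr ay yt tb')).
  by apply: lerB; [exact: W1mono|exact: W1mono].
apply: (le_trans (incr at' (ltW ty) yb)).
by apply: lerB; [exact: W1mono|exact: W1mono].
Qed.

Let derlin y : der lin y s.
Proof.
apply: (der_eq (a := 0 + s * (1 - 0))); last by rewrite add0r subr0 mulr1.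
by apply: derD; [exact: derC|apply: derZ; apply: derB; [exact: derX|exact: derC]].
Qed.

Let clin : {within Omega_bar, continuous lin}.
Proof. exact: derivable_within derlin. Qed.

Lemma interp_error y : a <= y <= b ->
  `|v y - (v a + s * (y - a))| <= (b - a) * (W1 b - W1 a).
Proof.
move=> /andP[]; rewrite le_eqVlt => /predU1P[<- _|ay yb].
  rewrite subrr mulr0 addr0 subrr normr0 mulr_ge0 ?subr_ge0 ?(ltW ab)//.
  exact: W1mono (lexx a) (ltW ab) (lexx b).
have Oy' : Omega_bar y by apply: Oy; rewrite ltW.
have [t|t ht] := @mvt_Omega_bar R (fun y => v y - lin y) (fun y => v1 y - s) a y
    (withinB cv clin) _ Oa Oy' ay.
  by move=> Ot; exact: derB (dv Ot) (derlin t).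
rewrite {2}/lin subrr mulr0 addr0 subrr subr0 => ->.
rewrite normrM mulrC (gtr0_norm (_ : 0 < y - a)) ?subr_gt0//.
have /andP[h1 h2] := ht.
apply: ler_pM => //; [by rewrite subr_ge0 ltW|by rewrite lerD2r|].
by apply: interp_slope; rewrite ltW//= (le_trans (ltW h2)).
Qed.

Let sW := (W b - W a) / (b - a).

(** A negative value at [y] would make the slope negative somewhere before [y] and positive
    somewhere after it, against [D2 <= 0]. *)
Let concave_ge0 (D D1 D2 : R -> R) : {within Omega_bar, continuous D} ->
  {within Omega_bar, continuous D1} ->
  (forall x, Omega x -> der D x (D1 x)) -> (forall x, Omega x -> der D1 x (D2 x)) ->
  (forall x, Omega x -> D2 x <= 0) -> D a = 0 -> D b = 0 ->
  forall y, a <= y <= b -> 0 <= D y.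
Proof.
move=> cD cD1 dD dD1 D20 Da Db y hy; have Oy' := Oy hy; move: hy => /andP[].
rewrite le_eqVlt => /predU1P[<- _|ay]; first by rewrite Da.
rewrite le_eqVlt => /predU1P[->|yb]; first by rewrite Db.
rewrite leNgt; apply/negP => Dy.
have [t1 ht1 E1] := mvt_Omega_bar cD dD Oa Oy' ay.
have [t2 ht2 E2] := mvt_Omega_bar cD dD Oy' Ob yb.
have /andP[h1 h2] := ht1; have /andP[h3 h4] := ht2.
have t12 : t1 < t2 by exact: lt_trans h3.
have [t ht E] := mvt_Omega_bar cD1 dD1 (Omega_sub (subOmega Oa Oy' ht1))
  (Omega_sub (subOmega Oy' Ob ht2)) t12.
have Ot : Omega t.
  exact: subOmega (Omega_sub (subOmega Oa Oy' ht1)) (Omega_sub (subOmega Oy' Ob ht2)) ht.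
have s1 : D1 t1 < 0.
  by rewrite -(pmulr_llt0 _ (_ : 0 < y - a)) ?subr_gt0// -E1 Da subr0.
have s2 : 0 < D1 t2.
  by rewrite -(pmulr_lgt0 _ (_ : 0 < b - y)) ?subr_gt0// -E2 Db sub0r oppr_gt0.
have : D2 t * (t2 - t1) <= 0 by rewrite mulr_le0_ge0 ?D20// subr_ge0 ltW.
by rewrite -E; lra.
Qed.

(** The interpolation error of [W], plus or minus that of [v], is concave and vanishes at both ends.
    On coarse cells this beats [interp_error]: it costs only values of [W], not the cell length
    times an increment of [W1]. *)
Lemma interp_error_convex y : a <= y <= b ->
  `|v y - (v a + s * (y - a))| <= W a + sW * (y - a) - W y.
Proof.
move=> hy.
pose linW y := W a + sW * (y - a).
have derlinW z : der linW z sW.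
  apply: (der_eq (a := 0 + sW * (1 - 0))); last by rewrite add0r subr0 mulr1.
  by apply: derD; [exact: derC|apply: derZ; apply: derB; [exact: derX|exact: derC]].
have clinW : {within Omega_bar, continuous linW} by exact: derivable_within derlinW.
have lb : lin b = v b by rewrite /lin /s divfK ?lt0r_neq0// addrC subrK.
have lWb : linW b = W b by rewrite /linW /sW divfK ?lt0r_neq0// addrC subrK.
have la : lin a = v a by rewrite /lin subrr mulr0 addr0.
have lWa : linW a = W a by rewrite /linW subrr mulr0 addr0.
have H1 : 0 <= (linW y - W y) - (v y - lin y).
  have h1 : {within Omega_bar, continuous (fun y => (linW y - W y) - (v y - lin y))}.
    exact: withinB (withinB clinW cW) (withinB cv clin).
  have h2 : {within Omega_bar, continuous (fun y => (sW - W1 y) - (v1 y - s))}.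
    exact: withinB (withinB (@within_cst R _) cW1) (withinB cv1 (@within_cst R _)).
  have h3 t (Ot : Omega t) : der (fun y => (linW y - W y) - (v y - lin y)) t
      ((sW - W1 t) - (v1 t - s)).
    exact: derB (derB (derlinW t) (dW Ot)) (derB (dv Ot) (derlin t)).
  have h4 t (Ot : Omega t) : der (fun y => (sW - W1 y) - (v1 y - s)) t
      ((0 - W2 t) - (v2 t - 0)).
    exact: derB (derB (derC _ _) (dW1 Ot)) (derB (dv1 Ot) (derC _ _)).
  have h5 t (Ot : Omega t) : (0 - W2 t) - (v2 t - 0) <= 0.
    by have := vW Ot; rewrite ler_norml => /andP[? ?]; lra.
  by apply: (concave_ge0 h1 h2 h3 h4 h5 _ _ hy);
    rewrite ?la ?lWa ?lb ?lWb !subrr ?addr0 ?subr0.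
have H2 : 0 <= (linW y - W y) + (v y - lin y).
  have h1 : {within Omega_bar, continuous (fun y => (linW y - W y) + (v y - lin y))}.
    exact: withinD (withinB clinW cW) (withinB cv clin).
  have h2 : {within Omega_bar, continuous (fun y => (sW - W1 y) + (v1 y - s))}.
    exact: withinD (withinB (@within_cst R _) cW1) (withinB cv1 (@within_cst R _)).
  have h3 t (Ot : Omega t) : der (fun y => (linW y - W y) + (v y - lin y)) t
      ((sW - W1 t) + (v1 t - s)).
    exact: derD (derB (derlinW t) (dW Ot)) (derB (dv Ot) (derlin t)).
  have h4 t (Ot : Omega t) : der (fun y => (sW - W1 y) + (v1 y - s)) t
      ((0 - W2 t) + (v2 t - 0)).
    exact: derD (derB (derC _ _) (dW1 Ot)) (derB (dv1 Ot) (derC _ _)).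
  have h5 t (Ot : Omega t) : (0 - W2 t) + (v2 t - 0) <= 0.
    by have := vW Ot; rewrite ler_norml => /andP[? ?]; lra.
  by apply: (concave_ge0 h1 h2 h3 h4 h5 _ _ hy);
    rewrite ?la ?lWa ?lb ?lWb !subrr ?addr0 ?subr0.
by rewrite ler_norml -/(lin y) -/(linW y); apply/andP; split; lra.
Qed.

End CellInterpolation.

(** * Interpolation error *)

Section InterpolationError.
Context {R : realType}.

(** One minus [exp (- s)] is at most the smaller of 1 and [s]; the first bound serves coarse cells,
    the second fine ones. *)
Lemma decay0_drop (k a b : R) : 0 <= k -> a <= b ->
  [/\ 0 <= decay0 k a - decay0 k b, decay0 k a - decay0 k b <= decay0 k a
    & decay0 k a - decay0 k b <= k * (b - a) * decay0 k a].
Proof.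
move=> k0 ab; have t0 : 0 <= k * (b - a) by rewrite mulr_ge0// subr_ge0.
have -> : decay0 k b = decay0 k a * expR (- (k * (b - a))).
  by rewrite /decay0 /eaff -expRD; congr expR; ring.
have := decay0_gt0 k a; move: (decay0 k a) => e e0.
have h1 := expR_ge1Dx (- (k * (b - a))); have h2 := expR_gt0 (- (k * (b - a))).
have h3 : expR (- (k * (b - a))) <= 1 by rewrite -expR0 ler_expR oppr_le0.
move: (expR _) h1 h2 h3 => r h1 h2 h3.
have h4 : 0 <= e * (1 - r) by rewrite mulr_ge0// ?subr_ge0// ltW.
have h5 : 0 <= e * r by rewrite mulr_ge0// ltW.
have h6 : e * (1 - r) <= e * (k * (b - a)) by rewrite ler_wpM2l ?(ltW e0)//; lra.
by split; lra.
Qed.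

Lemma decay1_drop (k a b : R) : 0 <= k -> a <= b ->
  [/\ 0 <= decay1 k b - decay1 k a, decay1 k b - decay1 k a <= decay1 k b
    & decay1 k b - decay1 k a <= k * (b - a) * decay1 k b].
Proof.
move=> k0 ab; have H (s t : R) : decay1 k (1 - s) = decay0 k s.
  by rewrite /decay0 /decay1 /eaff; congr expR; ring.
have ab' : 1 - b <= 1 - a by lra.
have := decay0_drop k0 ab'; rewrite -!H// !subKr.
by rewrite (_ : 1 - a - (1 - b) = b - a)//; ring.
Qed.

Variables (Cm p mu0 mu1 : R) (N : nat) (x : nat -> R) (j : nat).
Hypotheses (fm : fine_mesh Cm p mu0 mu1 N x j) (Cm1 : 1 <= Cm) (p01 : 0 < p < 1)
  (mu00 : 0 < mu0) (mu10 : 0 < mu1).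

Let nu : R := N%:R^-1.
Let P := p^-1.
Let Q := Cm ^+ 2 * P ^+ 2.
Let x0 := fm_0 fm.
Let xN := fm_N fm.
Let xlt := fm_gt fm.
Let p0 : 0 < p. Proof. by have /andP[] := p01. Qed.
Let P1 : 1 <= P. Proof. by rewrite /P invr_ge1 ?unitfE ?lt0r_neq0//; have /andP[_ /ltW] := p01. Qed.
Let pP : p * P = 1. Proof. by rewrite /P divff// lt0r_neq0. Qed.
Let N0 : (0 < N)%N. Proof. exact: N_gt0 x0 xN. Qed.
Let nu0 : 0 < nu. Proof. by rewrite invr_gt0 ltr0n. Qed.
Let nuN : nu * N%:R = 1. Proof. by rewrite /nu mulVf// pnatr_eq0 -lt0n. Qed.
Let nu1 : nu <= 1.
Proof. by rewrite /nu invf_le1 ?ltr0n// ler1n. Qed.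
Let Cm0 : 0 < Cm. Proof. exact: lt_le_trans Cm1. Qed.
Let P0 : 0 < P. Proof. exact: lt_le_trans P1. Qed.
Let CQ : Cm <= Q.
Proof.
have h1 : Cm * 1 <= Cm * Cm by rewrite ler_wpM2l// ltW.
have h2 : Cm ^+ 2 * 1 <= Cm ^+ 2 * P ^+ 2 by rewrite ler_wpM2l ?sqr_ge0// exprn_ege1.
by rewrite /Q; lra.
Qed.
Let C2Q : Cm ^+ 2 <= Q.
Proof. by rewrite /Q ler_peMr ?sqr_ge0// exprn_ege1. Qed.
Let CPQ : Cm * P <= Q.
Proof.
by rewrite /Q !expr2 mulrACA ler_peMr ?mulr_ge0 ?(ltW Cm0) ?(ltW P0)// -[leLHS]mul1r ler_pM.
Qed.
Let CP2Q : Cm * P ^+ 2 <= Q.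
Proof. by rewrite /Q ler_wpM2r ?sqr_ge0// expr2 ler_peMr// ltW. Qed.
Let Q0 : 0 < Q. Proof. exact: lt_le_trans CQ. Qed.
Let pm0 : 0 <= p * mu0. Proof. by rewrite mulr_ge0// ltW. Qed.
Let pm1 : 0 <= p * mu1. Proof. by rewrite mulr_ge0// ltW. Qed.

Let h i := x i.+1 - x i.
Let h0 i : (i < N)%N -> 0 < h i. Proof. by move=> iN; rewrite subr_gt0 xlt. Qed.
Let bar i : (i <= N)%N -> Omega_bar (x i). Proof. exact: node_bar. Qed.
Let cell_bar i y : (i < N)%N -> x i <= y <= x i.+1 -> Omega_bar y.
Proof.
move=> iN hy; apply: (subOmega_bar (bar (ltnW iN)) (bar iN)).
by rewrite /= in_itv.
Qed.
Let hsq i : (i < N)%N -> h i ^+ 2 <= Cm ^+ 2 * nu ^+ 2.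
Proof.
move=> iN; rewrite -exprMn lerXn2r ?nnegrE ?(ltW (h0 iN)) ?(fm_gap fm)//.
by rewrite mulr_ge0 ?ltW.
Qed.

(* Up to the factor [S], [h i + d1 i + d0 i] is the increment over a cell of the
   dominating function [W1] below. *)
Let d1 i := P * (decay1 (p * mu1) (x i.+1) - decay1 (p * mu1) (x i)).
Let d1_ge0 i : (i < N)%N -> 0 <= d1 i.
Proof.
move=> iN; have [h1 _ _] := decay1_drop pm1 (ltW (xlt iN)).
by rewrite mulr_ge0// ltW.
Qed.
(** No [mu1] appears: the term [mu1 * e_1] in the bound of the second derivative integrates to a
    drop of [e_1], which is of order [1 / N] on every cell. Before [j] this holds because [e_1]
    itself is that small. *)
Let d1_le i : (i < N)%N -> d1 i <= Cm * P * nu.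
Proof.
move=> iN; have [h1 h2 h3] := decay1_drop pm1 (ltW (xlt iN)).
have [ji|ij] := leqP j i.
  have /(fm_right fm)[g1 _ _ _] : (j <= i < N)%N by rewrite ji.
  have : d1 i <= P * (p * mu1 * h i * decay1 (p * mu1) (x i.+1)) by rewrite ler_wpM2l// ltW.
  rewrite (_ : P * _ = p * P * (mu1 * h i * decay1 (p * mu1) (x i.+1))); last ring.
  rewrite pP mul1r => /le_trans; apply; apply: (le_trans g1); rewrite -/nu.
  by rewrite mulrAC ler_peMr// mulr_ge0 ?ltW.
have g := fm_coarse fm (ltnW ij); rewrite -/nu in g.
have e0 := decay1_gt0 (p * mu1) (x i.+1).
have g' : decay1 (p * mu1) (x i.+1) <= Cm * nu.
  rewrite -ler_sqr ?nnegrE ?(ltW e0)//; last by rewrite mulr_ge0 ?ltW.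
  apply: (le_trans g); rewrite exprMn.
  rewrite ler_pM ?exprn_ge0 ?(ltW nu0) ?(ltW Cm0)//.
    by rewrite expr2 ler_peMr// ltW.
  by rewrite ler_wiXn2l// ltW.
rewrite /d1 mulrAC [Cm * nu * P]mulrC ler_wpM2l ?(ltW P0)//.
exact: le_trans g'.
Qed.

Let d0 i := P * mu0 * (decay0 (p * mu0) (x i) - decay0 (p * mu0) (x i.+1)).
Let d0_ge0 i : (i < N)%N -> 0 <= d0 i.
Proof.
move=> iN; have [h1 _ _] := decay0_drop pm0 (ltW (xlt iN)).
by rewrite !mulr_ge0// ltW.
Qed.
Let d0_le i : (i < N)%N ->
  d0 i <= P * mu0 * decay0 (p * mu0) (x i) /\
  d0 i <= mu0 * (mu0 * h i) * decay0 (p * mu0) (x i).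
Proof.
move=> iN; have [h1 h2 h3] := decay0_drop pm0 (ltW (xlt iN)).
have m : 0 <= P * mu0 by rewrite mulr_ge0// ltW.
split; first by rewrite ler_wpM2l.
apply: (le_trans (ler_wpM2l m h3)); rewrite -/(h i).
rewrite (_ : P * mu0 * _ = p * P * (mu0 * (mu0 * h i) * decay0 (p * mu0) (x i))); last ring.
by rewrite pP mul1r.
Qed.

(** Separates the part [k] of the cell bound that does not scale with the cell length, counted once
    per cell, from the parts [A] and [phi] that are integrated. *)
Let ip_cells_le (k A : R) (g Phi phi : R -> R) :
  L2 g -> is_weak_derivative Phi phi ->
  (forall i y, (i < N)%N -> x i <= y < x i.+1 ->
     h i * g y ^+ 2 <= k + h i * (A + phi y)) ->
  ip g g <= k * N%:R + A + (Phi 1 - Phi 0).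
Proof.
move=> g2 hP H.
have H' i y : (i < N)%N -> x i <= y < x i.+1 -> g y ^+ 2 <= (k / h i + A) + phi y.
  move=> iN hy; have g0 := h0 iN; rewrite -(ler_pM2l g0).
  apply: (le_trans (H i y iN hy)); rewrite -addrA [leRHS]mulrDr.
  by rewrite mulrCA divff ?mulr1// lt0r_neq0.
apply: (le_trans (ip_cells x0 xN xlt g2 hP H')); rewrite lerD2r.
have -> : \sum_(i < N) (x i.+1 - x i) * (k / h i + A) =
    \sum_(i < N) (k + (x i.+1 - x i) * A).
  apply: eq_bigr => -[i iN] _ /=; rewrite mulrDr mulrCA divff ?mulr1//.
  by rewrite lt0r_neq0// h0.
rewrite big_split/= sumr_const card_ord -mulr_suml.
have -> : \sum_(i < N) (x i.+1 - x i) = 1.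
  by rewrite -(big_mkord xpredT (fun i => x i.+1 - x i)) telescope_sumr// xN x0 subr0.
by rewrite mul1r mulr_natr.
Qed.

(** * Interpolation of the smooth part *)

Section Smooth.
Variables (S : R) (w w1 w2 : R -> R).
Hypotheses (S0 : 0 <= S) (cw : {within Omega_bar, continuous w})
  (cw1 : {within Omega_bar, continuous w1})
  (dw : forall y, Omega y -> der w y (w1 y))
  (dw1 : forall y, Omega y -> der w1 y (w2 y))
  (w2S : forall y, Omega y -> `|w2 y| <=
     S * (1 + mu0 ^+ 2 * decay0 (p * mu0) y + mu1 * decay1 (p * mu1) y)).

(** [WA2 + WB2] is the assumed bound of the second derivative. The left layer [WB] is kept apart
    because on coarse cells it needs the convexity argument, while [WA] is always handled through
    increments. *)
Let WA y := S * (y * y / 2 + P ^+ 2 / mu1 * decay1 (p * mu1) y).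
Let WA1 y := S * (y + P * decay1 (p * mu1) y).
Let WA2 y := S * (1 + mu1 * decay1 (p * mu1) y).
Let WB y := S * (P ^+ 2 * decay0 (p * mu0) y).
Let WB1 y := S * (- (P * mu0) * decay0 (p * mu0) y).
Let WB2 y := S * (mu0 ^+ 2 * decay0 (p * mu0) y).
Let dWA y : der WA y (WA1 y).
Proof.
apply: (der_eq (derZ _ (derD (derM (derM (derX _) (derX _)) (derC _ _)) (derZ _ (der_eaff _ _ _))))).
by rewrite /WA1 /decay1 /P; field; rewrite !lt0r_neq0.
Qed.
Let dWA1 y : der WA1 y (WA2 y).
Proof.
apply: (der_eq (derZ _ (derD (derX _) (derZ _ (der_eaff _ _ _))))).
by rewrite /WA2 /decay1 /P; field; rewrite !lt0r_neq0.
Qed.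
Let dWB y : der WB y (WB1 y).
Proof.
apply: (der_eq (derZ _ (derZ _ (der_eaff _ _ _)))).
by rewrite /WB1 /decay0 /P; field; rewrite !lt0r_neq0.
Qed.
Let dWB1 y : der WB1 y (WB2 y).
Proof.
apply: (der_eq (derZ _ (derZ _ (der_eaff _ _ _)))).
by rewrite /WB2 /decay0 /P; field; rewrite !lt0r_neq0.
Qed.
Let W y := WA y + WB y.
Let W1 y := WA1 y + WB1 y.
Let W2 y := WA2 y + WB2 y.
Let dW y : der W y (W1 y). Proof. exact: derD. Qed.
Let dW1 y : der W1 y (W2 y). Proof. exact: derD. Qed.
Let cWA := derivable_within dWA.
Let cWA1 := derivable_within dWA1.
Let cW := derivable_within dW.
Let cW1 := derivable_within dW1.
Let wW y : Omega y -> `|w2 y| <= W2 y.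
Proof.
by move=> Oy; apply: (le_trans (w2S Oy)); rewrite /W2 /WA2 /WB2 -mulrDr ler_wpM2l//; lra.
Qed.
Let WA2P y : Omega y -> `|WA2 y| <= WA2 y.
Proof.
move=> Oy; rewrite ger0_norm// mulr_ge0// addr_ge0// mulr_ge0 ?(ltW mu10)//.
exact/ltW/decay1_gt0.
Qed.
Let incA i : WA1 (x i.+1) - WA1 (x i) = S * (h i + d1 i).
Proof. by rewrite /WA1 /d1 /h; ring. Qed.
Let inc i : W1 (x i.+1) - W1 (x i) = S * (h i + d1 i + d0 i).
Proof. by rewrite /W1 /WA1 /WB1 /d1 /d0 /h; ring. Qed.

Let hhd1 i : (i < N)%N -> h i * (h i + d1 i) <= 2 * (Q * nu ^+ 2).
Proof.
move=> iN; rewrite mulrDr -expr2.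
have a1 : h i ^+ 2 <= Q * nu ^+ 2.
  by apply: (le_trans (hsq iN)); rewrite ler_wpM2r ?sqr_ge0.
have a2 : h i * d1 i <= Q * nu ^+ 2.
  apply: (@le_trans _ _ ((Cm * nu) * (Cm * P * nu))).
    apply: ler_pM; [exact/ltW/h0|exact: d1_ge0|exact: (fm_gap fm)|exact: d1_le].
  rewrite (_ : _ * _ = Cm * (Cm * P) * nu ^+ 2); last ring.
  rewrite ler_wpM2r ?sqr_ge0// /Q mulrA -expr2 ler_wpM2l ?sqr_ge0//.
  by rewrite expr2 ler_peMr// ltW.
by lra.
Qed.

(** Where the left layer is resolved, all increments are of the right order. Elsewhere the
    interpolation error of the convex [WB] is at most its value at the left node, which is of order
    [N^-2]. *)
Lemma smooth_interp_sup i y : (i < N)%N -> x i <= y <= x i.+1 ->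
  `|w y - pl N x (w \o x) y| <= 3 * S * Q * nu ^+ 2.
Proof.
move=> iN hy; rewrite (pl_cell xlt _ iN hy) /=.
have Oa := bar (ltnW iN); have Ob := bar iN; have lt := xlt iN.
have hd := hhd1 iN; have h0i := ltW (h0 iN).
have [[g1 _]|g] := fm_left fm iN.
  have H := interp_error cw cw1 dw dw1 cW1 (fun y _ => dW1 y) wW Oa Ob lt hy.
  apply: (le_trans H); rewrite inc -/(h i).
  have [_ k] := d0_le iN.
  have : h i * d0 i <= Cm * nu ^+ 2.
    apply: le_trans g1; apply: (le_trans (ler_wpM2l h0i k)).
    by rewrite le_eqVlt; apply/orP; left; apply/eqP; rewrite -/(h i); ring.
  have : Cm * nu ^+ 2 <= Q * nu ^+ 2 by rewrite ler_wpM2r ?sqr_ge0.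
  move=> k1 k2; rewrite (_ : h i * (S * _) = S * (h i * (h i + d1 i) + h i * d0 i)); last ring.
  rewrite (_ : 3 * S * Q * nu ^+ 2 = S * (3 * (Q * nu ^+ 2))); last ring.
  by rewrite ler_wpM2l//; lra.
have H := interp_error_convex cw cw1 dw dw1 cW cW1 (fun y _ => dW y) (fun y _ => dW1 y) wW Oa Ob lt hy.
apply: (le_trans H).
have HA := interp_error cWA cWA1 (fun y _ => dWA y) (fun y _ => dWA1 y)
  cWA1 (fun y _ => dWA1 y) WA2P Oa Ob lt hy.
rewrite ler_norml incA -/(h i) in HA; have /andP[HA' _] := HA.
have E : W (x i) + (W (x i.+1) - W (x i)) / (x i.+1 - x i) * (y - x i) - W y =
  - (WA y - (WA (x i) + (WA (x i.+1) - WA (x i)) / (x i.+1 - x i) * (y - x i)))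
  + (WB (x i) - (WB (x i) - WB (x i.+1)) / (x i.+1 - x i) * (y - x i) - WB y).
  by rewrite /W; ring.
rewrite E.
have /andP[hy1 hy2] := hy.
have B1 : 0 <= (WB (x i) - WB (x i.+1)) / (x i.+1 - x i) * (y - x i).
  rewrite mulr_ge0 ?subr_ge0// divr_ge0 ?subr_ge0 ?(ltW lt)//.
  rewrite /WB ler_wpM2l// ler_wpM2l ?sqr_ge0//.
  by have [k _ _] := decay0_drop pm0 (ltW lt); lra.
have B2 : 0 <= WB y by rewrite /WB; nonneg.
have B3 : WB (x i) <= S * (Q * nu ^+ 2).
  rewrite ler_wpM2l//; apply: (@le_trans _ _ (P ^+ 2 * (Cm * nu ^+ 2))).
    by rewrite ler_wpM2l ?sqr_ge0.
  by rewrite mulrA [P ^+ 2 * _]mulrC ler_wpM2r ?sqr_ge0.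
have B4 : S * (h i * (h i + d1 i)) <= S * (2 * (Q * nu ^+ 2)) by rewrite ler_wpM2l.
by lra.
Qed.

(** The squared increment of the left layer contributes [mu0 * nu ^+ 3] per resolved cell, from the
    third power in [fm_left]; on the other cells its value is of order [mu0 * nu ^+ 2], hence the
    term scaling with [h i]. *)
Lemma smooth_interp_slope i y : (i < N)%N -> x i <= y < x i.+1 ->
  h i * (w1 y - dpl N x (w \o x) y) ^+ 2 <=
  3 * S ^+ 2 * Q * mu0 * nu ^+ 3 +
  h i * (3 * S ^+ 2 * Q * (2 * nu ^+ 2 + mu0 ^+ 2 * nu ^+ 4)).
Proof.
move=> iN hy; rewrite (dpl_cell xlt _ iN hy) /=.
have Oa := bar (ltnW iN); have Ob := bar iN; have lt := xlt iN.
have hy' : x i <= y <= x i.+1 by have /andP[-> /ltW ->] := hy.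
have H := interp_slope cw cw1 dw dw1 cW1 (fun y _ => dW1 y) wW Oa Ob lt hy'.
rewrite inc in H.
have g0 := h0 iN; have h0i := ltW g0; have a0 := d0_ge0 iN; have a1 := d1_ge0 iN.
have H2 : (w1 y - (w (x i.+1) - w (x i)) / (x i.+1 - x i)) ^+ 2 <=
    (S * (h i + d1 i + d0 i)) ^+ 2.
  by rewrite -real_normK ?num_real// lerXn2r ?nnegrE// (mulr_ge0 S0)//
      (addr_ge0 (addr_ge0 h0i a1)).
apply: (le_trans (ler_wpM2l h0i H2)).
have H3 : (h i + d1 i + d0 i) ^+ 2 <= 3 * (h i ^+ 2 + d1 i ^+ 2 + d0 i ^+ 2).
  have := sqr_ge0 (h i - d1 i); have := sqr_ge0 (h i - d0 i).
  have := sqr_ge0 (d1 i - d0 i); move: (h i) (d1 i) (d0 i) => a b c *; lra.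
have S2 : 0 <= S ^+ 2 by exact: sqr_ge0.
rewrite exprMn mulrCA; apply: (le_trans (ler_wpM2l S2 (ler_wpM2l h0i H3))).
have b1 : h i ^+ 2 <= Q * nu ^+ 2.
  by apply: (le_trans (hsq iN)); rewrite ler_wpM2r ?sqr_ge0.
have b2 : d1 i ^+ 2 <= Q * nu ^+ 2.
  rewrite /Q -!exprMn lerXn2r ?nnegrE ?d1_le//.
  by rewrite !mulr_ge0 ?ltW.
have b3 : h i * d0 i ^+ 2 <= Q * mu0 * nu ^+ 3 + h i * (Q * (mu0 ^+ 2 * nu ^+ 4)).
  have [k1 k2] := d0_le iN; have [[_ g]|g] := fm_left fm iN; rewrite -/nu -/(h i) in g.
    apply: (@le_trans _ _ (Q * mu0 * nu ^+ 3)); last first.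
      by rewrite lerDl; nonneg.
    apply: (@le_trans _ _ (h i * (mu0 * (mu0 * h i) * decay0 (p * mu0) (x i)) ^+ 2)).
      by rewrite ler_wpM2l// lerXn2r ?nnegrE//; nonneg.
    rewrite (_ : h i * _ = mu0 * ((mu0 * h i) ^+ 3 * decay0 (p * mu0) (x i) ^+ 2)); last ring.
    rewrite (_ : Q * mu0 * nu ^+ 3 = mu0 * (Q * nu ^+ 3)); last ring.
    rewrite ler_wpM2l ?(ltW mu00)//; apply: (le_trans g).
    by rewrite ler_wpM2r ?exprn_ge0 ?(ltW nu0).
  apply: (@le_trans _ _ (h i * (Q * (mu0 ^+ 2 * nu ^+ 4)))); last first.
    by rewrite lerDr; nonneg.
  rewrite ler_wpM2l//.
  apply: (@le_trans _ _ ((P * mu0 * (Cm * nu ^+ 2)) ^+ 2)); last first.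
    by rewrite /Q le_eqVlt; apply/orP; left; apply/eqP; ring.
  have m : 0 <= P * mu0 by rewrite mulr_ge0// ltW.
  rewrite lerXn2r ?nnegrE//; first by nonneg.
  by apply: (le_trans k1); rewrite ler_wpM2l.
have b4 : h i * (h i ^+ 2 + d1 i ^+ 2) <= h i * (2 * (Q * nu ^+ 2)).
  by rewrite ler_wpM2l//; lra.
have b5 : S ^+ 2 * (3 * (h i * (h i ^+ 2 + d1 i ^+ 2) + h i * d0 i ^+ 2)) <=
  S ^+ 2 * (3 * (h i * (2 * (Q * nu ^+ 2)) +
     (Q * mu0 * nu ^+ 3 + h i * (Q * (mu0 ^+ 2 * nu ^+ 4))))).
  by rewrite ler_wpM2l// ler_pM2l//; lra.
apply: (le_trans _ (le_trans b5 _)); rewrite le_eqVlt; apply/orP; left; apply/eqP; ring.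
Qed.

Lemma smooth_interp_L2 :
  ip (w \- pl N x (w \o x)) (w \- pl N x (w \o x)) <= (3 * S * Q * nu ^+ 2) ^+ 2.
Proof.
apply: ip_le_cst.
  exact: L2B (L2_within cw) (weak_L2 (weak_pl x0 xN xlt (w \o x))).
move=> y /OmegaP/andP[y0 y1].
have hy : 0 <= y < 1 by rewrite ltW.
have [i iN /andP[h1 h2]] := node_cell x0 xN hy.
by apply: (smooth_interp_sup iN); rewrite h1 ltW.
Qed.

Lemma smooth_interp_H1 :
  ip (w1 \- dpl N x (w \o x)) (w1 \- dpl N x (w \o x)) <=
  3 * S ^+ 2 * Q * (mu0 * nu ^+ 2 + 2 * nu ^+ 2 + mu0 ^+ 2 * nu ^+ 4).
Proof.
have [d2 _] := weak_pl x0 xN xlt (w \o x).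
have g2 := L2B (L2_within cw1) d2.
apply: (le_trans (ip_cells_le g2 (weak_cst 0) (k := 3 * S ^+ 2 * Q * mu0 * nu ^+ 3)
  (A := 3 * S ^+ 2 * Q * (2 * nu ^+ 2 + mu0 ^+ 2 * nu ^+ 4)) _)).
  by move=> i y iN hy; rewrite /= addr0; exact: smooth_interp_slope.
rewrite subrr addr0 (_ : 3 * S ^+ 2 * Q * mu0 * nu ^+ 3 * N%:R =
  3 * S ^+ 2 * Q * mu0 * nu ^+ 2 * (nu * N%:R)); last ring.
by rewrite nuN mulr1; lra.
Qed.

End Smooth.

(** * Interpolation of the layer part, cut off before node [j] *)

Section Layer.
Variables (B : R) (E E1 E2 : R -> R).
Hypotheses (B0 : 0 <= B) (cE : {within Omega_bar, continuous E})
  (cE1 : {within Omega_bar, continuous E1})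
  (dE : forall y, Omega y -> der E y (E1 y))
  (dE1 : forall y, Omega y -> der E1 y (E2 y))
  (EB : forall y, Omega_bar y -> `|E y| <= B * decay1 (p * mu1) y)
  (E1B : forall y, Omega_bar y -> `|E1 y| <= B * (mu1 * decay1 (p * mu1) y))
  (E2B : forall y, Omega y -> `|E2 y| <= B * (mu1 ^+ 2 * decay1 (p * mu1) y)).

(** Zero up to and including node [j], so the interpolant vanishes on the oversized cell at the
    transition point and rises to [E] on cell [j], whose length is of order [1 / mu1]. *)
Definition layer_nodes (i : nat) : R := if (i <= j)%N then 0 else E (x i).

Let W y := B * (P ^+ 2 * decay1 (p * mu1) y).
Let W1 y := B * (P * mu1 * decay1 (p * mu1) y).
Let W2 y := B * (mu1 ^+ 2 * decay1 (p * mu1) y).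
Let dW1 y : der W1 y (W2 y).
Proof.
apply: (der_eq (derZ _ (derZ _ (der_eaff _ _ _)))).
by rewrite /W2 /decay1 /P; field; rewrite !lt0r_neq0.
Qed.
Let cW1 := derivable_within dW1.
Let trunc y : R := decay1 (2 * p * mu1) y * (y < x j)%R%:R.

Let sqr_le (a d : R) : `|a| <= d -> a ^+ 2 <= d ^+ 2.
Proof.
move=> ad; rewrite -[a ^+ 2]real_normK ?num_real// lerXn2r ?nnegrE//.
exact: le_trans ad.
Qed.

Let xmono := fine_mesh_mono fm.

Let decay1_sqr (k y : R) : decay1 k y ^+ 2 = decay1 (2 * k) y.
Proof. by rewrite /decay1 /eaff -expRM_natl; congr expR; ring. Qed.

Let last_cell i y : (i < N)%N -> i = j -> x i <= y < x i.+1 ->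
  h i * (decay1 (p * mu1) (x i.+1)) ^+ 2 <= Cm ^+ 2 * nu ^+ 5 / mu1.
Proof.
move=> iN ij hy; have /andP[_ g] := fm_cell fm; rewrite -ij in g.
have ij' : (i <= j)%N by rewrite ij.
rewrite ler_pdivlMr// mulrAC [h i * _]mulrC [Cm ^+ 2]expr2 -[leRHS]mulrA.
apply: ler_pM => //; [by rewrite mulr_ge0 ?ltW// h0|exact: sqr_ge0|].
exact: (fm_coarse fm ij').
Qed.

Lemma layer_interp_sup i y : (i < N)%N -> x i <= y < x i.+1 ->
  h i * (E y - pl N x layer_nodes y) ^+ 2 <=
  4 * B ^+ 2 * Cm ^+ 2 * nu ^+ 5 / mu1 + h i * (0 + B ^+ 2 * trunc y).
Proof.
move=> iN hy; have /andP[hy1 hy2] := hy.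
have hy' : x i <= y <= x i.+1 by rewrite hy1 ltW.
have Oa := bar (ltnW iN); have Ob := bar iN; have lt := xlt iN.
have Oy := cell_bar iN hy'.
have g0 := h0 iN; have h0i := ltW g0.
have im : 0 < mu1^-1 by rewrite invr_gt0.
have t0 : 0 <= trunc y by apply: mulr_ge0; [exact/ltW/decay1_gt0|exact: ler0n].
have s0 : 0 <= h i * (0 + B ^+ 2 * trunc y) by rewrite add0r; nonneg.
have e0 := decay1_gt0 (p * mu1) y; have e1 := decay1_gt0 (p * mu1) (x i.+1).
have ey : decay1 (p * mu1) y <= decay1 (p * mu1) (x i.+1).
  by have [k _ _] := decay1_drop pm1 (ltW hy2); rewrite -subr_ge0.
rewrite (pl_cell xlt _ iN hy') /layer_nodes.
(* Before [j] the error is [E] itself, integrated as the truncated exponential; after [j] the cell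
   is fine; on cell [j] the interpolant joins 0 to [E], so the error is bounded by two values of the
   layer function. *)
case: (ltngtP i j) => ij.
- rewrite subrr mul0r mul0r addr0 subr0 add0r.
  apply: (@le_trans _ _ (h i * (B ^+ 2 * trunc y))); last by rewrite lerDr; nonneg.
  rewrite ler_wpM2l// /trunc (lt_le_trans hy2) ?mulr1; last first.
    by apply: xmono => //; exact: ltnW (fm_j fm).
  by rewrite -mulrA -decay1_sqr -exprMn; apply: sqr_le; exact: EB.
- have ji : (j <= i < N)%N by rewrite (ltnW ij).
  have H := interp_error cE cE1 dE dE1 cW1 (fun y _ => dW1 y) E2B Oa Ob lt hy'.
  have [_ _ _ g] := fm_right fm ji; rewrite -/nu -/(h i) in g.
  have [_ _ k] := decay1_drop pm1 (ltW lt).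
  apply: (@le_trans _ _ (4 * B ^+ 2 * Cm ^+ 2 * nu ^+ 5 / mu1)); last by rewrite lerDl.
  have H' : `|E y - (E (x i) + (E (x i.+1) - E (x i)) / (x i.+1 - x i) * (y - x i))| <=
     B * (mu1 ^+ 2 * h i ^+ 2 * decay1 (p * mu1) (x i.+1)).
    apply: (le_trans H); rewrite /W1 -/(h i).
    have m : 0 <= h i * B * P * mu1 by nonneg.
    have := ler_wpM2l m k; rewrite -/(h i) => /(le_trans _) K; apply: le_trans (K _ _) _.
    - by rewrite le_eqVlt; apply/orP; left; apply/eqP; ring.
    - rewrite (_ : h i * B * _ * _ * _ = p * P * (B * (mu1 ^+ 2 * h i ^+ 2 * decay1 (p * mu1) (x i.+1)))); last ring.
      by rewrite pP mul1r.
  apply: (le_trans (ler_wpM2l h0i (sqr_le H'))).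
  rewrite ler_pdivlMr//.
  rewrite (_ : h i * _ * mu1 = B ^+ 2 * ((mu1 * h i) ^+ 5 * decay1 (p * mu1) (x i.+1) ^+ 2)); last ring.
  apply: (@le_trans _ _ (B ^+ 2 * (Cm * nu ^+ 5))); first by rewrite ler_wpM2l ?sqr_ge0.
  have : B ^+ 2 * (Cm * nu ^+ 5) <= B ^+ 2 * (Cm ^+ 2 * nu ^+ 5).
    rewrite ler_wpM2l ?sqr_ge0// ler_wpM2r ?exprn_ge0 ?(ltW nu0)//.
    by rewrite expr2 ler_peMr// ltW.
  have : 0 <= B ^+ 2 * (Cm ^+ 2 * nu ^+ 5) by nonneg.
  by lra.
- rewrite subr0 add0r.
  apply: (@le_trans _ _ (4 * B ^+ 2 * Cm ^+ 2 * nu ^+ 5 / mu1)); last by rewrite lerDl.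
  have H' : `|E y - E (x i.+1) / (x i.+1 - x i) * (y - x i)| <=
      2 * B * decay1 (p * mu1) (x i.+1).
    apply: (le_trans (ler_normB _ _)).
    have k1 : `|E y| <= B * decay1 (p * mu1) (x i.+1).
      by apply: (le_trans (EB Oy)); rewrite ler_wpM2l.
    have k2 : `|E (x i.+1) / (x i.+1 - x i) * (y - x i)| <= B * decay1 (p * mu1) (x i.+1).
      rewrite -mulrA normrM; apply: (le_trans _ (EB Ob)); rewrite ler_piMr//.
      rewrite ger0_norm; last by rewrite mulr_ge0 ?invr_ge0 ?subr_ge0// ltW.
      by rewrite mulrC ler_pdivrMr// mul1r lerD2r ltW.
    by lra.
  apply: (le_trans (ler_wpM2l h0i (sqr_le H'))).
  have := last_cell iN ij hy; have B2 : 0 <= 4 * B ^+ 2 by nonneg.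
  by move=> /(ler_wpM2l B2); lra.
Qed.

(** The same three cases. On cell [j] the slope of the interpolant is a nodal value divided by the
    cell length, harmless because [mu1 * h] is at least 1: this is the purpose of the lower bound in
    [fm_cell]. *)
Lemma layer_interp_slope i y : (i < N)%N -> x i <= y < x i.+1 ->
  h i * (E1 y - dpl N x layer_nodes y) ^+ 2 <=
  4 * B ^+ 2 * Cm ^+ 2 * mu1 * nu ^+ 3 + h i * (0 + B ^+ 2 * mu1 ^+ 2 * trunc y).
Proof.
move=> iN hy; have /andP[hy1 hy2] := hy.
have hy' : x i <= y <= x i.+1 by rewrite hy1 ltW.
have Oa := bar (ltnW iN); have Ob := bar iN; have lt := xlt iN.
have Oy := cell_bar iN hy'.
have g0 := h0 iN; have h0i := ltW g0.
have t0 : 0 <= trunc y by apply: mulr_ge0; [exact/ltW/decay1_gt0|exact: ler0n].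
have s0 : 0 <= h i * (0 + B ^+ 2 * mu1 ^+ 2 * trunc y) by rewrite add0r; nonneg.
have e0 := decay1_gt0 (p * mu1) y; have e1 := decay1_gt0 (p * mu1) (x i.+1).
have ey : decay1 (p * mu1) y <= decay1 (p * mu1) (x i.+1).
  by have [k _ _] := decay1_drop pm1 (ltW hy2); rewrite -subr_ge0.
rewrite (dpl_cell xlt _ iN hy) /layer_nodes.
case: (ltngtP i j) => ij.
- rewrite subrr mul0r subr0 add0r.
  apply: (@le_trans _ _ (h i * (B ^+ 2 * mu1 ^+ 2 * trunc y))); last by rewrite lerDr; nonneg.
  rewrite ler_wpM2l// /trunc (lt_le_trans hy2) ?mulr1; last first.
    by apply: xmono => //; exact: ltnW (fm_j fm).
  by rewrite -[2 * p * mu1]mulrA -decay1_sqr -!exprMn -mulrA; apply: sqr_le; exact: E1B.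
- have ji : (j <= i < N)%N by rewrite (ltnW ij).
  have H := interp_slope cE cE1 dE dE1 cW1 (fun y _ => dW1 y) E2B Oa Ob lt hy'.
  have [_ _ g _] := fm_right fm ji; rewrite -/nu -/(h i) in g.
  have [_ _ k] := decay1_drop pm1 (ltW lt).
  apply: (@le_trans _ _ (4 * B ^+ 2 * Cm ^+ 2 * mu1 * nu ^+ 3)); last by rewrite lerDl.
  have H' : `|E1 y - (E (x i.+1) - E (x i)) / (x i.+1 - x i)| <=
     B * (mu1 ^+ 2 * h i * decay1 (p * mu1) (x i.+1)).
    apply: (le_trans H); rewrite /W1.
    have m : 0 <= B * P * mu1 by nonneg.
    have := ler_wpM2l m k; rewrite -/(h i) => /(le_trans _) K; apply: le_trans (K _ _) _.
    - by rewrite le_eqVlt; apply/orP; left; apply/eqP; ring.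
    - rewrite (_ : B * P * _ * _ = p * P * (B * (mu1 ^+ 2 * h i * decay1 (p * mu1) (x i.+1)))); last ring.
      by rewrite pP mul1r.
  apply: (le_trans (ler_wpM2l h0i (sqr_le H'))).
  rewrite (_ : h i * _ ^+ 2 = B ^+ 2 * mu1 * ((mu1 * h i) ^+ 3 * decay1 (p * mu1) (x i.+1) ^+ 2)); last ring.
  have m : 0 <= B ^+ 2 * mu1 by nonneg.
  apply: (@le_trans _ _ (B ^+ 2 * mu1 * (Cm * nu ^+ 3))); first by rewrite ler_wpM2l.
  have : B ^+ 2 * mu1 * (Cm * nu ^+ 3) <= B ^+ 2 * mu1 * (Cm ^+ 2 * nu ^+ 3).
    rewrite ler_wpM2l// ler_wpM2r ?exprn_ge0 ?(ltW nu0)//.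
    by rewrite expr2 ler_peMr// ltW.
  have : 0 <= B ^+ 2 * mu1 * (Cm ^+ 2 * nu ^+ 3) by nonneg.
  by lra.
- rewrite subr0.
  apply: (@le_trans _ _ (4 * B ^+ 2 * Cm ^+ 2 * mu1 * nu ^+ 3)); last by rewrite lerDl.
  have H' : `|E1 y - E (x i.+1) / (x i.+1 - x i)| <=
      2 * B * mu1 * decay1 (p * mu1) (x i.+1).
    apply: (le_trans (ler_normB _ _)).
    have k1 : `|E1 y| <= B * (mu1 * decay1 (p * mu1) (x i.+1)).
      by apply: (le_trans (E1B Oy)); rewrite ler_wpM2l// ler_wpM2l// ltW.
    have k2 : `|E (x i.+1) / (x i.+1 - x i)| <= B * (mu1 * decay1 (p * mu1) (x i.+1)).
      rewrite normrM (gtr0_norm (_ : 0 < (x i.+1 - x i)^-1)) ?invr_gt0//.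
      rewrite mulrA mulrAC; apply: ler_pM; [exact: normr_ge0|by rewrite invr_ge0|exact: EB|].
      have /andP[k _] := fm_cell fm; rewrite -ij in k.
      by rewrite -[leLHS]mul1r ler_pdivrMr.
    by lra.
  apply: (le_trans (ler_wpM2l h0i (sqr_le H'))).
  have := last_cell iN ij hy; have B2 : 0 <= 4 * B ^+ 2 * mu1 ^+ 2 by nonneg.
  move=> /(ler_wpM2l B2).
  rewrite (_ : 4 * B ^+ 2 * mu1 ^+ 2 * (Cm ^+ 2 * nu ^+ 5 / mu1) =
    4 * B ^+ 2 * Cm ^+ 2 * mu1 * nu ^+ 5); last by field; rewrite lt0r_neq0.
  have : 4 * B ^+ 2 * Cm ^+ 2 * mu1 * nu ^+ 5 <= 4 * B ^+ 2 * Cm ^+ 2 * mu1 * nu ^+ 3.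
    by rewrite ler_wpM2l ?ler_wiXn2l// ?(ltW nu0)//; nonneg.
  by lra.
Qed.

Let weak_trunc_decay (r : R) :
  is_weak_derivative
    (fun y : R => r * ((2 * p * mu1)^-1 * decay1 (2 * p * mu1) (Num.min y (x j))))
    (fun y => r * trunc y).
Proof.
have k0 : 2 * p * mu1 != 0 by rewrite lt0r_neq0// mulr_gt0// mulr_gt0.
pose g y := (2 * p * mu1)^-1 * decay1 (2 * p * mu1) y.
have dg y : der g y (decay1 (2 * p * mu1) y).
  by apply: (der_eq (derZ _ (der_eaff _ _ _))); rewrite mulrA mulVf// mul1r.
have cg := derivable_within dg.
have wg : is_weak_derivative g (decay1 (2 * p * mu1)).
  have c1 : {within Omega_bar, continuous (decay1 (2 * p * mu1))} by exact: within_eaff.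
  by apply: (weak_C1 cg c1) => y _; exact: dg.
exact: weakZ (weak_trunc (bar (ltnW (fm_j fm))) wg).
Qed.

(** The integral of the squared layer function up to [x j] is at most its value there divided by
    [2 * p * mu1], and that value is of order [N^-5]. *)
Let trunc_total (r : R) : 0 <= r ->
  r * ((2 * p * mu1)^-1 * decay1 (2 * p * mu1) (Num.min 1 (x j))) -
  r * ((2 * p * mu1)^-1 * decay1 (2 * p * mu1) (Num.min 0 (x j))) <=
  r * (Cm * P) * nu ^+ 5 / mu1.
Proof.
move=> r0; have jN := fm_j fm; have /Omega_barP/andP[xj0 xj1] := bar (ltnW jN).
have k0 : 0 <= (2 * p * mu1)^-1 by rewrite invr_ge0 mulr_ge0 ?ltW// mulr_gt0.
rewrite (min_r xj1) (min_l xj0) -mulrBr -mulrBr.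
have e0 := decay1_gt0 (2 * p * mu1) 0.
have g := fm_coarse fm (leqnn j); rewrite decay1_sqr -/nu in g.
have k1 : 0 <= 2 * (p * mu1) by rewrite mulr_ge0.
have [l _ _] := decay1_drop k1 (ltW (xlt jN)).
have m : decay1 (2 * p * mu1) (x j) - decay1 (2 * p * mu1) 0 <= Cm * nu ^+ 5.
  by rewrite -mulrA; rewrite -mulrA in e0; lra.
apply: (@le_trans _ _ (r * ((2 * p * mu1)^-1 * (Cm * nu ^+ 5)))).
  by rewrite ler_wpM2l// ler_wpM2l.
rewrite (_ : r * (_^-1 * _) = (r * (Cm * P) * nu ^+ 5 / mu1) / 2); last first.
  by rewrite /P; field; rewrite !lt0r_neq0.
have : 0 <= r * (Cm * P) * nu ^+ 5 / mu1.
  by have im : 0 <= mu1^-1 by [rewrite invr_ge0 ltW|]; nonneg.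
by lra.
Qed.

Let layer_L2 : L2 (E \- pl N x layer_nodes).
Proof. exact: L2B (L2_within cE) (weak_L2 (weak_pl x0 xN xlt layer_nodes)). Qed.

Let layer_nu : nu ^+ 5 <= nu ^+ 4 /\ nu ^+ 5 <= nu ^+ 2.
Proof. by rewrite !ler_wiXn2l// ltW. Qed.

(** Each of the [N] cells may contribute [nu ^+ 5 / mu1], so the fifth power leaves [nu ^+ 4]. The
    division by [mu1] offsets the factor [e2 ^+ 2 / e1] that the integrated convection term will
    bring. *)
Lemma layer_interp_L2 :
  ip (E \- pl N x layer_nodes) (E \- pl N x layer_nodes) <= 5 * B ^+ 2 * Q * nu ^+ 4 / mu1.
Proof.
have B2 : 0 <= B ^+ 2 by exact: sqr_ge0.
apply: (le_trans (ip_cells_le layer_L2 (weak_trunc_decay (B ^+ 2))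
  (k := 4 * B ^+ 2 * Cm ^+ 2 * nu ^+ 5 / mu1) (A := 0) _)).
  by move=> i y iN hy; exact: layer_interp_sup.
have := trunc_total B2.
rewrite (_ : _ / mu1 * N%:R = 4 * B ^+ 2 * Cm ^+ 2 * (nu * N%:R) * nu ^+ 4 / mu1); last ring.
rewrite nuN mulr1 addr0 => T; apply: (le_trans (lerD (lexx _) T)).
rewrite -mulrDl ler_wpM2r ?invr_ge0 ?(ltW mu10)//.
have [n54 _] := layer_nu.
have a1 : 4 * B ^+ 2 * Cm ^+ 2 * nu ^+ 4 <= 4 * B ^+ 2 * Q * nu ^+ 4.
  by rewrite ler_wpM2r ?exprn_ge0 ?(ltW nu0)// ler_wpM2l// mulr_ge0.
have a2 : B ^+ 2 * (Cm * P) * nu ^+ 5 <= B ^+ 2 * Q * nu ^+ 4.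
  apply: ler_pM => //; [by nonneg|by nonneg|by rewrite ler_wpM2l].
by lra.
Qed.

Lemma layer_interp_H1 :
  ip (E1 \- dpl N x layer_nodes) (E1 \- dpl N x layer_nodes) <=
  5 * B ^+ 2 * Q * mu1 * nu ^+ 2.
Proof.
have B2 : 0 <= B ^+ 2 * mu1 ^+ 2 by nonneg.
have [d2 _] := weak_pl x0 xN xlt layer_nodes.
have g2 := L2B (L2_within cE1) d2.
apply: (le_trans (ip_cells_le g2 (weak_trunc_decay (B ^+ 2 * mu1 ^+ 2))
  (k := 4 * B ^+ 2 * Cm ^+ 2 * mu1 * nu ^+ 3) (A := 0) _)).
  by move=> i y iN hy; exact: layer_interp_slope.
have := trunc_total B2.
rewrite (_ : 4 * B ^+ 2 * Cm ^+ 2 * mu1 * nu ^+ 3 * N%:R =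
  4 * B ^+ 2 * Cm ^+ 2 * mu1 * (nu * N%:R) * nu ^+ 2); last ring.
rewrite (_ : B ^+ 2 * mu1 ^+ 2 * (Cm * P) * nu ^+ 5 / mu1 =
  B ^+ 2 * mu1 * (Cm * P) * nu ^+ 5); last by field; rewrite lt0r_neq0.
rewrite nuN mulr1 addr0 => T; apply: (le_trans (lerD (lexx _) T)).
have [_ n52] := layer_nu.
have a1 : 4 * B ^+ 2 * mu1 * nu ^+ 2 * Cm ^+ 2 <= 4 * B ^+ 2 * mu1 * nu ^+ 2 * Q.
  by rewrite ler_wpM2l//; nonneg.
have a2 : B ^+ 2 * mu1 * (Cm * P) * nu ^+ 5 <= B ^+ 2 * mu1 * Q * nu ^+ 2.
  by apply: ler_pM => //; [nonneg|nonneg|rewrite ler_wpM2l//; nonneg].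
by lra.
Qed.

End Layer.

End InterpolationError.

(** * Energy argument *)

Section EnergyArgument.
Context {R : realType}.
Implicit Types a f g u v : R -> R.

Lemma ip_mul_le (a g : R -> R) (M : R) : (forall x, Omega x -> `|a x| <= M) ->
  L2 g -> L2 (a \* g) -> ip (a \* g) (a \* g) <= M ^+ 2 * ip g g.
Proof.
move=> aM g2 ag2; have Mg := L2Z M g2.
rewrite expr2 -mulrA -ipZr// -ipZl//; apply: ip_le => // x Ox /=.
by rewrite !normrM ler_wpM2r// (le_trans (aM x Ox))// ler_norm.
Qed.

Lemma ip_add3_le f g v : L2 f -> L2 g -> L2 v ->
  ip (f \+ g \+ v) (f \+ g \+ v) <= 3 * (ip f f + ip g g + ip v v).
Proof.
move=> f2 g2 v2; have fg := L2D f2 g2.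
rewrite (ipDl fg v2 (L2D fg v2)) (ipDr fg v2 fg) (ipDr fg v2 v2).
rewrite (ipDl f2 g2 fg) (ipDl f2 g2 v2) (ipDr f2 g2 f2) (ipDr f2 g2 g2) (ipDr f2 g2 v2).
rewrite (ipC g f) (ipC v f) (ipC v g).
have one : 0 < (1 : R) by [].
have := ip_young one f2 g2; have := ip_young one f2 v2; have := ip_young one g2 v2.
have := ler_norm (ip f g); have := ler_norm (ip f v); have := ler_norm (ip g v).
by rewrite invr1; lra.
Qed.

Lemma ip_young_half f g (t : R) : 0 < t -> L2 f -> L2 g ->
  `|ip f g| <= t * ip f f / 2 + t^-1 * ip g g / 2.
Proof. by move=> t0 f2 g2; have := ip_young t0 f2 g2; lra. Qed.

Lemma ip_mul_young (t M : R) a f g : 0 < t -> (forall x, Omega x -> `|a x| <= M) ->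
  L2 f -> L2 g -> L2 (a \* f) ->
  `|ip (a \* f) g| <= t * M ^+ 2 * ip f f / 2 + t^-1 * ip g g / 2.
Proof.
move=> t0 aM f2 g2 af2; apply: (le_trans (ip_young_half t0 af2 g2)).
by rewrite lerD2r ler_pM2r// -mulrA ler_pM2l// ip_mul_le.
Qed.

Variables (e1 e2 gamma M : R) (b b1 c : R -> R).
Hypotheses (e10 : 0 < e1) (e20 : 0 < e2) (gamma0 : 0 < gamma)
  (cb : {within Omega_bar, continuous b}) (cc : {within Omega_bar, continuous c})
  (cb1 : {within Omega_bar, continuous b1})
  (db : forall x, Omega x -> der b x (b1 x))
  (gc : forall x, Omega x -> gamma <= c x - 1 / 2 * e2 * b1 x)
  (bM : forall x, Omega x -> `|b x| <= M) (b1M : forall x, Omega x -> `|b1 x| <= M)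
  (cM : forall x, Omega x -> `|c x| <= M).

(* The convection term of the layer error [etaE] is integrated by parts, its
   derivative being large. *)
Lemma galerkin_energy (etaw gw etaE gE chi dchi : R -> R) :
  is_weak_derivative etaw gw -> is_weak_derivative etaE gE ->
  is_weak_derivative chi dchi -> chi 0 = 0 -> chi 1 = 0 ->
  e1 * ip (gw \+ gE \+ dchi) dchi + e2 * ip (b \* (gw \+ gE \+ dchi)) chi +
    ip (c \* (etaw \+ etaE \+ chi)) chi = 0 ->
  5 / 8 * (e1 * ip dchi dchi) + gamma / 2 * ip chi chi <=
  2 * (e1 * (ip gw gw + ip gE gE)) +
  2 * M ^+ 2 / gamma * (e2 ^+ 2 * (ip gw gw + ip etaE etaE) + ip etaw etaw + ip etaE etaE) +
  2 * M ^+ 2 * (e2 ^+ 2 / e1) * ip etaE etaE.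
Proof.
move=> hw hE hchi chi0 chi1 orth.
have [gw2 _] := hw; have [gE2 _] := hE; have [dc2 _] := hchi.
have w2 := weak_L2 hw; have E2 := weak_L2 hE; have c2 := weak_L2 hchi.
have bgw := L2_withinM cb gw2; have bgE := L2_withinM cb gE2; have bdc := L2_withinM cb dc2.
have cw := L2_withinM cc w2; have cE := L2_withinM cc E2; have cch := L2_withinM cc c2.
have bE := L2_withinM cb E2; have b1E := L2_withinM cb1 E2.
have bch := L2_withinM cb c2; have b1ch := L2_withinM cb1 c2.
have coer := bilin_coercive e1 cb cc cb1 db gc hchi chi0 chi1.
rewrite (bilinE e1 e2 cb cc hchi hchi) in coer.
have X1 : ip (b \* (gw \+ gE \+ dchi)) chi =
    ip (b \* gw) chi + ip (b \* gE) chi + ip (b \* dchi) chi.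
  rewrite -ipDl// -ipDl//; last exact: L2D.
  by apply: eq_ip => // y _ /=; ring.
have X2 : ip (c \* (etaw \+ etaE \+ chi)) chi =
    ip (c \* etaw) chi + ip (c \* etaE) chi + ip (c \* chi) chi.
  rewrite -ipDl// -ipDl//; last exact: L2D.
  by apply: eq_ip => // y _ /=; ring.
have X3 : ip (gw \+ gE \+ dchi) dchi = ip gw dchi + ip gE dchi + ip dchi dchi.
  by rewrite ipDl//; [rewrite ipDl|exact: L2D].
have X4 : ip (b \* gE) chi = - ip (b1 \* etaE) chi - ip (b \* etaE) dchi.
  have := ip_by_parts hE (weakM (weak_C1 cb cb1 db) hchi).
  rewrite /= chi0 chi1 !mulr0 subrr ipDr//.
  have -> : ip gE (b \* chi) = ip (b \* gE) chi by apply: eq_Rintegral => y _ /=; ring.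
  have -> : ip etaE (b1 \* chi) = ip (b1 \* etaE) chi by apply: eq_Rintegral => y _ /=; ring.
  have -> : ip etaE (b \* dchi) = ip (b \* etaE) dchi by apply: eq_Rintegral => y _ /=; ring.
  by lra.
rewrite X1 X2 X3 X4 in orth.
have four : 0 < (4 : R) by [].

have scaled (e r h : R) : 0 < e -> `|r| <= h -> - (e * r) <= e * h /\ e * r <= e * h.
  move=> e_gt0 rh; rewrite -mulrN !ler_pM2l// (le_trans (ler_norm _)) ?normrN//.
  by rewrite (le_trans (ler_norm r)).
(* The weights are chosen so that each of the four products with [chi] costs [gamma / 8] of its
   squared norm and each of the three with [dchi] costs [e1 / 8], which leaves [gamma / 2] and
   [5 / 8]. *)
have t1 : 0 < 4 / gamma by rewrite divr_gt0.
have t2 : 0 < 4 * e2 / gamma by rewrite divr_gt0// mulr_gt0.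
have t3 : 0 < 4 * e2 / e1 by rewrite divr_gt0// mulr_gt0.
have [Y1 _] := scaled _ _ _ e10 (ip_young_half four gw2 dc2).
have [Y2 _] := scaled _ _ _ e10 (ip_young_half four gE2 dc2).
have [Y3 _] := scaled _ _ _ e20 (ip_mul_young t2 bM gw2 c2 bgw).
have [_ Y5] := scaled _ _ _ e20 (ip_mul_young t2 b1M E2 c2 b1E).
have [_ Y6] := scaled _ _ _ e20 (ip_mul_young t3 bM E2 dc2 bE).
have [Y4 _] := scaled _ _ _ ltr01 (ip_mul_young t1 cM w2 c2 cw).
have [Y7 _] := scaled _ _ _ ltr01 (ip_mul_young t1 cM E2 c2 cE).
have E3 (r s : R) : e2 * (4 * e2 / gamma * M ^+ 2 * r / 2 + (4 * e2 / gamma)^-1 * s / 2)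
    = 2 * M ^+ 2 / gamma * (e2 ^+ 2 * r) + gamma / 8 * s.
  by field; rewrite !lt0r_neq0.
have E6 (r s : R) : e2 * (4 * e2 / e1 * M ^+ 2 * r / 2 + (4 * e2 / e1)^-1 * s / 2)
    = 2 * M ^+ 2 * (e2 ^+ 2 / e1) * r + e1 * s / 8.
  by field; rewrite !lt0r_neq0.
rewrite E3 in Y3; rewrite E3 in Y5; rewrite E6 in Y6; rewrite !invf_div in Y4 Y7.
clear X1 X2 X3 X4 E3 E6 scaled t1 t2 t3.
move: (ip (b \* gw) chi) (ip (b1 \* etaE) chi) (ip (b \* etaE) dchi)
  (ip (b \* dchi) chi) (ip (c \* etaw) chi) (ip (c \* etaE) chi) (ip (c \* chi) chi)
  (ip gw dchi) (ip gE dchi) (ip dchi dchi) (ip chi chi) (ip gw gw) (ip gE gE)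
  (ip etaw etaw) (ip etaE etaE) orth coer Y1 Y2 Y3 Y4 Y5 Y6 Y7.
move=> ? ? ? ? ? ? ? ? ? ? ? ? ? ? ? *.
by lra.
Qed.

(** Coercivity together with Young's inequality with weight [1 / gamma] on the right-hand side. *)
Lemma bilin_stability (f v dv : R -> R) : L2 f ->
  is_weak_derivative v dv -> v 0 = 0 -> v 1 = 0 ->
  bilin e1 e2 b c v v = ip f v ->
  e1 * ip dv dv + gamma / 2 * ip v v <= (2 * gamma)^-1 * ip f f.
Proof.
move=> f2 hv v0 v1 Ev; have v2 := weak_L2 hv.
have := bilin_coercive e1 cb cc cb1 db gc hv v0 v1; rewrite Ev.
have gi : 0 < gamma^-1 by rewrite invr_gt0.
have := ip_young gi f2 v2; have := ler_norm (ip f v).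
by rewrite invrK invfM; lra.
Qed.

End EnergyArgument.

(** * Energy error of the discrete solution, and plain stability *)

Section FiniteElementError.
Context {R : realType}.
Variables (e1 e2 gamma M : R) (b b1 c f : R -> R).
Hypotheses (e10 : 0 < e1) (e20 : 0 < e2) (gamma0 : 0 < gamma)
  (cb : {within Omega_bar, continuous b}) (cc : {within Omega_bar, continuous c})
  (cb1 : {within Omega_bar, continuous b1})
  (db : forall x, Omega x -> der b x (b1 x))
  (gc : forall x, Omega x -> gamma <= c x - 1 / 2 * e2 * b1 x)
  (bM : forall x, Omega x -> `|b x| <= M) (b1M : forall x, Omega x -> `|b1 x| <= M)
  (cM : forall x, Omega x -> `|c x| <= M).
Variables (N : nat) (x : nat -> R).
Hypotheses (x0 : x 0%N = 0) (xN : x N = 1)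
  (xlt : forall i, (i < N)%N -> x i < x i.+1).
Variables (u du uN : R -> R).
Hypotheses (hu : is_weak_derivative u du) (hbvp : bvp_solution e1 e2 b c f u)
  (hfem : fem_solution e1 e2 b c f N x uN).

Lemma plDB (a a' a'' : nat -> R) y :
  pl N x (fun i => a i + a' i - a'' i) y = pl N x a y + pl N x a' y - pl N x a'' y /\
  dpl N x (fun i => a i + a' i - a'' i) y = dpl N x a y + dpl N x a' y - dpl N x a'' y.
Proof.
rewrite /pl /dpl; split; last first.
  by rewrite -big_split -sumrB/=; apply: eq_bigr => i _; ring.
have -> : forall r r' r'' s s' s'' : R,
  r + s + (r' + s') - (r'' + s'') = (r + r' - r'') + (s + s' - s'').
  by move=> *; ring.
by congr (_ + _); rewrite -big_split -sumrB/=; apply: eq_bigr => i _; ring.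
Qed.

(** When every error quantity is at most [T], the bracket bounds the right-hand side of
    [galerkin_energy]. The factor [6 * (1 + gamma^-1)] recovers the norm of the discrete part, and
    12 is three times the four interpolation terms. *)
Definition energy_const : R :=
  12 + 6 * (1 + gamma^-1) * (4 + 8 * (M ^+ 2 / gamma) + 2 * M ^+ 2).

(* [w] is interpolated at all nodes, [E] only at those in its layer, where
   [aE] does not vanish. *)
Lemma fem_energy_error (w w1 E E1 : R -> R) (aE : nat -> R) (T : R) :
  is_weak_derivative w w1 -> is_weak_derivative E E1 ->
  (forall y, Omega_bar y -> u y = w y + E y) ->
  w 0 = 0 -> aE 0%N = 0 -> aE N = E 1 ->
  let Gw := ip (w1 \- dpl N x (w \o x)) (w1 \- dpl N x (w \o x)) in
  let Hw := ip (w \- pl N x (w \o x)) (w \- pl N x (w \o x)) in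
  let GE := ip (E1 \- dpl N x aE) (E1 \- dpl N x aE) in
  let HE := ip (E \- pl N x aE) (E \- pl N x aE) in
  e1 * Gw <= T -> e2 ^+ 2 * Gw <= T -> Hw <= T ->
  e1 * GE <= T -> HE <= T -> e2 ^+ 2 * HE <= T -> e2 ^+ 2 / e1 * HE <= T ->
  energy_norm e1 (u \- uN) <= Num.sqrt (energy_const * T).
Proof.
move=> hw hE uE w0 aE0 aEN Gw Hw GE HE B1 B2 B3 B4 B5 B6 B7.
have [[_ u0 u1] Hu] := hbvp; have [VuN HuN] := hfem.
have huN := VN_weak x0 xN xlt VuN.
have [_ uN0 uN1 _] := VuN.
(* Nodal values of the discrete part [chi] of the error, so that [u - uN] is [etaw + etaE + chi]. At
   the last node the values of [w] and [E] add up to [u 1 = 0], hence [chi] is a test function. *)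
pose a i := (w \o x) i + aE i - (uN \o x) i.
have a0 : a 0%N = 0 by rewrite /a /= x0 w0 aE0 uN0 subr0 addr0.
have aN : a N = 0.
  by rewrite /a /= xN aEN uN1 subr0; rewrite -uE//; exact: Omega_bar1.
have Vchi := VN_pl x0 xN xlt a0 aN.
have hchi := weak_pl x0 xN xlt a.
have hetaw := weakB hw (weak_pl x0 xN xlt (w \o x)).
have hetaE := weakB hE (weak_pl x0 xN xlt aE).
have [_ chi0 chi1 _] := Vchi.
set chi := pl N x a in Vchi hchi chi0 chi1 *; set dchi := dpl N x a in hchi *.
set etaw := w \- _ in hetaw Hw B3 *; set gw := w1 \- _ in hetaw Gw B1 B2 *.
set etaE := E \- _ in hetaE HE B5 B6 B7 *; set gE := E1 \- _ in hetaE GE B4 *.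
have uE' : {in Omega_bar, u =1 etaw \+ etaE \+ chi \+ uN}.
  move=> y; rewrite inE => Oy /=.
  rewrite uE// /chi (plDB _ _ _ _).1 /etaw /etaE /=.
  have := VN_is_pl x0 xN xlt VuN (mem_set Oy); rewrite /= => ->; ring.
have he : is_weak_derivative (u \- uN) (gw \+ gE \+ dchi).
  by apply: eq_weak (weakD (weakD hetaw hetaE) hchi) => y Oy /=; rewrite uE'//= addrK.
have hu' : is_weak_derivative u (gw \+ gE \+ dchi \+ dpl N x (uN \o x)).
  by apply: eq_weak (weakD he huN) => y _ /=; rewrite subrK.
have orth : e1 * ip (gw \+ gE \+ dchi) dchi + e2 * ip (b \* (gw \+ gE \+ dchi)) chi +
    ip (c \* (etaw \+ etaE \+ chi)) chi = 0.
  have := Hu _ (VN_H10 x0 xN xlt Vchi); rewrite -(HuN _ Vchi).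
  have hs := weakD (weakD hetaw hetaE) hchi.
  have [d2 _] := hs; have [dN2 _] := huN; have [dc2 _] := hchi.
  have s2 := weak_L2 hs; have n2 := weak_L2 huN; have c2 := weak_L2 hchi.
  rewrite (bilinE e1 e2 cb cc hu' hchi) (bilinE e1 e2 cb cc huN hchi).
  have -> : ip (c \* u) chi = ip (c \* (etaw \+ etaE \+ chi)) chi + ip (c \* uN) chi.
    rewrite -ipDl//; [|exact: L2_withinM|exact: L2_withinM].
    apply: eq_ip => // y; rewrite inE => Oy /=.
    by rewrite uE' ?inE//=; [ring|exact: Omega_sub].
  have -> : ip (b \* (gw \+ gE \+ dchi \+ dpl N x (uN \o x))) chi =
      ip (b \* (gw \+ gE \+ dchi)) chi + ip (b \* dpl N x (uN \o x)) chi.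
    rewrite -ipDl//; [|exact: L2_withinM|exact: L2_withinM].
    by apply: eq_ip => // y _ /=; ring.
  by rewrite (ipDl d2 dN2 dc2); lra.
have key := galerkin_energy e10 e20 gamma0 cb cc cb1 db gc bM b1M cM
  hetaw hetaE hchi chi0 chi1 orth.
rewrite (energy_normE e1 he) ler_wsqrtr//.
have [gw2 _] := hetaw; have [gE2 _] := hetaE; have [dc2 _] := hchi.
have w2 := weak_L2 hetaw; have E2 := weak_L2 hetaE; have c2 := weak_L2 hchi.
have K1 := ler_wpM2l (ltW e10) (ip_add3_le gw2 gE2 dc2).
have K2 : ip (u \- uN) (u \- uN) <= 3 * (Hw + HE + ip chi chi).
  rewrite (_ : ip (u \- uN) _ = ip (etaw \+ etaE \+ chi) (etaw \+ etaE \+ chi)).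
    exact: ip_add3_le.
  have Eq : {in Omega, u \- uN =1 etaw \+ etaE \+ chi}.
    move=> y; rewrite inE => Oy /=.
    by rewrite uE' ?inE//= ?addrK//; exact: Omega_sub.
  exact: eq_ip.
have X0 := mulr_ge0 (ltW e10) (ip_ge0 dchi).
have Y0 := mulr_ge0 (ltW gamma0) (ip_ge0 chi).
rewrite -/Gw -/GE -/Hw -/HE in key K1.
set X := e1 * ip dchi dchi in key X0 K1 *; set Y := ip chi chi in key Y0 K2 *.
have T0 : 0 <= T by apply: le_trans B3; exact: ip_ge0.
have m2 : 0 <= 2 * (M ^+ 2 / gamma) by rewrite mulr_ge0// divr_ge0 ?sqr_ge0// ltW.
have m3 : 0 <= 2 * M ^+ 2 by rewrite mulr_ge0// sqr_ge0.
have P1 : 2 * (M ^+ 2 / gamma) * (e2 ^+ 2 * Gw + e2 ^+ 2 * HE + Hw + HE) <=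
  2 * (M ^+ 2 / gamma) * (4 * T) by rewrite ler_wpM2l//; lra.
have P2 := ler_wpM2l m3 B7.
have key' : 5 / 8 * X + gamma / 2 * Y <= (4 + 8 * (M ^+ 2 / gamma) + 2 * M ^+ 2) * T.
  by lra.
set Z := _ * T in key'.
have X1 : X <= 2 * Z by lra.
have Y1 : Y <= 2 * gamma^-1 * Z.
  by rewrite mulrAC ler_pdivlMr//; lra.
have -> : energy_const * T = 12 * T + 6 * (1 + gamma^-1) * Z.
  by rewrite /energy_const /Z; ring.
have EX : e1 * (3 * (Gw + GE + ip dchi dchi)) = 3 * (e1 * Gw + e1 * GE + X).
  by rewrite /X; ring.
rewrite EX in K1; move: (e1 * ip _ _) (ip _ (u \- uN)) K1 K2 => r r' K1 K2.
by lra.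
Qed.

(** Testing each problem with its own solution bounds [u] and [uN] separately by [f], whatever the
    mesh; this serves the regime where [N] is bounded. *)
Lemma fem_stability : L2 f -> energy_norm e1 (u \- uN) <=
  Num.sqrt (4 * (1 + 2 / gamma) * ((2 * gamma)^-1 * ip f f)).
Proof.
move=> f2; have [[_ u0 u1] Hu] := hbvp; have [VuN HuN] := hfem.
have huN := VN_weak x0 xN xlt VuN; have [_ uN0 uN1 _] := VuN.
have Hu10 : H10 u by split => //; exists du.
have S1 := bilin_stability gamma0 cb cc cb1 db gc f2 hu u0 u1 (Hu _ Hu10).
have S2 := bilin_stability gamma0 cb cc cb1 db gc f2 huN uN0 uN1 (HuN _ VuN).
rewrite (energy_normE e1 (weakB hu huN)) ler_wsqrtr//.
have H (g v : R -> R) : L2 g -> L2 v -> ip (g \- v) (g \- v) <= 2 * (ip g g + ip v v).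
  move=> g2 v2; have gv := L2B g2 v2.
  rewrite (ipBl g2 v2 gv) (ipBr g2 v2 g2) (ipBr g2 v2 v2) (ipC v g).
  have one : 0 < (1 : R) by [].
  have := ip_young one g2 v2; have := ler_norm (- ip g v).
  by rewrite normrN invr1; lra.
have [d2 _] := hu; have [dN2 _] := huN.
have K1 := ler_wpM2l (ltW e10) (H _ _ d2 dN2).
have K2 := H _ _ (weak_L2 hu) (weak_L2 huN).
set F := (2 * gamma)^-1 * _ in S1 S2 *.
have main X Y : 0 <= X -> 0 <= Y -> e1 * X + gamma / 2 * Y <= F ->
    e1 * X + Y <= (1 + 2 / gamma) * F.
  move=> X0 Y0 h; have Y1 : Y <= 2 / gamma * F.
    rewrite mulrAC ler_pdivlMr//; have := mulr_ge0 (ltW e10) X0; lra.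
  by have := mulr_ge0 (ltW gamma0) Y0; lra.
have := main _ _ (ip_ge0 _) (ip_ge0 _) S1; have := main _ _ (ip_ge0 _) (ip_ge0 _) S2.
move: K1; rewrite mulrCA mulrDr; lra.
Qed.

End FiniteElementError.

(** * Dependence on the small parameters *)

Section Scales.
Context {R : realType}.
Variables (l M e1 e2 mu0 mu1 : R).
Hypotheses (l01 : 0 < l <= 1) (M1 : 1 <= M) (e101 : 0 < e1 <= 1) (e201 : 0 < e2 <= 1)
  (mu00 : 0 < mu0) (mu11 : 1 <= mu1)
  (hmu0 : e1 * mu0 ^+ 2 + e2 * l * mu0 <= M)
  (hmu1 : e1 * mu1 ^+ 2 <= e2 * M * mu1 + M)
  (hmu1' : e2 * l * mu1 + l <= e1 * mu1 ^+ 2).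

Let D : R := e2 + Num.sqrt e1.
Let L := M / l.

Let l0 : 0 < l. Proof. by have /andP[] := l01. Qed.
Let e10 : 0 < e1. Proof. by have /andP[] := e101. Qed.
Let e20 : 0 < e2. Proof. by have /andP[] := e201. Qed.
Let M0 : 0 < M. Proof. exact: lt_le_trans M1. Qed.
Let mu10 : 0 < mu1. Proof. exact: lt_le_trans mu11. Qed.
Let Ll : L * l = M. Proof. by rewrite /L divfK// lt0r_neq0. Qed.
Let ML : M <= L.
Proof. by have /andP[_ h] := l01; rewrite /L ler_pdivlMr// ler_piMr// ltW. Qed.
Let L0 : 0 < L. Proof. exact: lt_le_trans ML. Qed.
Let r : R := Num.sqrt e1.
Let r2 : r ^+ 2 = e1. Proof. by rewrite sqr_sqrtr// ltW. Qed.
Let r0 : 0 < r. Proof. by rewrite sqrtr_gt0. Qed.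
Let r1 : r <= 1. Proof. by rewrite -sqrtr1 ler_wsqrtr//; have /andP[] := e101. Qed.

Lemma eps2_mu0 : e2 * mu0 <= L.
Proof.
rewrite -(ler_pM2r l0) Ll mulrAC; apply: le_trans hmu0.
by rewrite lerDr mulr_ge0 ?sqr_ge0 ?ltW.
Qed.

(** For [mu0], the symbol bounds [sqrt e1 * mu0] and [e2 * mu0], and one factor [sqrt e1] or [e2] is
    left for [D]. For [mu1], the last bound follows from [e2 * l <= e1 * mu1]. *)
Lemma layer_scales :
  [/\ e1 <= D, e1 * mu0 <= L * D, e1 * mu0 ^+ 2 <= L &
  [/\ e2 ^+ 2 <= D, e2 ^+ 2 * mu0 <= L * D, e2 ^+ 2 * mu0 ^+ 2 <= L ^+ 2,
    e1 * mu1 <= 2 * L * D & e2 ^+ 2 / e1 / mu1 <= L * D]].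
Proof.
have /andP[_ le1] := e201.
have e2D : e2 <= D by rewrite lerDl ltW.
have rD : r <= D by rewrite lerDr ltW.
have h2 := eps2_mu0.
have h1 : e1 * mu0 ^+ 2 <= M.
  by apply: le_trans hmu0; rewrite lerDl !mulr_ge0 ?ltW.
have h3 : r * mu0 <= L.
  rewrite -ler_sqr ?nnegrE; [|nonneg|nonneg].
  rewrite exprMn r2; apply: (le_trans h1).
  apply: (le_trans ML); rewrite expr2 ler_peMr ?(ltW L0)//; exact: le_trans ML.
have D0 : 0 < D by rewrite addr_gt0.
split.
- by apply: le_trans rD; rewrite -r2 expr2 ler_piMr// ltW.
- by rewrite -r2 expr2 -mulrA mulrC; apply: ler_pM => //; nonneg.
- exact: le_trans h1 ML.
split.
- by apply: le_trans e2D; rewrite expr2 ler_piMr// ltW.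
- by rewrite expr2 -mulrA mulrC; apply: ler_pM => //; nonneg.
- by rewrite -exprMn lerXn2r ?nnegrE//; nonneg.
- apply: (@le_trans _ _ (2 * M * D)); last by rewrite ler_wpM2r ?(ltW D0)// ler_wpM2l.
  (* [s = e1 * mu1] satisfies [s ^+ 2 <= e2 * M * s + M * e1], which a value above [2 * M * D]
     violates. *)
  rewrite leNgt; apply/negP => h.
  have m0 : 0 < e1 * mu1 by rewrite mulr_gt0.
  have a1 : e1 * mu1 * (2 * M * D) < e1 * (e1 * mu1 ^+ 2).
    by rewrite (_ : e1 * (_ * _) = e1 * mu1 * (e1 * mu1)) ?ltr_pM2l//; ring.
  have a2 := ler_wpM2l (ltW e10) hmu1.
  have a3 : r * (2 * M * D) <= e1 * mu1 * (2 * M * r).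
    rewrite [leRHS](_ : _ = r * (2 * M * (e1 * mu1))); last ring.
    rewrite ler_wpM2l ?(ltW r0)// ler_wpM2l//; first by nonneg.
    apply: (le_trans _ (ltW h)); rewrite -[leLHS]mul1r ler_wpM2r ?(ltW D0)//.
    by have := M1; lra.
  have a4 : M * e1 <= r * (M * D).
    by rewrite -r2 expr2 mulrCA ler_wpM2l ?(ltW r0)// ler_wpM2l// ltW.
  have a5 : e1 * (e2 * M * mu1) <= e1 * mu1 * (M * e2) by rewrite le_eqVlt; apply/orP; left; apply/eqP; ring.
  have a6 : 0 <= r * (M * D) by nonneg.
  have a7 : 0 <= e1 * mu1 * (M * e2) by nonneg.
  move: a1; rewrite (_ : e1 * mu1 * (2 * M * D) = 2 * (e1 * mu1 * (M * e2)) + e1 * mu1 * (2 * M * r)); last by rewrite /D -/r; ring.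
  by lra.
- have h : e2 * l <= e1 * mu1.
    rewrite -(ler_pM2r mu10) -[leRHS]mulrA -expr2; apply: le_trans hmu1'.
    by rewrite lerDl ltW.
  apply: (@le_trans _ _ (e2 / l)).
    rewrite ler_pdivlMr// mulrAC ler_pdivrMr// mulrAC ler_pdivrMr//.
    by rewrite expr2 -!mulrA ler_wpM2l ?(ltW e20)// [mu1 * _]mulrC.
  rewrite mulrC; apply: ler_pM => //; [by rewrite invr_ge0 ltW|exact: ltW|].
  by rewrite /L -[leLHS]mul1r ler_wpM2r// invr_ge0 ltW.
Qed.

(** The symbol at 1 gives [e1 * G ^+ 2 <= M * (e2 * G + 1)], while [e1 * mu1 ^+ 2] is at least
    [l * (e2 * mu1 + 1)]. Comparing the two forces [G] below [L * mu1], and [L] is at most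
    [4 * L ^+ 2]. *)
Lemma root_le (b1 c1 G : R) : mu1 <= G -> - e1 * G ^+ 2 + e2 * b1 * G + c1 = 0 ->
  b1 <= M -> c1 <= M -> G <= 4 * M ^+ 2 / l ^+ 2 * mu1.
Proof.
move=> muG root bM cM; have G0 : 0 < G by exact: lt_le_trans muG.
apply: (@le_trans _ _ (L * mu1)); last first.
  have -> : 4 * M ^+ 2 / l ^+ 2 = 4 * (L * L) by rewrite /L; field; rewrite lt0r_neq0.
  have : 1 * L <= L * L by rewrite ler_wpM2r ?(ltW L0)//; exact: le_trans ML.
  by have := ltW L0; move=> a b; rewrite ler_wpM2r ?(ltW mu10)//; lra.
rewrite leNgt; apply/negP => h.
have a1 : L * (e2 * l * mu1 + l) * G <= L * (e1 * mu1 ^+ 2) * G.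
  by rewrite ler_wpM2r ?(ltW G0)// ler_wpM2l// ltW.
have a2 : L * mu1 * (e1 * mu1 * G) < G * (e1 * mu1 * G).
  by rewrite ltr_pM2r// !mulr_gt0.
have a3 : e2 * G * mu1 * b1 <= e2 * G * mu1 * M by rewrite ler_wpM2l// !mulr_ge0 ?ltW.
have a4 : mu1 * c1 <= mu1 * M by rewrite ler_wpM2l// ltW.
have a5 : mu1 * M <= G * M by rewrite ler_wpM2r// ltW.
have a6 : e1 * G ^+ 2 * mu1 = (e2 * b1 * G + c1) * mu1 by congr (_ * _); lra.
have a7 : L * (e2 * l * mu1 + l) * G = (L * l) * (e2 * mu1 + 1) * G by ring.
by rewrite Ll in a7; lra.
Qed.

End Scales.

Section Regime.
Context {R : realType}.

Definition regime_const (S B Q L : R) : R :=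
  9 * S ^+ 2 * Q * L ^+ 2 + 9 * S ^+ 2 * Q ^+ 2 + 10 * B ^+ 2 * Q * L ^+ 2.

(** Matches each interpolation error with the scale that tames it: powers of [mu0] in [Gw] with [e1]
    or [e2 ^+ 2], the factor [mu1] in [GE] with [e1], and the factor [e2 ^+ 2 / e1] with the
    [1 / mu1] in [HE]. *)
Lemma regime_bounds (S B Q L e1 e2 mu0 mu1 nu D Gw Hw GE HE : R) :
  0 <= S -> 0 <= B -> 0 <= Q -> 1 <= L -> 0 < e1 -> 0 < e2 <= 1 -> 0 < mu0 -> 1 <= mu1 ->
  0 < D -> 0 < nu <= 1 ->
  [/\ e1 <= D, e1 * mu0 <= L * D, e1 * mu0 ^+ 2 <= L &
  [/\ e2 ^+ 2 <= D, e2 ^+ 2 * mu0 <= L * D, e2 ^+ 2 * mu0 ^+ 2 <= L ^+ 2,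
    e1 * mu1 <= 2 * L * D & e2 ^+ 2 / e1 / mu1 <= L * D]] ->
  Gw <= 3 * S ^+ 2 * Q * (mu0 * nu ^+ 2 + 2 * nu ^+ 2 + mu0 ^+ 2 * nu ^+ 4) ->
  Hw <= (3 * S * Q * nu ^+ 2) ^+ 2 ->
  GE <= 5 * B ^+ 2 * Q * mu1 * nu ^+ 2 ->
  0 <= HE <= 5 * B ^+ 2 * Q * nu ^+ 4 / mu1 ->
  let T := regime_const S B Q L * (D * nu ^+ 2 + nu ^+ 4) in
  [/\ e1 * Gw <= T, e2 ^+ 2 * Gw <= T, Hw <= T &
    [/\ e1 * GE <= T, HE <= T, e2 ^+ 2 * HE <= T & e2 ^+ 2 / e1 * HE <= T]].
Proof.
move=> S0 B0 Q0 L1 e10 /andP[e20 e21] mu00 mu11 D0 /andP[nu0 nu1].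
move=> [s1 s2 s3 [s4 s5 s6 s7 s8]] hGw hHw hGE /andP[HE0 hHE] T.
have mu10 : 0 < mu1 by exact: lt_le_trans mu11.
have L0 : 0 < L by exact: lt_le_trans L1.
have LL : L <= L ^+ 2 by rewrite expr2 ler_peMr// ltW.
have L1' : 1 <= L ^+ 2 by exact: le_trans LL.
set n2 := nu ^+ 2 in T hGw hHw hGE *; set n4 := nu ^+ 4 in T hGw hHE *.
have n20 : 0 <= n2 by exact: sqr_ge0.
have n40 : 0 <= n4 by rewrite exprn_ge0// ltW.
have n42 : n4 <= n2 by rewrite ler_wiXn2l// ltW.
have Dn : 0 <= D * n2 by rewrite mulr_ge0// ltW.
set Z := D * n2 + n4 in T *.
have Z0 : 0 <= Z by rewrite addr_ge0.
have a0 : 0 <= S ^+ 2 * Q by rewrite mulr_ge0 ?sqr_ge0.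
have b0 : 0 <= B ^+ 2 * Q by rewrite mulr_ge0 ?sqr_ge0.
have TE : T = 9 * (S ^+ 2 * Q) * (L ^+ 2 * Z) + 9 * (S ^+ 2 * Q) * (Q * Z) +
   10 * (B ^+ 2 * Q) * (L ^+ 2 * Z) by rewrite /T /regime_const; ring.
have LZ : Z <= L ^+ 2 * Z by rewrite ler_peMl.
have LLZ : L * Z <= L ^+ 2 * Z by rewrite ler_wpM2r.
have QZ : 0 <= Q * Z by rewrite mulr_ge0.
have c1 := mulr_ge0 a0 (le_trans Z0 LZ).
have c2 := mulr_ge0 a0 QZ.
have c3 := mulr_ge0 b0 (le_trans Z0 LZ).
have LD n : 0 <= n -> L * D * n <= L ^+ 2 * (D * n).
  by move=> h; rewrite -mulrA ler_wpM2r// mulr_ge0// ltW.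
have G1 (a : R) : 0 <= a -> a <= D -> a * mu0 <= L * D -> a * mu0 ^+ 2 <= L ^+ 2 -> a * Gw <= T.
  move=> a_ge k1 k2 k3; apply: (le_trans (ler_wpM2l a_ge hGw)).
  have t1 : a * mu0 * n2 <= L ^+ 2 * (D * n2).
    by apply: le_trans (LD _ n20); rewrite ler_wpM2r.
  have t2 : a * n2 <= L ^+ 2 * (D * n2).
    by apply: (@le_trans _ _ (D * n2)); [rewrite ler_wpM2r|rewrite ler_peMl].
  have t3 : a * mu0 ^+ 2 * n4 <= L ^+ 2 * n4 by rewrite ler_wpM2r.
  have t4 : 0 <= L ^+ 2 * n4 by rewrite mulr_ge0// (le_trans ler01).
  have t5 : a * mu0 * n2 + 2 * (a * n2) + a * mu0 ^+ 2 * n4 <= 3 * (L ^+ 2 * Z).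
    by rewrite /Z [L ^+ 2 * (_ + _)]mulrDr; lra.
  have := ler_wpM2l a0 t5; rewrite TE; lra.
have H2 : HE <= 5 * (B ^+ 2 * Q) * Z.
  apply: (le_trans hHE); rewrite ler_pdivrMr//.
  have k : n4 <= Z * mu1.
    by apply: (@le_trans _ _ Z); [rewrite lerDr|rewrite ler_peMr].
  by have := ler_wpM2l b0 k; lra.
have HT : HE <= T by have := ler_wpM2l b0 LZ; rewrite TE; lra.
split.
- by apply: G1 => //; [exact: ltW|exact: le_trans LL].
- by apply: G1 => //; exact: sqr_ge0.
- apply: (le_trans hHw); rewrite TE.
  have k : n2 ^+ 2 <= Z by rewrite -exprM lerDr.
  by have := ler_wpM2l (mulr_ge0 a0 Q0) k; lra.
split=> //.
- apply: (le_trans (ler_wpM2l (ltW e10) hGE)).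
  have k : e1 * mu1 * n2 <= 2 * (L ^+ 2 * Z).
    apply: (@le_trans _ _ (2 * (L * D * n2))).
      by rewrite mulrA mulrA ler_wpM2r.
    by have := LD _ n20; have := mulr_ge0 (le_trans ler01 L1') n40; rewrite /Z; lra.
  by have := ler_wpM2l b0 k; rewrite TE; lra.
- apply: le_trans HT; rewrite ler_piMl// -[leRHS](expr1n _ 2) lerXn2r ?nnegrE//.
  exact: ltW.
- have q0 : 0 <= e2 ^+ 2 / e1 by rewrite divr_ge0 ?sqr_ge0// ltW.
  apply: (le_trans (ler_wpM2l q0 hHE)).
  rewrite (_ : _ * (_ / mu1) = 5 * (B ^+ 2 * Q) * (e2 ^+ 2 / e1 / mu1 * n4)); last ring.
  have k : e2 ^+ 2 / e1 / mu1 * n4 <= L ^+ 2 * Z.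
    apply: (@le_trans _ _ (L * D * n2)).
      by apply: ler_pM => //; rewrite !divr_ge0 ?sqr_ge0 ?ltW.
    by have := LD _ n20; have := mulr_ge0 (le_trans ler01 L1') n40; rewrite /Z; lra.
  by have := ler_wpM2l b0 k; rewrite TE; lra.
Qed.

Lemma sqrt_regime (k D nu : R) : 0 <= k -> 0 <= D -> 0 <= nu ->
  Num.sqrt (k * (D * nu ^+ 2 + nu ^+ 4)) <=
  Num.sqrt k * Num.sqrt D * nu + Num.sqrt k * nu ^+ 2.
Proof.
move=> k0 D0 nu0; rewrite sqrtrM// -mulrA -mulrDr ler_wpM2l ?sqrtr_ge0//.
have s0 : 0 <= Num.sqrt D * nu by rewrite mulr_ge0 ?sqrtr_ge0.
have n0 : 0 <= nu ^+ 2 by exact: sqr_ge0.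
rewrite -[leRHS]ger0_norm ?addr_ge0// -sqrtr_sqr ler_wsqrtr//.
rewrite sqrrD exprMn sqr_sqrtr// -exprM lerD2r lerDl.
by rewrite mulrn_wge0// mulr_ge0.
Qed.

End Regime.

(** * The error bound in the two regimes of the convection parameter *)

Section Convergence.
Context {R : realType}.
Variables (l M p tau gamma : R) (b b1 b2 c c1 c2 f f1 f2 : R -> R).
Hypotheses (l01 : 0 < l <= 1) (M1 : 1 <= M) (p01 : 0 < p < 1) (tau52 : 5 / 2 <= tau)
  (gamma0 : 0 < gamma)
  (cb : {within Omega_bar, continuous b}) (cb1 : {within Omega_bar, continuous b1})
  (cc : {within Omega_bar, continuous c}) (cf : {within Omega_bar, continuous f})
  (db : forall x, Omega x -> der b x (b1 x)) (db1 : forall x, Omega x -> der b1 x (b2 x))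
  (dc : forall x, Omega x -> der c x (c1 x)) (dc1 : forall x, Omega x -> der c1 x (c2 x))
  (df : forall x, Omega x -> der f x (f1 x)) (df1 : forall x, Omega x -> der f1 x (f2 x))
  (bM : forall x, Omega_bar x -> `|b x| <= M) (b1M : forall x, Omega x -> `|b1 x| <= M)
  (b2M : forall x, Omega x -> `|b2 x| <= M)
  (cM : forall x, Omega_bar x -> `|c x| <= M) (c1M : forall x, Omega x -> `|c1 x| <= M)
  (c2M : forall x, Omega x -> `|c2 x| <= M)
  (fM : forall x, Omega_bar x -> `|f x| <= M) (f1M : forall x, Omega x -> `|f1 x| <= M)
  (f2M : forall x, Omega x -> `|f2 x| <= M)
  (lb : forall x, Omega_bar x -> l <= b x) (lc : forall x, Omega_bar x -> l <= c x).

Definition convergence_const : R :=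
  let kap := p * (1 - p) * l / 2 in let K := 4 * M ^+ 2 / l ^+ 2 in
  energy_const gamma M *
  regime_const (smooth_const (decomp_const M kap p K) kap p K) (M / kap * K * K ^+ 2)
    (mesh_const tau p ^+ 2 * p^-1 ^+ 2) (M / l).

Variables (e1 e2 mu0 mu1 : R) (N : nat) (u uN : R -> R).
Hypotheses (e101 : 0 < e1 < 1) (e201 : 0 < e2 < 1)
  (gc : forall x, Omega x -> gamma <= c x - 1 / 2 * e2 * b1 x)
  (hmu : layer_parameters e1 e2 b c mu0 mu1)
  (N16 : (16 <= N)%N) (dN : (4 %| N)%N)
  (s0 : sigma tau p mu0 <= 1 / 4) (s1 : sigma tau p mu1 <= 1 / 4)
  (Nmu : mu1^-1 <= mu0^-1 <= N%:R^-1)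
  (hu : bvp_solution e1 e2 b c f u)
  (huN : fem_solution e1 e2 b c f N (mesh tau p mu0 mu1 N) uN).

Let e10 : 0 < e1. Proof. by have /andP[] := e101. Qed.
Let e20 : 0 < e2. Proof. by have /andP[] := e201. Qed.
Let l0 : 0 < l. Proof. by have /andP[] := l01. Qed.
Let M0 : 0 < M. Proof. exact: lt_le_trans M1. Qed.
Let N0 : 0 < N%:R :> R. Proof. by rewrite ltr0n (leq_trans _ N16). Qed.
Let symbol := layer_parameters_symbol e10 e20 l0 lb lc bM cM hmu.
Let mu00 : 0 < mu0. Proof. by have [] := symbol. Qed.
Let mu10 : 0 < mu1. Proof. by have [] := symbol. Qed.
Let Nmu0 : N%:R <= mu0.
Proof. by have /andP[_] := Nmu; rewrite lef_pV2 ?posrE. Qed.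
Let mu01 : mu0 <= mu1.
Proof. by have /andP[] := Nmu; rewrite lef_pV2 ?posrE. Qed.
Let fm := bakhvalov_fine tau52 p01 N16 dN Nmu0 (le_trans Nmu0 mu01) s0 s1.
Let bMO x : Omega x -> `|b x| <= M. Proof. by move=> /Omega_sub; exact: bM. Qed.
Let cMO x : Omega x -> `|c x| <= M. Proof. by move=> /Omega_sub; exact: cM. Qed.
Let symbol0 : e1 * mu0 ^+ 2 + e2 * l * mu0 <= M.
Proof.
have [_ _ h _ _] := symbol; have O0 := @Omega_bar0 R.
have k1 := h 0 O0; have k2 := lb O0; have k3 := cM O0.
have : e2 * mu0 * l <= e2 * mu0 * b 0 by rewrite ler_wpM2l// mulr_ge0 ?ltW.
by have := ler_norm (c 0); lra.
Qed.
Let symbol1 : e1 * mu1 ^+ 2 <= e2 * M * mu1 + M.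
Proof.
have [_ _ _ h _] := symbol; have O0 := @Omega_bar0 R.
have k1 := h 0 O0; have k2 := bM O0; have k3 := cM O0.
have : e2 * mu1 * b 0 <= e2 * mu1 * M.
  rewrite ler_wpM2l//; first by nonneg.
  exact: le_trans (ler_norm _) k2.
by have := ler_norm (c 0); lra.
Qed.
Let mu11 : 1 <= mu1.
Proof.
by rewrite (le_trans _ mu01)// (le_trans _ Nmu0)// ler1n (leq_trans _ N16).
Qed.
Let e1le : 0 < e1 <= 1. Proof. by have /andP[-> /ltW ->] := e101. Qed.
Let e2le : 0 < e2 <= 1. Proof. by have /andP[-> /ltW ->] := e201. Qed.

Let mesh_const_ge1 : 1 <= mesh_const tau p.
Proof.
have /andP[p0 _] := p01; have tau0 : 0 <= tau by apply: le_trans tau52; lra.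
have : 0 <= (8 * (tau / p)) ^+ 5.
  by rewrite exprn_ge0// mulr_ge0// divr_ge0// ltW.
by rewrite /mesh_const; lra.
Qed.

Lemma convergence_small_eps2 : 4 * M * e2 <= (1 - p) * l ->
  energy_norm e1 (u \- uN) <= Num.sqrt (convergence_const *
    ((e2 + Num.sqrt e1) * N%:R^-1 ^+ 2 + N%:R^-1 ^+ 4)).
Proof.
move=> small; have [_ _ P0 P1 [Q0 Q1 [G muG rootG]]] := symbol.
have mu16 : 16 <= mu0 by apply: le_trans Nmu0; rewrite ler_nat.
have ly := layered_of_parameters l01 M1 p01 e10 e2le mu16 mu01 cb cc db db1 dc dc1
  bM b1M b2M cM c1M c2M lb lc P0 P1 Q0 Q1 small.
rewrite /convergence_const /=.
set kap := p * (1 - p) * l / 2 in ly *; set K := 4 * M ^+ 2 / l ^+ 2 in ly *.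
set S := smooth_const _ _ _ _; set B := M / kap * K * K ^+ 2.
have GK : mu1 <= G <= K * mu1.
  rewrite muG /=; apply: (root_le l01 M1 e1le e2le mu11 Q1 muG rootG).
    exact: le_trans (ler_norm _) (bM Omega_bar1).
  exact: le_trans (ler_norm _) (cM Omega_bar1).
have [u1 [cu1 du du1]] := bvp_solution_regular e10 cb cc cf hu.
have [[[dv hdv] u00 u10] _] := hu; have cu := weak_within hdv.
have sB := smooth''_le ly cf df df1 fM f1M f2M cu cu1 du du1 u00 u10 GK rootG.
have E0B := layer1_le ly fM cu cu1 du du1 u00 u10 GK.
have E1B := layer1'_le ly fM cu cu1 du du1 u00 u10 GK.
have E2B := layer1''_le ly fM cu cu1 du du1 u00 u10 GK.
have K1 := ly_K ly; have /andP[kap0 _] := ly_kap ly.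
have K0 : 0 < K by exact: lt_le_trans K1.
have ik0 : 0 < kap^-1 by rewrite invr_gt0.
have A0 : 0 <= M / kap * K by nonneg.
(* A single [B] is to serve [E] and its first two derivatives, whose bounds carry 1, [K] and
   [K ^+ 2]. *)
have KK : K <= K ^+ 2 by rewrite expr2 ler_peMr// ltW.
have K21 : 1 <= K ^+ 2 by exact: le_trans KK.
have B0 : 0 <= B by rewrite /B; nonneg.
have e_ge0 y : 0 <= decay1 (p * mu1) y by exact/ltW/decay1_gt0.
have E0B' y : Omega_bar y -> `|layer1 u1 G y| <= B * decay1 (p * mu1) y.
  by move=> Oy; apply: (le_trans (E0B y Oy)); rewrite ler_wpM2r// ler_peMr.
have E1B' y : Omega_bar y -> `|layer1' u1 G y| <= B * (mu1 * decay1 (p * mu1) y).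
  move=> Oy; apply: (le_trans (E1B y Oy)); rewrite -[leLHS]mulrA ler_wpM2r//.
    exact: mulr_ge0 (ltW mu10) (e_ge0 y).
  by rewrite ler_wpM2l.
have E2B' y : Omega y -> `|layer1'' u1 G y| <= B * (mu1 ^+ 2 * decay1 (p * mu1) y).
  by move=> /Omega_sub Oy; apply: (le_trans (E2B y Oy)); rewrite -[leLHS]mulrA.
have S0 : 0 <= S.
  have O0 := @Omega_bar0 R.
  rewrite -(pmulr_lge0 _ (_ : 0 < 1 + mu0 ^+ 2 * decay0 (p * mu0) 0 + mu1 * decay1 (p * mu1) 0)).
    exact: le_trans (normr_ge0 _) (sB 0 O0).
  apply: ltr_wpDr; first exact: mulr_ge0 (ltW mu10) (e_ge0 0).
  apply: ltr_wpDr; last exact: ltr01.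
  exact: mulr_ge0 (sqr_ge0 mu0) (ltW (decay0_gt0 _ _)).
have sBO y : Omega y -> `|smooth'' e1 e2 b c f u u1 G y| <=
    S * (1 + mu0 ^+ 2 * decay0 (p * mu0) y + mu1 * decay1 (p * mu1) y).
  by move=> /Omega_sub; exact: sB.
have cm1 := mesh_const_ge1.
have cw : {within Omega_bar, continuous (smooth u u1 G)} := within_smooth cu.
have cw1 : {within Omega_bar, continuous (smooth' u1 G)} := within_smooth' cu1.
have cE : {within Omega_bar, continuous (layer1 u1 G)} := @within_layer1 R u1 G.
have cE1 : {within Omega_bar, continuous (layer1' u1 G)} := @within_layer1' R u1 G.
have dw := der_smooth G du; have dw1 := der_smooth' ly G du1.
have dE y (_ : Omega y) := der_layer1 u1 G y.
have dE1 y (_ : Omega y) := der_layer1' u1 G y.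
have bw2 := smooth_interp_L2 fm cm1 p01 mu00 mu10 S0 cw cw1 dw dw1 sBO.
have bw1 := smooth_interp_H1 fm cm1 p01 mu00 mu10 S0 cw cw1 dw dw1 sBO.
have bE2 := layer_interp_L2 fm cm1 p01 mu10 B0 cE cE1 dE dE1 E0B' E2B'.
have bE1 := layer_interp_H1 fm cm1 p01 mu10 B0 cE cE1 dE dE1 E0B' E1B' E2B'.
have Q00 : 0 <= mesh_const tau p ^+ 2 * p^-1 ^+ 2 by rewrite mulr_ge0 ?sqr_ge0.
have L1 : 1 <= M / l.
  by rewrite ler_pdivlMr// mul1r; have /andP[_ h] := l01; exact: le_trans M1.
have D0 : 0 < e2 + Num.sqrt e1 by rewrite addr_gt0// sqrtr_gt0.
have nu01 : 0 < (N%:R^-1 : R) <= 1.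
  by rewrite invr_gt0 N0/= invf_le1// ler1n (leq_trans _ N16).
have sc := layer_scales l01 M1 e1le e2le mu00 mu11 symbol0 symbol1 Q1.
have HE : 0 <= ip (layer1 u1 G \- pl N (mesh tau p mu0 mu1 N)
    (layer_nodes (mesh tau p mu0 mu1 N) (3 * (N %/ 4)).+1 (layer1 u1 G)))
    (layer1 u1 G \- pl N (mesh tau p mu0 mu1 N)
    (layer_nodes (mesh tau p mu0 mu1 N) (3 * (N %/ 4)).+1 (layer1 u1 G)))
   <= 5 * B ^+ 2 * (mesh_const tau p ^+ 2 * p^-1 ^+ 2) * N%:R^-1 ^+ 4 / mu1.
  by rewrite ip_ge0.
have [r1 r2 r3 [r4 r5 r6 r7]] := regime_bounds S0 B0 Q00 L1 e10 e2le mu00 mu11 D0 nu01 sc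
  bw1 bw2 bE1 HE.
rewrite -mulrA; apply: (fem_energy_error e10 e20 gamma0 cb cc cb1 db gc bMO b1M cMO
  (fm_0 fm) (fm_N fm) (fm_gt fm) hu huN (weak_C1 cw cw1 dw) (weak_C1 cE cE1 dE)
  _ _ _ _ r1 r2 r3 r4 r5 r6 r7).
- by move=> y _; rewrite /smooth subrK.
- by rewrite /smooth u00 layer1_0 subr0.
- by [].
- by rewrite /layer_nodes leqNgt (fm_j fm) /= (fm_N fm).
Qed.

Lemma convergence_large_eps2 : (1 - p) * l < 4 * M * e2 ->
  energy_norm e1 (u \- uN) <= Num.sqrt (4 * (1 + 2 / gamma) * ((2 * gamma)^-1 * M ^+ 2)) *
    (4 * M ^+ 2 / ((1 - p) * l ^+ 2)) ^+ 2 * N%:R ^- 2.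
Proof.
move=> large; have /andP[p0 p1] := p01.
have q0 : 0 < 1 - p by rewrite subr_gt0.
have [u1 [cu1 du du1]] := bvp_solution_regular e10 cb cc cf hu.
have [[[dv hdv] _ _] _] := hu.
have f2' := L2_within cf.
apply: (le_trans (fem_stability e10 gamma0 cb cc cb1 db gc (fm_0 fm) (fm_N fm) (fm_gt fm)
  hdv hu huN f2')).
have ff : ip f f <= M ^+ 2 by apply: ip_le_cst => // x /Omega_sub; exact: fM.
have g2 : 0 <= 2 / gamma by rewrite divr_ge0// ltW.
have h1 : Num.sqrt (4 * (1 + 2 / gamma) * ((2 * gamma)^-1 * ip f f)) <=
    Num.sqrt (4 * (1 + 2 / gamma) * ((2 * gamma)^-1 * M ^+ 2)).
  rewrite ler_wsqrtr// ler_wpM2l//; first by rewrite mulr_ge0// addr_ge0.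
  by rewrite ler_wpM2l// invr_ge0 mulr_ge0// ltW.
apply: (le_trans h1); rewrite -[_ * _ * N%:R ^- 2]mulrA.
set Nm := 4 * M ^+ 2 / _.
(* [e2 * mu0 * l] is at most [M] and [e2] is bounded below in this regime, so [mu0], and with it
   [N], is bounded. *)
have NNm : N%:R <= Nm.
  apply: (le_trans Nmu0); rewrite /Nm ler_pdivlMr ?mulr_gt0 ?exprn_gt0//.
  have k1 := eps2_mu0 l01 e1le symbol0.
  have k2 : e2 * mu0 * l <= M by rewrite -ler_pdivlMr.
  have k3 : mu0 * l * ((1 - p) * l) <= mu0 * l * (4 * M * e2).
    by apply: ler_wpM2l (ltW large); apply: mulr_ge0; exact: ltW.
  have k4 : 4 * M * (e2 * mu0 * l) <= 4 * M * M by rewrite ler_wpM2l// mulr_ge0// ltW.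
  by lra.
(* The missing power of [N] comes from [1 <= (Nm / N) ^+ 2]. *)
rewrite -[leLHS]mulr1 ler_wpM2l ?sqrtr_ge0//.
rewrite -exprVn -exprMn -[leLHS](expr1n _ 2) lerXn2r ?nnegrE//.
  by rewrite divr_ge0 ?(le_trans _ NNm) ?ltW.
by rewrite ler_pdivlMr// mul1r.
Qed.

End Convergence.

Theorem theorem3 (R : realType) (q : nat) (b c f : R -> R)
    (lambda beta gamma p kappa tau : R)
    (hq : (3 <= q)%N) (hb : Cq q b) (hc : Cq q c) (hf : Cq q f)
    (hlambda : 0 < lambda) (hbeta : 0 < beta) (hgamma : 0 < gamma)
    (hblambda : forall x, Omega_bar x -> lambda <= b x)
    (hcbeta : forall x, Omega_bar x -> beta <= c x)
    (hp : 0 < p < 1) (hkappa : 0 < kappa < 1) (htau : 5 / 2 <= tau) :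
  exists2 C : R, 0 < C &
    forall (eps1 eps2 mu0 mu1 : R) (N : nat) (u uN : R -> R),
      0 < eps1 < 1 -> 0 < eps2 < 1 ->
      (forall x, Omega x -> gamma <= c x - 1 / 2 * eps2 * (b^`())%classic x) ->
      ((q%:R)%:E * Linfty_norm (b^`())%classic * eps2%:E <= (kappa * (1 - p))%:E)%E ->
      layer_parameters eps1 eps2 b c mu0 mu1 ->
      (16 <= N)%N -> (4 %| N)%N ->
      sigma tau p mu0 <= 1 / 4 -> sigma tau p mu1 <= 1 / 4 ->
      mu1^-1 <= mu0^-1 <= N%:R^-1 ->
      bvp_solution eps1 eps2 b c f u ->
      fem_solution eps1 eps2 b c f N (mesh tau p mu0 mu1 N) uN ->
      energy_norm eps1 (u \- uN)
        <= C * Num.sqrt (eps2 + Num.sqrt eps1) * N%:R^-1 + C * N%:R ^- 2.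
Proof.
have [b1 [b2 [Mb Mb1 [cb cb1 db db1 [[bM b1M b2M] b1E]]]]] := Cq_derivatives hq hb.
have [c1 [c2 [Mc Mc1 [cc _ dc dc1 [[cM c1M c2M] _]]]]] := Cq_derivatives hq hc.
have [f1 [f2 [Mf Mf1 [cf _ df df1 [[fM f1M f2M] _]]]]] := Cq_derivatives hq hf.
(* One upper bound for all data and one lower bound for [b] and [c], capped at 1 as the symbol
   estimates require. *)
pose M := Mb + Mc + Mf; pose l := Num.min 1 (Num.min lambda beta).
have M1 : 1 <= M by rewrite /M; lra.
have bound (g : R -> R) (A : set R) m : m <= M -> (forall x, A x -> `|g x| <= m) ->
    forall x, A x -> `|g x| <= M by move=> mM h x Ax; exact: le_trans (h x Ax) mM.
have boundO (g : R -> R) m : m <= M -> (forall x, Omega_bar x -> `|g x| <= m) ->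
    forall x, Omega x -> `|g x| <= M.
  by move=> mM h x /Omega_sub; exact: bound mM h x.
have MbM : Mb <= M by rewrite /M; lra.
have McM : Mc <= M by rewrite /M; lra.
have MfM : Mf <= M by rewrite /M; lra.
have l01 : 0 < l <= 1 by rewrite /l !lt_min ltr01 hlambda hbeta ge_min lexx.
have lb x : Omega_bar x -> l <= b x.
  by move=> Ox; apply: le_trans (hblambda x Ox); rewrite /l !ge_min lexx orbT.
have lc x : Omega_bar x -> l <= c x.
  by move=> Ox; apply: le_trans (hcbeta x Ox); rewrite /l !ge_min lexx !orbT.
pose C1 := Num.sqrt (convergence_const l M p tau gamma).
pose C2 := Num.sqrt (4 * (1 + 2 / gamma) * ((2 * gamma)^-1 * M ^+ 2)) *
    (4 * M ^+ 2 / ((1 - p) * l ^+ 2)) ^+ 2.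
have C10 : 0 <= C1 by exact: sqrtr_ge0.
have C20 : 0 <= C2 by rewrite mulr_ge0 ?sqrtr_ge0 ?sqr_ge0.
have C1C : C1 <= 1 + C1 + C2 by lra.
have C2C : C2 <= 1 + C1 + C2 by lra.
(* The summand 1 makes the constant positive; [C1] and [C2] belong to the two regimes. *)
exists (1 + C1 + C2); first by rewrite -addrA ltr_pwDl// addr_ge0.
move=> e1 e2 mu0 mu1 N u uN e101 e201 gc _ hmu N16 dN s0 s1 Nmu hu huN.
have gc1 x : Omega x -> gamma <= c x - 1 / 2 * e2 * b1 x.
  by move=> Ox; rewrite -b1E//; exact: gc.
set D := e2 + Num.sqrt e1.
have D0 : 0 <= D by rewrite addr_ge0 ?sqrtr_ge0//; have /andP[/ltW] := e201.
have nu0 : 0 <= N%:R^-1 :> R by rewrite invr_ge0.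
have sD : 0 <= Num.sqrt D * N%:R^-1 by rewrite mulr_ge0 ?sqrtr_ge0.
have nn : 0 <= N%:R ^- 2 :> R by rewrite invr_ge0 exprn_ge0.
have [small|large] := leP (4 * M * e2) ((1 - p) * l).
  have H := convergence_small_eps2 l01 M1 hp htau hgamma cb cb1 cc cf db db1 dc dc1 df df1
    (bound _ _ _ MbM bM) (boundO _ _ MbM b1M) (bound _ _ _ MbM b2M)
    (bound _ _ _ McM cM) (boundO _ _ McM c1M) (bound _ _ _ McM c2M)
    (bound _ _ _ MfM fM) (boundO _ _ MfM f1M) (bound _ _ _ MfM f2M)
    lb lc e101 e201 gc1 hmu N16 dN s0 s1 Nmu hu huN small.
  (* The sign of [convergence_const] is split here; were it negative, the square root would be 0 by
     convention and the bound would hold trivially. *)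
  apply: (le_trans H); case: (leP 0 (convergence_const l M p tau gamma)) => cc0; last first.
    rewrite ler0_sqrtr; last first.
      rewrite mulr_le0_ge0 ?(ltW cc0)// addr_ge0 ?exprn_ge0// mulr_ge0 ?exprn_ge0//.
    by rewrite addr_ge0// ?mulr_ge0 ?addr_ge0 ?sqrtr_ge0.
  apply: (le_trans (sqrt_regime cc0 D0 nu0)); rewrite -/C1 exprVn.
  by rewrite -!mulrA lerD// ler_wpM2r.
have H := convergence_large_eps2 l01 M1 hp htau hgamma cb cb1 cc cf db
    (bound _ _ _ MbM bM) (bound _ _ _ McM cM) (bound _ _ _ MfM fM)
    lb lc e101 e201 gc1 hmu N16 dN s0 s1 Nmu hu huN large.
apply: (le_trans H); rewrite -/C2.
have k1 : C2 * N%:R ^- 2 <= (1 + C1 + C2) * N%:R ^- 2 by rewrite ler_wpM2r.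
by rewrite (le_trans k1)// lerDr -mulrA mulr_ge0// !addr_ge0.
Qed.
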